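(* Let $f\in L^1([0,1],r\,dr)$ with $f\ge 0$. There exists a real number $\lambda_c>0$ such that for every $\lambda$ with $0<\lambda<\lambda_c$ the Navier problem $$\frac{1}{r}\left\{ r\left[\frac{1}{r}\left(r u'\right)'\right]'\right\}'=\frac{1}{r}\,u'u''+\lambda f(r),\qquad r\in(0,1),$$ $$u'(0)=0,\qquad u(1)=0,\qquad u''(1)+u'(1)=0,$$ has at least two solutions in $\hat{W}^{2,2}([0,1],r\,dr)$.
   Context: Here $'=d/dr$, and radial functions on the unit disk of $\mathbb{R}^2$ are identified with functions of $r\in[0,1]$. $L^1([0,1],r\,dr)$ is the space of functions on $[0,1]$ absolutely integrable against $r\,dr$. $W^{2,2}([0,1],r\,dr)$ is the space of radially symmetric $W^{2,2}$ functions on the unit disk, i.e. functions $u:[0,1]\to\mathbb{R}$ such that $u''$ and $u'/r$ are square integrable on $[0,1]$ against $r\,dr$, with norm given by $\|u\|^2=\int_0^1\left[u^2+(u')^2+(u'')^2+(u')^2/r^2\right]r\,dr$. $\mathring{W}^{1,2}([0,1],r\,dr)$ is the closure of the radially symmetric smooth functions compactly supported inside the unit ball of $\mathbb{R}^2$ in the norm given by $\int_0^1[u^2+(u')^2]\,r\,dr$. $\hat{W}^{2,2}([0,1],r\,dr)=W^{2,2}([0,1],r\,dr)\cap\mathring{W}^{1,2}([0,1],r\,dr)$, with the norm of $W^{2,2}([0,1],r\,dr)$ (so its elements satisfy $u(1)=0$). A solution is a function $u\in\hat{W}^{2,2}([0,1],r\,dr)$ satisfying the differential equation in the weak sense, i.e.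 $$\int_0^1\left(u''+\frac{u'}{r}\right)\left(\phi''+\frac{\phi'}{r}\right)r\,dr=\int_0^1 u'u''\phi\,dr+\lambda\int_0^1 f\phi\,r\,dr$$ for every radially symmetric smooth $\phi$ compactly supported inside the unit ball of $\mathbb{R}^2$, together with the listed boundary conditions, where $u''(1)+u'(1)=0$ is understood in the sense of traces, i.e. the trace of $u''+u'/r$ at $r=1$ is zero. *)

(* Defs.v *)
From mathcomp Require Import all_boot all_order all_algebra.
From mathcomp Require Import all_classical all_reals all_analysis.

Set Implicit Arguments.
Unset Strict Implicit.
Unset Printing Implicit Defensive.

Import Order.TTheory GRing.Theory Num.Theory.
Import numFieldNormedType.Exports.

Local Open Scope classical_set_scope.
Local Open Scope ring_scope.

(* A radial function on the unit disk is given by its profile R -> R, of which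
   only the values on [0, 1] matter. Elements of the function spaces below are
   functions, and two of them are identified when they agree almost everywhere
   on [0, 1]. *)

Fixpoint Ck (R : realType) (V : normedModType R) (k : nat) (F : V -> R) : Prop :=
  continuous F /\
  if k is m.+1 then forall v : V, (forall x, derivable F x v) /\ Ck m ('D_v F)
  else True.

Definition smooth (R : realType) (V : normedModType R) (F : V -> R) : Prop :=
  forall k, Ck k F.

(* Compactly supported smooth functions on the open interval (0, 1); they only
   serve to define weak derivatives with respect to r. *)
Definition test01 (R : realType) (phi : R -> R) : Prop :=
  smooth phi /\
  exists a b : R, [/\ 0 < a, b < 1 &
    forall x, x < a \/ b < x -> phi x = 0].

(* Profiles of the radial smooth functions with compact support in the open
   unit disk of R^2: smoothness is that of x |-> phi |x| on the plane. *)
Definition radial_test (R : realType) (phi : R -> R) : Prop :=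
  smooth (fun x : R * R => phi (Num.sqrt (x.1 ^+ 2 + x.2 ^+ 2))) /\
  exists2 rho : R, rho < 1 & forall r, 0 <= r -> rho <= r -> phi r = 0.

Section radial_spaces.
Context {R : realType}.
Local Notation mu := (@lebesgue_measure R).
Implicit Types f u v g du ddu : R -> R.

Definition L1r f : Prop :=
  measurable_fun (`[0, 1] : set R) f /\
  mu.-integrable `[0, 1] (EFin \o (fun r => f r * r)).

Definition L2r f : Prop :=
  measurable_fun (`[0, 1] : set R) f /\
  mu.-integrable `[0, 1] (EFin \o (fun r => f r ^+ 2 * r)).

(* [g] is the weak derivative of [u] on (0, 1). *)
Definition weak_deriv u g : Prop :=
  [/\ locally_integrable `]0, 1[ u, locally_integrable `]0, 1[ g &
      forall phi : R -> R, test01 phi ->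
        \int[mu]_(r in `]0, 1[) (u r * derive1 phi r) =
        - \int[mu]_(r in `]0, 1[) (g r * phi r)].

Definition W22 : set (R -> R) := [set u | exists du ddu,
  [/\ weak_deriv u du, weak_deriv du ddu &
      [/\ L2r u, L2r du, L2r ddu & L2r (fun r => du r / r)]]].

(* Closure of the radial test functions in the W^{1,2} norm. *)
Definition W12o : set (R -> R) := [set u | exists du,
  [/\ weak_deriv u du, L2r u, L2r du &
      forall e : R, 0 < e -> exists2 phi : R -> R, radial_test phi &
        (\int[mu]_(r in `[0%R, 1%R])
           (((u r - phi r) ^+ 2 + (du r - derive1 phi r) ^+ 2) * r)%:E < e%:E)%E]].

Definition hatW22 : set (R -> R) := W22 `&` W12o.

(* Sobolev trace at r = 1: [v] is W^{1,1} near 1, that is, it has there an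
   absolutely continuous representative, whose value at 1 is [c]. *)
Definition trace1 v (c : R) : Prop :=
  exists (a : R) (dv : R -> R),
    [/\ 0 <= a < 1, mu.-integrable `[a, 1] (EFin \o dv) &
        {ae mu, forall r, a < r < 1 ->
           v r = c - \int[mu]_(s in `[r, 1]) dv s}].

(* Boundary value at r = 0, taken as the limit of a representative: for u in
   W^{2,2}, u' is continuous up to r = 0, but u'' need not be integrable against
   dr, so that u' need not be W^{1,1} near 0. *)
Definition boundary_value0 v (c : R) : Prop :=
  exists2 w : R -> R,
    {ae mu, forall r, 0 < r < 1 -> v r = w r} & w r @[r --> 0^'+] --> c.

(* [du] and [ddu] stand for u' and u''; they are determined by [u] almost
   everywhere. *)
Definition navier_solution f (lambda : R) u : Prop :=
  hatW22 u /\
  exists du ddu, [/\ weak_deriv u du, weak_deriv du ddu,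
    (forall phi : R -> R, radial_test phi ->
       \int[mu]_(r in `[0, 1])
          ((ddu r + du r / r) * (derive1n 2 phi r + derive1 phi r / r) * r) =
       \int[mu]_(r in `[0, 1]) (du r * ddu r * phi r) +
       lambda * \int[mu]_(r in `[0, 1]) (f r * phi r * r)) &
    [/\ boundary_value0 du 0, trace1 u 0 &
        trace1 (fun r => ddu r + du r / r) 0]].

End radial_spaces.

(* Main.v *)
(* Shooting from the origin. Integrating the equation once, k = - (u'' + u'/r)
   satisfies k(1) = 0 and k' = - (u'^2 / 2 + F) / r with F(r) = lambda * int_0^r f t dt,
   while - r u'(r) = int_0^r k t dt. Subtracting from k the explicit, possibly
   unbounded, part int_r^1 F / t leaves a Volterra equation for a bounded
   nonincreasing function with free initial value c, solved by Picard iteration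
   in a weighted supremum norm and depending continuously on c. Its value at 1
   is nonpositive for c = 0, positive for c = 1 when lambda is small, and
   nonpositive again for c large, because otherwise - r u' would grow by a fixed
   amount on each of arbitrarily many dyadic intervals although it is bounded a
   priori. The intermediate value theorem gives two zeros, hence two solutions,
   and c can be recovered from u. *)
Require Import Defs.
From mathcomp Require Import all_boot all_order all_algebra.
From mathcomp Require Import all_classical all_reals all_analysis.
From mathcomp Require Import measurable_realfun zify ring lra.

Set Implicit Arguments.
Unset Strict Implicit.
Unset Printing Implicit Defensive.

Import Order.TTheory GRing.Theory Num.Theory.
Import numFieldNormedType.Exports.

Local Open Scope classical_set_scope.
Local Open Scope ring_scope.

(** * Integrals over intervals *)

Section toolkit.
Context {R : realType}.
Local Notation mu := (@lebesgue_measure R).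
Implicit Types (a b c x y r M : R) (f g h : R -> R).

(** Behind the second zero is a scale-invariant Riccati inequality. Put y = - r u' and s = log r. As
    long as k is nonnegative, k(r) is at least the integral of y^2 / (2 t^3) over [r, 2r], which is
    of order y^2 / r^2, and r y' >= k r^2 then gives dy/ds >= const * y^2. A start of size B makes y
    of order one already at r of order B^(-1/2), so the range of s left before r = 1 has length of
    order log B, which is too long for a bounded y. The dyadic steps are a discrete form of this
    inequality.

    The obstacle at the origin is that f is only integrable: F is bounded, but F / r need not be
    integrable, so k and u'' may be unbounded. The weight r in the quadratic term absorbs this,
    since r a^2 stays bounded for the part a of - u' / r that comes from the source.

    Membership in the closure of the radial test functions raises another difficulty: a profile
    smooth in r need not be smooth on the plane at the origin. The approximations are therefore
    built as smooth functions of r^2. *)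

Lemma eq_le_refl x y : x = y -> x <= y.
Proof. by move=> ->. Qed.

Lemma mu_itv_cc a b : a <= b -> mu `[a, b] = (b - a)%:E.
Proof.
move=> ab; rewrite lebesgue_measure_itv/= lte_fin.
case: ltP => // ba; have -> : a = b by apply/eqP; rewrite eq_le ab ba.
by rewrite subrr.
Qed.

Lemma bounded_integrable a b M f : measurable_fun `[a, b] f ->
  (forall x, a <= x <= b -> `|f x| <= M) ->
  mu.-integrable `[a, b] (EFin \o f).
Proof.
move=> mf fM; apply: measurable_bounded_integrable => //.
  by apply: compact_finite_measure; exact: segment_compact.
exists M; split; first exact: num_real.
by move=> N MN x /=; rewrite in_itv/= => /fM /le_trans; apply; exact: ltW.
Qed.

Lemma integrable_sub a b c d f : a <= c -> d <= b ->
  mu.-integrable `[a, b] (EFin \o f) -> mu.-integrable `[c, d] (EFin \o f).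
Proof.
move=> ac db; apply: integrableS => // x /=; rewrite !in_itv/= => /andP[cx xd].
by rewrite (le_trans ac cx) (le_trans xd db).
Qed.

Lemma measurable_sub a b c d f : a <= c -> d <= b ->
  measurable_fun (`[a, b] : set R) f -> measurable_fun (`[c, d] : set R) f.
Proof.
move=> ac db; apply: measurable_funS => // x /=.
rewrite !in_itv/= => /andP[cx xd].
by rewrite (le_trans ac cx) (le_trans xd db).
Qed.

Lemma integrable_addr (D : set R) f g : measurable D ->
  mu.-integrable D (EFin \o f) -> mu.-integrable D (EFin \o g) ->
  mu.-integrable D (EFin \o (fun x => f x + g x)).
Proof.
move=> mD intf intg.
rewrite (_ : _ \o _ = (EFin \o f) \+ (EFin \o g))%E; first exact: integrableD.
by apply/funext => x; rewrite /= EFinD.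
Qed.

Lemma integrable_subr (D : set R) f g : measurable D ->
  mu.-integrable D (EFin \o f) -> mu.-integrable D (EFin \o g) ->
  mu.-integrable D (EFin \o (fun x => f x - g x)).
Proof.
move=> mD intf intg.
rewrite (_ : _ \o _ = (EFin \o f) \- (EFin \o g))%E; first exact: integrableB.
by apply/funext => x; rewrite /= EFinB.
Qed.

Lemma integrable_scaler (D : set R) M f : measurable D ->
  mu.-integrable D (EFin \o f) ->
  mu.-integrable D (EFin \o (fun x => M * f x)).
Proof.
move=> mD intf.
rewrite (_ : _ \o _ = (fun x => M%:E * (EFin \o f) x))%E; first exact: integrableZl.
by apply/funext => x; rewrite /= EFinM.
Qed.

Lemma Rintegral_cstE a b M : a <= b -> \int[mu]_(x in `[a, b]) M = M * (b - a).
Proof. by move=> ab; rewrite Rintegral_cst//= mu_itv_cc. Qed.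

Lemma cst_integrable a b M : mu.-integrable `[a, b] (EFin \o cst M).
Proof. exact: (@bounded_integrable _ _ `|M|). Qed.

Lemma Rintegral_le_cst a b M f : a <= b ->
  mu.-integrable `[a, b] (EFin \o f) ->
  (forall x, a <= x <= b -> f x <= M) ->
  \int[mu]_(x in `[a, b]) f x <= M * (b - a).
Proof.
move=> ab intf fM; rewrite -Rintegral_cstE//; apply: le_Rintegral => //; exact: cst_integrable.
Qed.

Lemma Rintegral_ge_cst a b M f : a <= b ->
  mu.-integrable `[a, b] (EFin \o f) ->
  (forall x, a <= x <= b -> M <= f x) ->
  M * (b - a) <= \int[mu]_(x in `[a, b]) f x.
Proof.
move=> ab intf fM; rewrite -Rintegral_cstE//; apply: le_Rintegral => //; exact: cst_integrable.
Qed.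

Lemma Rintegral_norm_le_cst a b M f : a <= b ->
  mu.-integrable `[a, b] (EFin \o f) ->
  (forall x, a <= x <= b -> `|f x| <= M) ->
  `|\int[mu]_(x in `[a, b]) f x| <= M * (b - a).
Proof.
move=> ab intf fM; rewrite ler_norml -mulNr.
rewrite Rintegral_le_cst ?Rintegral_ge_cst// => x /fM; rewrite ler_norml.
  by move=> /andP[].
by move=> /andP[].
Qed.

Lemma le_Rintegral_itv a b f g :
  mu.-integrable `[a, b] (EFin \o f) -> mu.-integrable `[a, b] (EFin \o g) ->
  (forall x, a <= x <= b -> f x <= g x) ->
  \int[mu]_(x in `[a, b]) f x <= \int[mu]_(x in `[a, b]) g x.
Proof.
by move=> intf intg fg; apply: le_Rintegral.
Qed.

Lemma eq_Rintegral_itv a b f g : (forall x, a <= x <= b -> f x = g x) ->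
  \int[mu]_(x in `[a, b]) f x = \int[mu]_(x in `[a, b]) g x.
Proof.
by move=> fg; apply: eq_Rintegral => x; rewrite inE/= in_itv/=; exact: fg.
Qed.

Lemma Rintegral_itv_ge0 a b f : (forall x, a <= x <= b -> 0 <= f x) ->
  0 <= \int[mu]_(x in `[a, b]) f x.
Proof. by move=> f0; apply: Rintegral_ge0 => x /=; rewrite in_itv/=; exact: f0. Qed.

Lemma Rintegral_nil a f : \int[mu]_(x in `[a, a]) f x = 0.
Proof. by rewrite set_itv1 Rintegral_set1. Qed.

Lemma Rintegral_split b a c f : a <= b -> b <= c ->
  mu.-integrable `[a, c] (EFin \o f) ->
  \int[mu]_(x in `[a, c]) f x =
  \int[mu]_(x in `[a, b]) f x + \int[mu]_(x in `[b, c]) f x.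
Proof.
move=> ab bc intf; apply/eqP; rewrite addrC -subr_eq; apply/eqP.
have := @Rintegral_itvB R f (BLeft a) (BRight c) b.
rewrite /= => -> //.
by apply: Rintegral_itv_obnd_cbnd; apply: integrableS intf => // x /=;
  rewrite !in_itv/= => /andP[bx ->]; rewrite (le_trans ab)// ltW.
Qed.

Lemma is_derive_Rintegral_ub a b x f : a < x < b ->
  mu.-integrable `[a, b] (EFin \o f) -> {for x, continuous f} ->
  is_derive x 1 (fun r => \int[mu]_(t in `[a, r]) f t) (f x).
Proof.
move=> /andP[ax xb] intf cf.
have [df dE] := continuous_FTC1_closed xb intf ax cf.
by apply: DeriveDef; [exact: df|rewrite -derive1E].
Qed.

Lemma near_itvoo a b x : a < x < b -> \forall r \near x, a < r < b.
Proof.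
move=> /andP[ax xb].
have : x \in `]a, b[ by rewrite in_itv/= ax xb.
by move=> /near_in_itvoo; apply: filterS => r; rewrite in_itv.
Qed.

Lemma is_derive_near f g x df : (\near x, f x = g x) ->
  is_derive x 1 f df -> is_derive x 1 g df.
Proof.
move=> fg [dfx dE]; apply: DeriveDef.
  by apply: near_eq_derivable dfx.
by rewrite -dE; apply/esym; exact: near_eq_derive.
Qed.

Lemma is_derive_Rintegral_lb a b x f : a < x < b ->
  mu.-integrable `[a, b] (EFin \o f) -> {for x, continuous f} ->
  is_derive x 1 (fun r => \int[mu]_(t in `[r, b]) f t) (- f x).
Proof.
move=> axb intf cf.
apply: (@is_derive_near (cst (\int[mu]_(t in `[a, b]) f t) -
                         (fun r => \int[mu]_(t in `[a, r]) f t))).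
  near=> r; have /andP[ar rb] : a < r < b by near: r; exact: near_itvoo.
  by rewrite !fctE (@Rintegral_split r a b)// ?(ltW ar) ?(ltW rb)// addrC addKr.
have ? := is_derive_Rintegral_ub axb intf cf.
by apply: is_derive_eq; rewrite add0r.
Unshelve. all: by end_near. Qed.

Lemma is_derive_continuous f x df : is_derive x 1 f df -> {for x, continuous f}.
Proof.
by move=> [dfx _]; apply: differentiable_continuous; apply/derivable1_diffP.
Qed.

Lemma continuous_itv_measurable a b f :
  (forall x, a < x < b -> {for x, continuous f}) -> measurable_fun `[a, b] f.
Proof.
move=> cf; apply: (@measurable_fun_itv_cc R a b false true).
apply: open_continuous_measurable_fun; first exact: interval_open.
by move=> x; rewrite inE/= in_itv/=; exact: cf.
Qed.

(* The integrand need only be integrable at the end points, where the primitive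
   is replaced by its limits. *)
Lemma improper_FTC a b h P la lb : a < b ->
  mu.-integrable `[a, b] (EFin \o h) ->
  (forall x, a < x < b -> {for x, continuous h}) ->
  (forall x, a < x < b -> is_derive x 1 P (h x)) ->
  P x @[x --> a^'+] --> la -> P x @[x --> b^'-] --> lb ->
  \int[mu]_(x in `[a, b]) h x = lb - la.
Proof.
move=> ab inth ch dP Pa Pb.
pose I x := \int[mu]_(t in `[a, x]) h t.
pose m := (a + b) / 2.
have am : a < m by rewrite /m; lra.
have mb : m < b by rewrite /m; lra.
have dD x : a < x < b -> is_derive x 1 (P - I) 0.
  move=> axb; have ? := dP _ axb.
  have ? := is_derive_Rintegral_ub axb inth (ch _ axb).
  by apply: is_derive_eq; rewrite subrr.
(* [P] and the primitive [I] differ by a constant inside the interval, so the end points matter only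
   through limits, and those of [I] are known from integrability alone. *)
have cst x : a < x < b -> P x = I x + (P m - I m).
  move=> axb; suff : P x - I x = P m - I m.
    by move=> /eqP; rewrite subr_eq addrC => /eqP.
  case/andP: axb => ax xb; have [mx|xm] := leP m x.
    have [||c _] := @MVT_segment R (P - I) (fun=> 0) m x mx.
    - move=> y; rewrite in_itv/= => /andP[my yx]; apply: dD.
      by rewrite (lt_trans am my) (lt_trans yx xb).
    - apply: derivable_within_continuous => y; rewrite in_itv/= => /andP[my yx].
      apply: (@ex_derive _ _ _ _ _ _ 0); apply: dD.
      by rewrite (lt_le_trans am my) (le_lt_trans yx xb).
    by rewrite mul0r => /eqP; rewrite subr_eq0 => /eqP Pxm; exact: Pxm.
  have [||c _] := @MVT_segment R (P - I) (fun=> 0) x m (ltW xm).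
  - move=> y; rewrite in_itv/= => /andP[my yx]; apply: dD.
    by rewrite (lt_trans ax my) (lt_trans yx mb).
  - apply: derivable_within_continuous => y; rewrite in_itv/= => /andP[my yx].
    apply: (@ex_derive _ _ _ _ _ _ 0); apply: dD.
    by rewrite (lt_le_trans ax my) (le_lt_trans yx mb).
  by rewrite mul0r => /eqP; rewrite subr_eq0 => /eqP Pmx; apply/esym; exact: Pmx.
set k := P m - I m in cst.
have Ia : I x @[x --> a^'+] --> 0.
  by apply: cvg_at_right_filter; exact: (parameterized_integral_cvg_left ab inth).
have Ib : I x @[x --> b^'-] --> \int[mu]_(x in `[a, b]) h x.
  exact: (parameterized_integral_cvg_at_left ab inth).
have Pa' : P x @[x --> a^'+] --> 0 + k.
  apply: cvg_trans (cvgD Ia (cvg_cst k)); apply: near_eq_cvg; near=> x.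
  rewrite cst//; apply/andP; split; first by near: x; exact: nbhs_right_gt.
  by near: x; exact: nbhs_right_lt.
have Pb' : P x @[x --> b^'-] --> \int[mu]_(x in `[a, b]) h x + k.
  apply: cvg_trans (cvgD Ib (cvg_cst k)); apply: near_eq_cvg; near=> x.
  rewrite cst//; apply/andP; split; last by near: x; exact: nbhs_left_lt.
  by near: x; exact: nbhs_left_gt.
have -> : la = k by rewrite -(add0r k); apply: (cvg_unique _ Pa Pa'); exact: Rhausdorff.
have -> : lb = \int[mu]_(x in `[a, b]) h x + k.
  by apply: (cvg_unique _ Pb Pb'); exact: Rhausdorff.
by rewrite addrK.
Unshelve. all: by end_near. Qed.

End toolkit.

(** * Averages and Picard iteration *)

Section picard.
Context {R : realType}.
Local Notation mu := (@lebesgue_measure R).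
Implicit Types (r c B C D : R) (k : R -> R).

Lemma primitive_measurable (f : R -> R) : mu.-integrable `[0, 1] (EFin \o f) ->
  measurable_fun (`[0, 1] : set R) (fun r => \int[mu]_(t in `[0, r]) f t).
Proof.
move=> intf; apply: subspace_continuous_measurable_fun => //.
exact: (parameterized_integral_continuous ler01 intf).
Qed.

(** The increments from [n] on add up to at most [2 * D / 2 ^+ n]. Shifting [u n] down and up by
    this amount gives a nondecreasing and a nonincreasing sequence, and the limit is the supremum of
    the first. Applied pointwise with its explicit rate, this replaces completeness of a function
    space. *)
Lemma halving_limit (u : R^nat) D :
  (forall n, `|u n.+1 - u n| <= D / 2 ^+ n) ->
  exists l, forall n, `|l - u n| <= 2 * D / 2 ^+ n.
Proof.
move=> uD; pose e n : R := D / 2 ^+ n.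
have eS n : e n.+1 = e n / 2 by rewrite /e exprS invfM mulrCA mulrC.
have D0 n : 0 <= e n by rewrite (le_trans _ (uD n)).
pose v n := u n - 2 * e n; pose w n := u n + 2 * e n.
have vS n : v n <= v n.+1.
  by rewrite /v; have := uD n; rewrite -/(e n) eS ler_norml => /andP[]; lra.
have wS n : w n.+1 <= w n.
  by rewrite /w; have := uD n; rewrite -/(e n) eS ler_norml => /andP[]; lra.
have vm : {homo v : n m / (n <= m)%N >-> n <= m}.
  by apply: homo_leq => //; exact: le_trans.
have wm : {homo w : n m / (n <= m)%N >-> m <= n}.
  by apply: homo_leq => // x y z xy yz; exact: le_trans yz xy.
have vw n m : v n <= w m.
  rewrite (le_trans (vm _ _ (leq_maxl n m)))//.
  rewrite (le_trans _ (wm _ _ (leq_maxr n m)))// /v /w.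
  by have := D0 (maxn n m); lra.
have vub m : ubound (range v) (w m) by move=> _ [n _ <-].
exists (sup (range v)) => n; rewrite ler_norml.
have -> : 2 * D / 2 ^+ n = 2 * e n by rewrite mulrA.
apply/andP; split.
  have : v n <= sup (range v).
    by apply: (@ub_le_sup _ (range v)); [exists (w 0%N)|exists n].
  by rewrite /v; lra.
have : sup (range v) <= w n by apply: ge_sup => //; exists (v 0%N); exists 0%N.
by rewrite /w; lra.
Qed.

Lemma halving_cvg0 D : (fun n => D / 2 ^+ n) @ \oo --> 0.
Proof.
rewrite (_ : (fun n => _) = geometric D (2^-1)); last first.
  by apply/funext => n; rewrite /= exprVn.
by apply: cvg_geometric; rewrite ger0_norm; lra.
Qed.

Lemma halving_le0 x D : (forall n, x <= D / 2 ^+ n) -> x <= 0.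
Proof.
move=> xD; have := halving_cvg0 D; move=> /cvgP/limr_ge/(_ (nearW _ xD)) => h.
by have := cvg_lim (@Rhausdorff R) (halving_cvg0 D) => E; move: h; rewrite E.
Qed.

Definition bounded_by C k :=
  measurable_fun (`[0, 1] : set R) k /\ forall r, 0 <= r <= 1 -> `|k r| <= C.

Lemma bounded_by_int C k r : bounded_by C k -> r <= 1 ->
  mu.-integrable `[0, r] (EFin \o k).
Proof.
move=> [mk kC] r1; apply: (@integrable_sub _ 0 1) => //.
exact: bounded_integrable kC.
Qed.

Lemma bounded_byMid C k : bounded_by C k -> bounded_by C (fun t => k t * t).
Proof.
move=> [mk kC]; split; first exact: measurable_funM.
move=> r /[dup] /kC kr /andP[r0 r1].
by rewrite normrM (ger0_norm r0) (le_trans _ kr)// ler_piMr.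
Qed.

Lemma bounded_byB C C' k k' : bounded_by C k -> bounded_by C' k' ->
  bounded_by (C + C') (fun t => k t - k' t).
Proof.
move=> [mk kC] [mk' kC']; split; first exact: measurable_funB.
by move=> r r01; rewrite (le_trans (ler_normB _ _))// lerD ?kC ?kC'.
Qed.

(** Half the mean of the radial function [k] over the disk of radius [r], which is [- u' / r] when
    [k] is minus the Laplacian of [u]. The bounds below estimate [t] by [r] under the integral and
    so give up the factor two. At [r = 0] the value is [0]. *)
Definition disk_avg k r := (\int[mu]_(t in `[0, r]) (k t * t)) / r ^+ 2.

Lemma disk_avg_le C k r B : bounded_by C k -> 0 <= r <= 1 -> 0 <= B ->
  (forall t, 0 <= t <= r -> k t <= B) -> disk_avg k r <= B.
Proof.
move=> kC /andP[r0 r1] B0 kB; rewrite /disk_avg.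
move: r0; rewrite le_eqVlt => /predU1P[<-|r0]; first by rewrite expr0n/= invr0 mulr0.
rewrite ler_pdivrMr ?exprn_gt0//.
have -> : B * r ^+ 2 = (B * r) * (r - 0) by ring.
apply: Rintegral_le_cst; first exact: ltW.
  exact: (bounded_by_int (bounded_byMid kC)).
move=> t /[dup] t01 /andP[t0 tr]; rewrite (@le_trans _ _ (B * t))//.
  by rewrite ler_wpM2r// kB.
by rewrite ler_wpM2l.
Qed.

Lemma disk_avg_norm_le C k r B : bounded_by C k -> 0 <= r <= 1 -> 0 <= B ->
  (forall t, 0 <= t <= r -> `|k t| <= B) -> `|disk_avg k r| <= B.
Proof.
move=> kC /andP[r0 r1] B0 kB; rewrite /disk_avg.
move: r0; rewrite le_eqVlt => /predU1P[<-|r0].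
  by rewrite expr0n/= invr0 mulr0 normr0.
rewrite normrM normfV (ger0_norm (sqr_ge0 r)) ler_pdivrMr ?exprn_gt0//.
have -> : B * r ^+ 2 = (B * r) * (r - 0) by ring.
apply: Rintegral_norm_le_cst; first exact: ltW.
  exact: (bounded_by_int (bounded_byMid kC)).
move=> t /[dup] t01 /andP[t0 tr]; rewrite (@le_trans _ _ (B * t))//.
  by rewrite normrM (ger0_norm t0) ler_wpM2r// kB.
by rewrite ler_wpM2l.
Qed.

Lemma disk_avgB C C' k k' r : bounded_by C k -> bounded_by C' k' ->
  0 <= r <= 1 -> disk_avg (fun t => k t - k' t) r = disk_avg k r - disk_avg k' r.
Proof.
move=> kC kC' /andP[r0 r1]; rewrite /disk_avg -mulrBl; congr (_ / _).
rewrite -RintegralB//=; first by apply: eq_Rintegral => t _; rewrite mulrBl.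
  exact: (bounded_by_int (bounded_byMid kC)).
exact: (bounded_by_int (bounded_byMid kC')).
Qed.

Lemma disk_avg_measurable C k : bounded_by C k ->
  measurable_fun (`[0, 1] : set R) (disk_avg k).
Proof.
move=> kC; apply: measurable_funM.
  by apply: primitive_measurable; exact: (bounded_by_int (bounded_byMid kC)).
apply: continuous_itv_measurable => x /andP[x0 _].
have x20 : x ^+ 2 != 0 by rewrite expf_neq0// gt_eqF.
have : {for x, continuous (fun y : R => y ^+ 2)} by exact: exprn_continuous.
exact: cvgV.
Qed.

Lemma expR_primitive_le (K r : R) : 0 < K -> 0 <= r ->
  \int[mu]_(t in `[0, r]) expR (K * t) <= expR (K * r) / K.
Proof.
move=> K0; rewrite le_eqVlt => /predU1P[<-|r0].
  by rewrite Rintegral_nil divr_ge0 ?expR_ge0// ltW.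
have cexp : continuous (fun t : R => expR (K * t)).
  move=> t; apply: continuous_comp; last exact: continuous_expR.
  exact: mulrl_continuous.
pose P t := expR (K * t) / K.
have dP (t : R) : is_derive t (1 : R) P (expR (K * t)).
  have d1 : is_derive t (1 : R) (fun x : R => K * x) K.
    have ? : is_derive t (1 : R) (@id R) 1 by exact: is_derive_id.
    by apply: is_derive_eq; exact: mulr1.
  have d2 := @is_derive1_comp R expR _ t _ _ (is_derive_expR _) d1.
  have -> : P = K^-1 \*: (expR \o (fun x : R => K * x)).
    by apply/funext => x; rewrite /P mulrC.
  apply: is_derive_eq; rewrite [_ *: _]mulrC.
  by rewrite -mulrA divff ?mulr1// gt_eqF.
have cP := fun t => is_derive_continuous (dP t).
rewrite (@improper_FTC R 0 r _ P (P 0) (P r))//.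
- by rewrite lerBlDr lerDl divr_ge0 ?expR_ge0// ltW.
- apply: continuous_compact_integrable; first exact: segment_compact.
  exact: continuous_subspaceT.
- by move=> t _; exact: cexp.
- by apply: cvg_at_right_filter; exact: cP.
- by apply: cvg_at_left_filter; exact: cP.
Qed.

End picard.

(** * Shooting *)

Section shooting.
Context {R : realType}.
Local Notation mu := (@lebesgue_measure R).
(** [a] will be the [disk_avg] of the explicit part of [k] and may blow up at the origin. Control of
    [a r ^+ 2 * r] is what keeps the quadratic [force] bounded; in the application [e] is four times
    the total mass of the source. *)
Variables (a : R -> R) (e : R).
Hypothesis a_meas : measurable_fun (`[0, 1] : set R) a.
Hypothesis a_ge0 : forall r, 0 <= r <= 1 -> 0 <= a r.
Hypothesis a_le : forall r, 0 <= r <= 1 -> a r ^+ 2 * r <= e ^+ 2.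
Hypothesis e_ge0 : 0 <= e.
Hypothesis e_le : e <= 8^-1.
Implicit Types (r c B C D : R) (k : R -> R).

(* With [a] the contribution of the source, [slope k r] stands for [- u'(r) / r]
   and the fixed points of [shoot c] solve the initial value problem. Keeping
   only the positive part of the slope bounds every shot from above by [c]; it
   changes nothing for a shot ending at [0], whose slope is nonnegative. *)
Definition slope k r := a r + disk_avg k r.

Definition force k r := Num.max 0 (slope k r) ^+ 2 * r / 2.

Definition shoot c k r := c - \int[mu]_(t in `[0, r]) force k t.

Lemma a_mid_le r : 0 <= r <= 1 -> a r * r <= e.
Proof.
move=> /[dup] r01 /andP[r0 r1].
have ar0 : 0 <= a r * r by rewrite mulr_ge0// a_ge0.
rewrite -(@ler_pXn2r _ 2)// ?nnegrE// exprMn.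
rewrite (le_trans _ (a_le r01))// (expr2 r) mulrA ler_piMr//.
by rewrite mulr_ge0// sqr_ge0.
Qed.

Lemma force_ge0 k r : 0 <= r -> 0 <= force k r.
Proof. by move=> r0; rewrite /force divr_ge0// mulr_ge0// sqr_ge0. Qed.

Lemma force_meas C k : bounded_by C k ->
  measurable_fun (`[0, 1] : set R) (force k).
Proof.
move=> kC; apply: measurable_funM => //; apply: measurable_funM => //.
apply: measurable_funX; apply: measurable_maxr => //.
by apply: measurable_funD => //; exact: disk_avg_measurable kC.
Qed.

Lemma max_slope_le C B k r : bounded_by C k -> 0 <= r <= 1 -> 0 <= B ->
  (forall t, 0 <= t <= r -> k t <= B) ->
  0 <= Num.max 0 (slope k r) <= a r + B.
Proof.
move=> kC r01 B0 kB; rewrite le_max lexx/= ge_max.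
rewrite addr_ge0 ?a_ge0//= lerD2l.
exact: (disk_avg_le kC r01 B0 kB).
Qed.

(** Expand [(a r + B) ^+ 2 * r]. The factor [r] is kept on the [B ^+ 2] term because a large start
    is followed up to a radius with [B * r ^+ 2 = 1/4], where this term integrates to a fraction of
    [B] only. *)
Lemma force_le C B k r : bounded_by C k -> 0 <= r <= 1 -> 0 <= B ->
  (forall t, 0 <= t <= r -> k t <= B) ->
  force k r <= (e ^+ 2 + 2 * B * e + B ^+ 2 * r) / 2.
Proof.
move=> kC /[dup] r01 /andP[r0 r1] B0 kB.
have /andP[m0 mB] := max_slope_le kC r01 B0 kB.
rewrite /force ler_pM2r//.
apply: (@le_trans _ _ ((a r + B) ^+ 2 * r)).
  by rewrite ler_wpM2r// ler_pXn2r// nnegrE// (le_trans m0).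
have := a_le r01; have := a_mid_le r01.
have -> : (a r + B) ^+ 2 * r = a r ^+ 2 * r + 2 * B * (a r * r) + B ^+ 2 * r by ring.
move=> h1 h2; rewrite lerD2r lerD//.
by rewrite ler_wpM2l// mulr_ge0.
Qed.

Lemma force_bounded C B k : bounded_by C k -> 0 <= B ->
  (forall t, 0 <= t <= 1 -> k t <= B) ->
  bounded_by ((1 + B) ^+ 2) (force k).
Proof.
move=> kC B0 kB; split; first exact: force_meas kC.
move=> r /[dup] r01 /andP[r0 r1]; rewrite ger0_norm ?force_ge0//.
rewrite (le_trans (force_le kC r01 B0 _))//.
  by move=> t /andP[t0 tr]; rewrite kB// t0 (le_trans tr).
have e2 : e ^+ 2 <= 1 by rewrite expr_le1//; have := e_le; lra.
have Be : 2 * B * e <= 2 * B by rewrite ler_piMr ?mulr_ge0//; have := e_le; lra.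
have Br : B ^+ 2 * r <= B ^+ 2 by rewrite ler_piMr// sqr_ge0.
have -> : (1 + B) ^+ 2 = 1 + 2 * B + B ^+ 2 by ring.
have := sqr_ge0 B; lra.
Qed.

(** A difference of squares, together with the fact that the positive part is 1-Lipschitz. Upper
    bounds suffice since the positive part discards large negative values. *)
Lemma sqr_max0_dist (x y M : R) : x <= M -> y <= M -> 0 <= M ->
  `|Num.max 0 x ^+ 2 - Num.max 0 y ^+ 2| <= 2 * M * `|x - y|.
Proof.
move=> xM yM M0.
have [mx my] : Num.max 0 x <= M /\ Num.max 0 y <= M by rewrite !ge_max M0 xM yM.
have [x0 y0] : 0 <= Num.max 0 x /\ 0 <= Num.max 0 y by rewrite !le_max lexx.
rewrite subr_sqr normrM mulrC ler_pM//.
  rewrite ger0_norm ?addr_ge0//; lra.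
have := ler_norm (x - y); have := ler_norm (y - x); rewrite (distrC y x).
have := normr_ge0 (x - y); rewrite !maxEle.
case: (leP 0 x) => hx; case: (leP 0 y) => hy.
- by [].
- by rewrite subr0 (ger0_norm hx); lra.
- by rewrite sub0r normrN (ger0_norm hy); lra.
- by rewrite subrr normr0.
Qed.

(** The Lipschitz constant of the square is [2 * (a r + B)]; multiplied by [r / 2] it becomes
    [a r * r + B * r], so the weight removes the singularity of [a]. Only values up to [r] enter:
    this is the Volterra structure. *)
Lemma force_dist C C' B k k' D r : bounded_by C k -> bounded_by C' k' ->
  0 <= r <= 1 -> 0 <= B -> 0 <= D ->
  (forall t, 0 <= t <= r -> k t <= B) -> (forall t, 0 <= t <= r -> k' t <= B) ->
  (forall t, 0 <= t <= r -> `|k t - k' t| <= D) ->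
  `|force k r - force k' r| <= (1 + B) * D.
Proof.
move=> kC kC' /[dup] r01 /andP[r0 r1] B0 D0 kB kB' kD.
have M0 : 0 <= a r + B by rewrite addr_ge0// a_ge0.
have sB : slope k r <= a r + B by rewrite lerD2l; exact: (disk_avg_le kC).
have sB' : slope k' r <= a r + B by rewrite lerD2l; exact: (disk_avg_le kC').
have sD : `|slope k r - slope k' r| <= D.
  rewrite /slope opprD addrACA subrr add0r -(disk_avgB kC kC')//.
  exact: (disk_avg_norm_le (bounded_byB kC kC')).
rewrite /force -!mulrBl !normrM (ger0_norm r0) (@ger0_norm _ 2^-1)//.
have h1 := sqr_max0_dist sB sB' M0.
have h2 : 2 * (a r + B) * `|slope k r - slope k' r| <= 2 * (a r + B) * D.
  by rewrite ler_wpM2l// mulr_ge0.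
have h3 := ler_wpM2r r0 (le_trans h1 h2).
have h4 : (a r * r + B * r) * D <= (1 + B) * D.
  rewrite ler_wpM2r// lerD ?ler_piMr//.
  by have := a_mid_le r01; have := e_le; lra.
by move: h3; rewrite mulrDr; lra.
Qed.

(** * Picard iteration for starts in [[0, B]] *)

Section fixed_bound.
Variable B : R.
Hypothesis B_ge0 : 0 <= B.
(** [1 + B] is the Lipschitz constant in [force_dist], and integrating the weight [expR (K * t)]
    divides by [K], which leaves one half. As the total force is at most [(1 + B) ^+ 2], a shot
    stays between [- (1 + B) ^+ 2] and [B], hence the bound [C]. *)
Local Notation K := (2 * (1 + B)).
Local Notation C := (B + (1 + B) ^+ 2).

(** Two bounds with different roles: the one-sided bound [B] governs the size and the Lipschitz
    constant of [force], while the two-sided bound [C] provides integrability and the size of the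
    first Picard increment. *)
Definition admissible k := bounded_by C k /\ forall r, 0 <= r <= 1 -> k r <= B.

Lemma admissible_sub k r : admissible k -> r <= 1 ->
  forall t, 0 <= t <= r -> k t <= B.
Proof. by move=> [_ kB] r1 t /andP[t0 tr]; rewrite kB// t0 (le_trans tr). Qed.

Lemma force_int k r : admissible k -> r <= 1 ->
  mu.-integrable `[0, r] (EFin \o force k).
Proof. by move=> [kC kB]; exact: (bounded_by_int (force_bounded kC B_ge0 kB)). Qed.

Lemma shoot_admissible c k : 0 <= c <= B -> admissible k -> admissible (shoot c k).
Proof.
move=> /andP[c0 cB] /[dup] ak [kC kB].
have Fk0 r : 0 <= r <= 1 -> 0 <= \int[mu]_(t in `[0, r]) force k t.
  by move=> _; apply: Rintegral_itv_ge0 => t /andP[t0 _]; exact: force_ge0.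
have FkB r : 0 <= r <= 1 -> \int[mu]_(t in `[0, r]) force k t <= (1 + B) ^+ 2.
  move=> /andP[r0 r1]; have [_ fB] := force_bounded kC B_ge0 kB.
  apply: (@le_trans _ _ ((1 + B) ^+ 2 * (r - 0))).
    apply: Rintegral_le_cst => //; first exact: force_int.
    move=> t /andP[t0 tr]; rewrite (le_trans (ler_norm _))// fB//.
    by rewrite t0 (le_trans tr).
  by rewrite subr0 ler_piMr// sqr_ge0.
split; [split|] => [|r r01|r r01].
- by apply: measurable_funB => //; apply: primitive_measurable; exact: force_int.
- have := Fk0 _ r01; have := FkB _ r01; rewrite /shoot ler_norml.
  by have := B_ge0; move=> h0 h1 h2; apply/andP; split; lra.
- have := Fk0 _ r01; rewrite /shoot; lra.
Qed.

(* The weight [expR (K * r)] makes one iteration a contraction by one half. *)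
Lemma shoot_dist c c' k k' D : admissible k -> admissible k' -> 0 <= D ->
  (forall r, 0 <= r <= 1 -> `|k r - k' r| <= D * expR (K * r)) ->
  forall r, 0 <= r <= 1 ->
    `|shoot c k r - shoot c' k' r| <= `|c - c'| + D / 2 * expR (K * r).
Proof.
move=> ak ak' D0 kD r /andP[r0 r1].
have K0 : 0 < K by have := B_ge0; lra.
have iexp : mu.-integrable `[0, r] (EFin \o (fun t => expR (K * t))).
  apply: continuous_compact_integrable; first exact: segment_compact.
  apply: continuous_subspaceT => t.
  apply: continuous_comp; last exact: continuous_expR.
  exact: mulrl_continuous.
rewrite /shoot; set I := Rintegral _ _ _; set I' := Rintegral _ _ _.
have -> : c - I - (c' - I') = (c - c') - (I - I') by ring.
rewrite (le_trans (ler_normB _ _))// lerD2l /I /I' -RintegralB//; [|exact: force_int..].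
apply: (@le_trans _ _ (\int[mu]_(t in `[0, r]) `|force k t - force k' t|)).
  apply: le_normr_Rintegral => //.
  by apply: integrable_subr => //; exact: force_int.
apply: (@le_trans _ _ (\int[mu]_(t in `[0, r]) ((1 + B) * D * expR (K * t)))).
  apply: le_Rintegral_itv => //.
    apply: (@integrable_norm _ _ _ mu _ (fun t => force k t - force k' t)).
    by apply: integrable_subr => //; exact: force_int.
    exact: integrable_scaler.
  move=> t /andP[t0 tr]; have t1 := le_trans tr r1.
  rewrite -mulrA; apply: (force_dist (C := C) (C' := C)) => //.
  - by case: ak.
  - by case: ak'.
  - by rewrite t0 t1.
  - by rewrite mulr_ge0// expR_ge0.
  - exact: admissible_sub.
  - exact: admissible_sub.
  - move=> s /andP[s0 st]; rewrite (le_trans (kD _ _)) ?s0 ?(le_trans st)//.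
    by rewrite ler_wpM2l// ler_expR ler_pM2l.
rewrite RintegralZl//.
rewrite (@le_trans _ _ ((1 + B) * D * (expR (K * r) / K)))//.
  by rewrite ler_wpM2l ?expR_primitive_le// mulr_ge0//; have := B_ge0; lra.
apply: eq_le_refl; field; have := B_ge0; lra.
Qed.

Definition shot c k := admissible k /\
  forall r, 0 <= r <= 1 -> k r = shoot c k r.

Lemma shot_exists c : 0 <= c <= B -> exists k, shot c k.
Proof.
move=> cB; pose u n := iter n (shoot c) (cst c).
have au n : admissible (u n).
  elim: n => [|n IH]; last exact: shoot_admissible.
  case/andP: cB => c0 cB; split; [split|] => //= r r01.
  by rewrite ger0_norm//=; have := sqr_ge0 (1 + B); have := B_ge0; lra.
have C0 : 0 <= C by have := sqr_ge0 (1 + B); have := B_ge0; lra.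
have ud n r : 0 <= r <= 1 ->
    `|u n.+1 r - u n r| <= 2 * C / 2 ^+ n * expR (K * r).
  elim: n r => [|n IH] r r01.
    have [[_ h0] _] := au 0%N; have [[_ h1] _] := au 1%N.
    rewrite expr0 divr1 (@le_trans _ _ (2 * C))//.
      by rewrite (le_trans (ler_normB _ _))// mulr2n mulrDl !mul1r lerD ?h0 ?h1.
    rewrite ler_peMr ?mulr_ge0// -[leLHS]expR0 ler_expR mulr_ge0//; last by case/andP: r01.
    by have := B_ge0; lra.
  have := @shoot_dist c c _ _ _ (au n.+1) (au n) _ IH r r01.
  rewrite (subrr c) normr0 add0r (exprSr 2 n) invfM mulrA; apply.
  by rewrite divr_ge0 ?mulr_ge0// exprn_ge0.
have lim r : exists l, 0 <= r <= 1 ->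
    forall n, `|l - u n r| <= 2 * (2 * C * expR (K * r)) / 2 ^+ n.
  have [r01|] := boolP (0 <= r <= 1); last by exists 0.
  have [|l hl] := @halving_limit R (u ^~ r) (2 * C * expR (K * r)); last by exists l.
  by move=> n; rewrite mulrAC ud.
have [k hk] := choice lim.
have kcvg r : 0 <= r <= 1 -> u n r @[n --> \oo] --> k r.
  move=> r01; apply/cvgrPdist_le => eps eps0.
  have := halving_cvg0 (2 * (2 * C * expR (K * r))).
  move=> /cvgrPdist_le /(_ _ eps0); apply: filterS => n.
  rewrite sub0r normrN => h; rewrite (le_trans (hk r r01 n))//.
  by rewrite (le_trans (ler_norm _)).
have ak : admissible k.
  split; [split|] => [|r r01|r r01].
  - apply: (@measurable_fun_cvg _ _ _ _ u) => [n|r].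
      by have [[]] := au n.
    by rewrite /= in_itv/=; exact: kcvg.
  - have h : `|u n r| @[n --> \oo] --> `|k r| by apply: cvg_norm; exact: kcvg.
    rewrite -(cvg_lim (@Rhausdorff R) h); apply: limr_le; first by apply/cvg_ex; exists `|k r|.
    by apply: nearW => n; have [[_ +] _] := au n; exact.
  - have h := kcvg _ r01.
    rewrite -(cvg_lim (@Rhausdorff R) h); apply: limr_le; first by apply/cvg_ex; exists (k r).
    by apply: nearW => n; have [_ +] := au n; exact.
exists k; split => // r r01.
apply/eqP; rewrite -subr_eq0 -normr_le0.
apply: (@halving_le0 _ _ (4 * C * expR (K * r))) => n.
have h1 : `|k r - u n.+1 r| <= 2 * C * expR (K * r) / 2 ^+ n.
  rewrite (le_trans (hk _ r01 _))// (exprSr 2 n); apply: eq_le_refl; field.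
  by rewrite expf_neq0.
(* The contraction estimate, applied to an iterate and the limit itself, carries the limit through
   [shoot] without exchanging limit and integral. *)
have h2 : `|u n.+1 r - shoot c k r| <= 2 * C * expR (K * r) / 2 ^+ n.
  have := @shoot_dist c c _ _ (4 * C / 2 ^+ n) (au n) ak _ _ r r01.
  rewrite (subrr c) normr0 add0r => h; rewrite (le_trans (h _ _))//.
  - by rewrite divr_ge0 ?mulr_ge0// exprn_ge0.
  - move=> s s01; rewrite distrC (le_trans (hk _ s01 _))//; apply: eq_le_refl; field.
    by rewrite expf_neq0.
  - by apply: eq_le_refl; field; rewrite expf_neq0.
have -> : k r - shoot c k r = (k r - u n.+1 r) + (u n.+1 r - shoot c k r) by ring.
rewrite (le_trans (ler_normD _ _))// (le_trans (lerD h1 h2))//.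
by apply: eq_le_refl; field; rewrite expf_neq0.
Qed.

(** In the weighted norm the distance [d] of the two shots satisfies [d <= |c - c'| + d / 2], hence
    [d <= 2 * |c - c'|]. The induction avoids defining [d] as a supremum: it starts from the trivial
    bound [2 * C] and halves it at each step. *)
Lemma shot_lipschitz c c' k k' : shot c k -> shot c' k' ->
  forall r, 0 <= r <= 1 -> `|k r - k' r| <= 2 * `|c - c'| * expR (K * r).
Proof.
move=> [ak kE] [ak' kE'] r r01.
have C0 : 0 <= C by have := sqr_ge0 (1 + B); have := B_ge0; lra.
have exp1 s : 0 <= s <= 1 -> 1 <= expR (K * s).
  move=> /andP[s0 _]; rewrite -[leLHS]expR0 ler_expR mulr_ge0//.
  by have := B_ge0; lra.
have ind n : forall s, 0 <= s <= 1 ->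
    `|k s - k' s| <= (2 * `|c - c'| + 2 * C / 2 ^+ n) * expR (K * s).
  elim: n => [|n IH] s s01.
    have [[_ h] _] := ak; have [[_ h'] _] := ak'.
    rewrite expr0 divr1 (le_trans (ler_normB _ _))//.
    rewrite (@le_trans _ _ ((2 * `|c - c'| + 2 * C) * 1))//.
      by have := h _ s01; have := h' _ s01; have := normr_ge0 (c - c'); lra.
    by rewrite ler_wpM2l ?exp1// addr_ge0// mulr_ge0.
  rewrite kE// kE'//.
  have p0 : 0 <= 2 * C / 2 ^+ n by rewrite divr_ge0 ?mulr_ge0// exprn_ge0.
  have := @shoot_dist c c' _ _ _ ak ak' _ IH s s01.
  move=> h; rewrite (le_trans (h _))//.
    by rewrite addr_ge0// mulr_ge0.
  have -> : 2 * C / 2 ^+ n.+1 = 2 * C / 2 ^+ n / 2 by rewrite (exprSr 2 n) invfM mulrA.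
  have := ler_wpM2l (normr_ge0 (c - c')) (exp1 _ s01); rewrite mulr1.
  move: (2 * C / 2 ^+ n) => q; move: (expR _) `|_| => E d; nra.
rewrite -subr_le0; apply: (@halving_le0 _ _ (2 * C * expR (K * r))) => n.
have := ind n r r01; rewrite mulrDl.
have -> : 2 * C * expR (K * r) / 2 ^+ n = 2 * C / 2 ^+ n * expR (K * r) by rewrite mulrAC.
by rewrite lerBlDl.
Qed.

End fixed_bound.

(** [r ^+ 2 * a r] is the source's share of [- r u']. It is nondecreasing because it will be the
    integral of a nonnegative function over [[0, r]]. *)
Hypothesis a_mono : forall r s, 0 < r -> r <= s -> s <= 1 ->
  r ^+ 2 * a r <= s ^+ 2 * a s.

Lemma shot_le_start B c k : 0 <= B -> shot B c k ->
  forall r, 0 <= r <= 1 -> k r <= c.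
Proof.
move=> B0 [ak kE] r /[dup] r01 /andP[r0 r1]; rewrite kE// /shoot gerBl.
by apply: Rintegral_itv_ge0 => t /andP[t0 _]; exact: force_ge0.
Qed.

Lemma shot_split B c k r s : 0 <= B -> shot B c k -> 0 <= r -> r <= s -> s <= 1 ->
  k r = k s + \int[mu]_(t in `[r, s]) force k t.
Proof.
move=> B0 [ak kE] r0 rs s1; rewrite !kE ?r0 ?(le_trans rs) ?(le_trans r0)//.
by rewrite /shoot (Rintegral_split r0 rs) ?(force_int B0)//; ring.
Qed.

(** A shot from [1] stays below [1], so its force is at most [(1 + e) ^+ 2 / 2]. For [e <= 1/8] this
    is less than [1], and the shot cannot come down to [0]. The smallness of the source is needed
    for this. *)
Lemma shot_at_1_gt0 B k : 1 <= B -> shot B 1 k -> 0 < k 1.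
Proof.
move=> B1 sk; have B0 : 0 <= B by lra.
have [[kC kB] kE] := sk; rewrite kE ?ler01 ?lexx// /shoot.
have : \int[mu]_(t in `[0, 1]) force k t <= (e ^+ 2 + 2 * e + 1) / 2 * (1 - 0).
  apply: Rintegral_le_cst => //; first exact: (force_int B0).
  move=> t /[dup] t01 /andP[t0 t1].
  apply: (le_trans (force_le kC t01 ler01 _)).
    move=> s /andP[s0 st]; apply: (shot_le_start B0 sk).
    by rewrite s0 (le_trans st).
  by rewrite expr1n !mulr1 !mul1r ler_pM2r// lerD2l.
have : e ^+ 2 <= e by rewrite expr2 ler_piMr//; have := e_le; lra.
have := e_le; lra.
Qed.

(* If a shot from [B = 4 ^+ N] stayed positive, then [y], which is [- r u'],
   would be at least [1/32] at [r = 2 ^- N.+1] and would increase by at least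
   [y ^+ 2 / 64] whenever [r] doubles, while [y <= 64] up to [r = 1/2]. *)
Section large_start.
Variables (B : R) (k : R -> R).
Hypothesis B_ge1 : 1 <= B.
Hypothesis k_shot : shot B B k.
Hypothesis k1_gt0 : 0 < k 1.

Let y r := r ^+ 2 * slope k r.

Let B_ge0 : 0 <= B. Proof. exact: le_trans B_ge1. Qed.

Let k_mono r s : 0 <= r -> r <= s -> s <= 1 -> k s <= k r.
Proof.
move=> r0 rs s1; rewrite (shot_split B_ge0 k_shot r0 rs s1) lerDl.
by apply: Rintegral_itv_ge0 => t /andP[rt _]; rewrite force_ge0// (le_trans r0).
Qed.

Let k_ge0 r : 0 <= r <= 1 -> 0 <= k r.
Proof. by move=> /andP[r0 r1]; rewrite (le_trans (ltW k1_gt0))// k_mono. Qed.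

Let yE r : 0 < r -> y r = r ^+ 2 * a r + \int[mu]_(t in `[0, r]) (k t * t).
Proof.
move=> r0; rewrite /y /slope /disk_avg mulrDr; congr (_ + _).
by rewrite mulrCA divff ?mulr1// expf_neq0// gt_eqF.
Qed.

Let k_int r s : 0 <= r -> s <= 1 ->
  mu.-integrable `[r, s] (EFin \o (fun t => k t * t)).
Proof.
move=> r0 s1; have [[kC _] _] := k_shot.
apply: (@integrable_sub _ 0 1) => //.
exact: (bounded_by_int (bounded_byMid kC)).
Qed.

(** The source part of [y] does not decrease, and on [[r, s]] the integrand [k t * t] is at least
    [k s * r]. *)
Let y_incr r s : 0 < r -> r <= s -> s <= 1 -> k s * r * (s - r) <= y s - y r.
Proof.
move=> r0 rs s1; rewrite !yE ?(lt_le_trans r0)//.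
rewrite (Rintegral_split (ltW r0) rs) ?k_int//.
have := a_mono r0 rs s1.
have : k s * r * (s - r) <= \int[mu]_(t in `[r, s]) (k t * t).
  apply: Rintegral_ge_cst => //; first exact: (k_int (ltW r0)).
  move=> t /andP[rt ts].
  have k0 : 0 <= k s by rewrite k_ge0// s1 andbT (le_trans (ltW r0)).
  by rewrite ler_pM// ?(ltW r0)// k_mono// (le_trans (ltW r0)).
lra.
Qed.

Let y_ge0 r : 0 < r -> r <= 1 -> 0 <= y r.
Proof.
move=> r0 r1; rewrite yE// addr_ge0//.
  by rewrite mulr_ge0 ?sqr_ge0// a_ge0// (ltW r0).
apply: Rintegral_itv_ge0 => t /andP[t0 tr].
by rewrite mulr_ge0// k_ge0// t0 (le_trans tr).
Qed.

Let y_mono r s : 0 < r -> r <= s -> s <= 1 -> y r <= y s.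
Proof.
move=> r0 rs s1; rewrite -subr_ge0 (le_trans _ (y_incr r0 rs s1))//.
by rewrite !mulr_ge0 ?subr_ge0 ?(ltW r0)// k_ge0// s1 (le_trans (ltW r0)).
Qed.

(** On [[r, 2r]] the force is [y t ^+ 2 / (2 * t ^+ 3)], which is at least
    [y r ^+ 2 / (16 * r ^+ 3)] by monotonicity of [y] and [t ^+ 3 <= 8 * r ^+ 3]. Integrate over the
    length [r] and drop [k (2 * r) >= 0]. *)
Let k_ge r : 0 < r -> r <= 2^-1 -> y r ^+ 2 / (16 * r ^+ 2) <= k r.
Proof.
move=> r0 rh; have r21 : 2 * r <= 1 by lra.
have rr : r <= 2 * r by lra.
rewrite (shot_split B_ge0 k_shot (ltW r0) rr r21).
have k20 : 0 <= k (2 * r) by rewrite k_ge0// r21 mulr_ge0// ltW.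
rewrite (@le_trans _ _ (y r ^+ 2 / (16 * r ^+ 3) * (2 * r - r)))//.
  by apply: eq_le_refl; field; rewrite gt_eqF.
apply: le_trans (Rintegral_ge_cst (f := force k) rr _ _) _.
- by apply: (integrable_sub (ltW r0) r21); apply: (force_int B_ge0) => //; case: k_shot.
- move=> t /andP[rt t2r]; have t0 : 0 < t := lt_le_trans r0 rt.
  have t1 := le_trans t2r r21.
  have yt : y r <= y t by exact: y_mono.
  have y0 : 0 <= y r by rewrite y_ge0// (le_trans rr).
  have st : slope k t = y t / t ^+ 2.
    by rewrite /y mulrC mulKf// expf_neq0// gt_eqF.
  have s0 : 0 <= slope k t by rewrite st divr_ge0 ?sqr_ge0// (le_trans y0).
  rewrite /force (max_idPr s0) st.
  have -> : (y t / t ^+ 2) ^+ 2 * t / 2 = y t ^+ 2 / (2 * t ^+ 3).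
    by field; rewrite gt_eqF.
  apply: ler_pM; rewrite ?sqr_ge0 ?invr_ge0 ?mulr_ge0 ?exprn_ge0 ?(ltW r0)//.
    by rewrite ler_pXn2r// nnegrE// (le_trans y0).
  rewrite lef_pV2 ?posrE ?mulr_gt0 ?exprn_gt0//.
  have : t ^+ 3 <= (2 * r) ^+ 3 by rewrite ler_pXn2r// nnegrE ltW// mulr_gt0.
  by rewrite exprMn; lra.
- by rewrite lerDr.
Qed.

(** [y_incr] from [r] to [2r], with [k (2 * r)] bounded below by [k_ge] at [2r]; this is why [2r]
    must not exceed [1/2]. The constant is [64 = 16 * 2 ^+ 2]. *)
Let y_double r : 0 < r -> r <= 4^-1 -> y r + y r ^+ 2 / 64 <= y (2 * r).
Proof.
move=> r0 r4; have rr : r <= 2 * r by lra.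
have r21 : 2 * r <= 1 by lra.
rewrite addrC -lerBrDr (le_trans _ (y_incr r0 rr r21))//.
have r20 : 0 < 2 * r by rewrite mulr_gt0.
have r22 : 2 * r <= 2^-1 by lra.
rewrite (@le_trans _ _ (y (2 * r) ^+ 2 / (16 * (2 * r) ^+ 2) * r * (2 * r - r)))//.
  rewrite (_ : _ * r * _ = y (2 * r) ^+ 2 / 64).
    by rewrite ler_pM2r// ler_pXn2r ?nnegrE ?y_ge0 ?y_mono// (le_trans rr).
  by field; rewrite gt_eqF.
have rr0 : 2 * r - r = r by ring.
by rewrite rr0 ler_pM2r// ler_pM2r// k_ge.
Qed.

Let y_upper r : 0 < r -> r <= 2^-1 -> k r * r ^+ 2 / 4 <= y r.
Proof.
move=> r0 rh; have r20 : 0 < r / 2 by rewrite divr_gt0.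
have rr : r / 2 <= r by lra.
have r1 : r <= 1 by lra.
have := y_incr r20 rr r1; have := y_ge0 r20 (le_trans rr r1).
rewrite (_ : k r * (r / 2) * (r - r / 2) = k r * r ^+ 2 / 4); last by field.
lra.
Qed.

(** Chaining [k_ge] with [y_upper] gives [y r ^+ 2 / 64 <= y r], where [64 = 16 * 4]. *)
Let y_le64 r : 0 < r -> r <= 2^-1 -> y r <= 64.
Proof.
move=> r0 rh; have r1 : r <= 1 by lra.
have := y_ge0 r0 r1; rewrite le_eqVlt => /predU1P[<-//|y0].
have : y r ^+ 2 / 64 <= y r.
  rewrite (le_trans _ (y_upper r0 rh))//.
  rewrite (_ : y r ^+ 2 / 64 = y r ^+ 2 / (16 * r ^+ 2) * r ^+ 2 / 4).
    by rewrite ler_pM2r// ler_pM2r ?exprn_gt0// k_ge.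
  by field; rewrite gt_eqF.
by rewrite expr2 -mulrA ger_pMr// ler_pdivrMr// mul1r.
Qed.

(** Up to this radius the total force is at most [1/16 + B/16 + B/8], which is at most [B/2]. So
    [k r >= B/2], and [y_upper] gives [y r >= B * r ^+ 2 / 8 = 1/32]. *)
Let y_start r : 0 < r -> r <= 2^-1 -> B * r ^+ 2 = 4^-1 -> 32^-1 <= y r.
Proof.
move=> r0 rh Br; rewrite (le_trans _ (y_upper r0 rh))//.
have r1 : r <= 1 by lra.
suff kB : B / 2 <= k r.
  rewrite (@le_trans _ _ (B / 2 * r ^+ 2 / 4))//.
    have -> : B / 2 * r ^+ 2 / 4 = B * r ^+ 2 / 8 by field.
    by rewrite Br; lra.
  by rewrite ler_pM2r// ler_pM2r// exprn_gt0.
have [[kC kB] kE] := k_shot; rewrite kE ?r1 ?ltW// /shoot.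
have : \int[mu]_(t in `[0, r]) force k t <=
    (e ^+ 2 + 2 * B * e + B ^+ 2 * r) / 2 * (r - 0).
  apply: Rintegral_le_cst; [exact: ltW|exact: (force_int B_ge0)|].
  move=> t /andP[t0 tr]; have t1 := le_trans tr r1.
  apply: (le_trans (force_le kC _ B_ge0 _)); first by rewrite t0.
    by move=> s /andP[s0 st]; rewrite kB// s0 (le_trans st).
  by rewrite ler_pM2r// lerD2l ler_wpM2l// sqr_ge0.
have -> : (e ^+ 2 + 2 * B * e + B ^+ 2 * r) / 2 * (r - 0) =
    e ^+ 2 * r / 2 + B * e * r + B * (B * r ^+ 2) / 2 by field.
rewrite Br.
have e2 : e ^+ 2 * r <= 8^-1.
  rewrite (@le_trans _ _ (e ^+ 2))// ?ler_piMr ?sqr_ge0//.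
  rewrite (@le_trans _ _ e)//; rewrite expr2 ler_piMr//; have := e_le; lra.
have Be : B * e * r <= B / 16.
  have -> : B / 16 = B * 8^-1 * 2^-1 by lra.
  have := B_ge0; have := e_le => h1 h2.
  apply: ler_pM; [exact: mulr_ge0|exact: ltW| |exact: rh].
  exact: ler_wpM2l.
have := B_ge1; lra.
Qed.

Lemma large_start_bound (N : nat) : B = 4 ^+ N -> N%:R * (32^-1 ^+ 2 / 64) <= 64 :> R.
Proof.
move=> BE; pose r0 : R := 2^-1 ^+ N.+1.
have r00 : 0 < r0 by rewrite exprn_gt0.
have n0 n : (2 : R) ^+ n != 0 by rewrite expf_neq0.
have rE : r0 = (2 * 2 ^+ N)^-1 by rewrite /r0 exprVn -exprS.
have step (j : nat) : (j <= N)%N -> 32^-1 + j%:R * (32^-1 ^+ 2 / 64) <= y (2 ^+ j * r0).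
  elim: j => [_|j IH jN].
    rewrite mul0r addr0 expr0 mul1r; apply: y_start => //.
      by rewrite /r0 exprS ler_piMr// exprn_ile1//; lra.
    rewrite BE rE (_ : 4 = 2 ^+ 2 :> R) -?exprM ?(mulnC 2) ?exprM; last by lra.
    by field.
  have yj := IH (ltnW jN).
  have rj0 : 0 < 2 ^+ j * r0 by rewrite mulr_gt0// exprn_gt0.
  have rj4 : 2 ^+ j * r0 <= 4^-1.
    rewrite rE -(subnKC jN) exprD exprS.
    have -> : 2 ^+ j * (2 * (2 * 2 ^+ j * 2 ^+ (N - j.+1)))^-1 =
        4^-1 * (2 ^+ (N - j.+1))^-1 :> R.
      by field; rewrite !n0.
    by rewrite ler_piMr// invf_le1 ?exprn_gt0// exprn_ege1//; lra.
  rewrite (exprS 2 j) -mulrA (le_trans _ (y_double rj0 rj4))//.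
  have c0 : (0 : R) <= j%:R * (32^-1 ^+ 2 / 64) by rewrite mulr_ge0.
  have y2 : 32^-1 ^+ 2 <= y (2 ^+ j * r0) ^+ 2.
    by rewrite ler_pXn2r// ?nnegrE ?y_ge0//; lra.
  have -> : j.+1%:R = j%:R + 1 :> R by rewrite natr1.
  by rewrite mulrDl mul1r addrA lerD// ler_pM2r.
have := step N (leqnn N).
have E : 2 ^+ N * r0 = 2^-1.
  by rewrite rE; field; exact: n0.
rewrite E.
have := @y_le64 2^-1 _ (lexx _).
lra.
Qed.

End large_start.

Lemma lipschitz_within (f : R -> R) (s t M : R) : 0 <= M ->
  (forall x y, s <= x <= t -> s <= y <= t -> `|f x - f y| <= M * `|x - y|) ->
  {within `[s, t], continuous f}.
Proof.
move=> M0 fM; apply/subspace_continuousP => x /=; rewrite in_itv/= => xst.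
apply/cvgrPdist_le => eps eps0; rewrite near_withinE.
have d0 : 0 < eps / (M + 1) by rewrite divr_gt0// ltr_wpDl.
near=> z; rewrite /= in_itv/= => zst.
rewrite (le_trans (fM _ _ xst zst))//.
have : `|x - z| <= eps / (M + 1).
  by near: z; apply: (@cvgr_dist_le _ _ _ _ _ id x) => //; exact: cvg_id.
rewrite ler_pdivlMr ?ltr_wpDl// mulrC => h.
by rewrite (le_trans _ h)// ler_wpM2r// lerDl.
Unshelve. all: by end_near. Qed.

(** A single [B = 4 ^+ N], with [N] violating [large_start_bound], serves for all starts in
    [[0, B]]. All shots then share one Lipschitz constant, and the final value depends continuously
    on the start. *)
Theorem two_shots : exists (C c1 c2 : R) (k1 k2 : R -> R),
  [/\ c1 < c2, bounded_by C k1 /\ bounded_by C k2,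
      forall r, 0 <= r <= 1 -> k1 r = shoot c1 k1 r,
      forall r, 0 <= r <= 1 -> k2 r = shoot c2 k2 r &
      k1 1 = 0 /\ k2 1 = 0].
Proof.
have [N hN] : exists N : nat, 64 < N%:R * (32^-1 ^+ 2 / 64) :> R.
  exists (Num.Def.archi_bound (64 / (32^-1 ^+ 2 / 64) : R)).
  rewrite -ltr_pdivrMr; first by rewrite archi_boundP// divr_ge0// divr_ge0// sqr_ge0.
  by rewrite divr_gt0// exprn_gt0.
pose B : R := 4 ^+ N.
have B1 : 1 <= B by rewrite /B exprn_ege1//; lra.
have B0 : 0 <= B by lra.
have ex c : exists k, 0 <= c <= B -> shot B c k.
  have [cB|] := boolP (0 <= c <= B); last by exists 0.
  by have [k] := shot_exists B0 cB; exists k.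
have [k hk] := choice ex.
pose M := 2 * expR (2 * (1 + B)).
have M0 : 0 <= M by rewrite mulr_ge0// expR_ge0.
have lip x y : 0 <= x <= B -> 0 <= y <= B -> `|k x 1 - k y 1| <= M * `|x - y|.
  move=> xB yB; have := shot_lipschitz B0 (hk _ xB) (hk _ yB) (r := 1).
  by rewrite ler01 lexx mulr1 /M [leRHS]mulrAC => /(_ isT).
have hk1 : 0 < k 1 1 by apply: (shot_at_1_gt0 B1); apply: hk; rewrite ler01.
have hk0 : k 0 1 <= 0.
  by apply: (shot_le_start B0 (hk 0 _)); rewrite ?lexx ?ler01.
have hkB : k B 1 <= 0.
  rewrite leNgt; apply/negP => kB0.
  have sB : shot B B (k B) by apply: hk; rewrite B0 lexx.
  by have := large_start_bound B1 sB kB0 (erefl B); rewrite leNgt hN.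
have [c1 c1I E1] : exists2 c, c \in `[0, 1] & k c 1 = 0.
  apply: (@IVT _ (fun c => k c 1)) => //.
    apply: (lipschitz_within M0) => x y /andP[x0 x1] /andP[y0 y1].
    by apply: lip; rewrite ?x0 ?y0 (le_trans _ B1).
  by rewrite ge_min le_max hk0 (ltW hk1) orbT.
have [c2 c2I E2] : exists2 c, c \in `[1, B] & k c 1 = 0.
  apply: (@IVT _ (fun c => k c 1)) => //.
    apply: (lipschitz_within M0) => x y /andP[x0 x1] /andP[y0 y1].
    by apply: lip; rewrite ?x1 ?y1 (le_trans ler01).
  by rewrite ge_min le_max hkB (ltW hk1) orbT.
move: c1I c2I; rewrite !in_itv/= => /andP[c10 c11] /andP[c21 c2B].
have c1B : 0 <= c1 <= B by rewrite c10 (le_trans c11).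
have c2B' : 0 <= c2 <= B by rewrite c2B (le_trans ler01).
(* The intervals [[0, 1]] and [[1, B]] meet at [1], where the final value is positive, so the two
   zeros are distinct. *)
have c1n : c1 != 1 by apply/eqP => c1E; move: hk1; rewrite -{1}c1E E1 ltxx.
have c2n : c2 != 1 by apply/eqP => c2E; move: hk1; rewrite -{1}c2E E2 ltxx.
have [[k1C _] k1E] := hk _ c1B; have [[k2C _] k2E] := hk _ c2B'.
exists (B + (1 + B) ^+ 2), c1, c2, (k c1), (k c2); split => //.
by rewrite (@lt_trans _ _ 1)// lt_neqAle ?c1n// eq_sym c2n.
Qed.

End shooting.

(** * Singular source *)

Section profiles.
Context {R : realType}.
Local Notation mu := (@lebesgue_measure R).
Implicit Types (r s t x C : R) (h k : R -> R).

(* The solution is logarithmically singular at the origin; a small fixed power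
   of [r] absorbs the logarithm. *)
Definition root4 r : R := Num.sqrt (Num.sqrt r).

Lemma root4_gt0 r : 0 < r -> 0 < root4 r.
Proof. by move=> r0; rewrite !sqrtr_gt0. Qed.

Lemma root4_ge0 r : 0 <= root4 r.
Proof. exact: sqrtr_ge0. Qed.

Lemma root4X r : 0 <= r -> root4 r ^+ 4 = r.
Proof. by move=> r0; rewrite (exprM _ 2 2) !sqr_sqrtr ?sqrtr_ge0. Qed.

Lemma root4_le r s : r <= s -> root4 r <= root4 s.
Proof. by move=> rs; rewrite /root4 ler_wsqrtr// ler_wsqrtr. Qed.

Lemma root4_le1 r : r <= 1 -> root4 r <= 1.
Proof. by move=> /root4_le/le_trans; apply; rewrite /root4 !sqrtr1. Qed.

(** The density [h] already carries the weight: it will be [lambda * f r * r] up to a null set, so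
    that [mass h] is the function F of the equation. *)
Definition mass h r := \int[mu]_(t in `[0, r]) h t.

Definition moment k r := \int[mu]_(t in `[0, r]) (k t * t).

(* [k] is minus the Laplacian of the solution and [moment k r] is [- r u'(r)]. *)
Definition profile h k := [/\ measurable_fun (`[0, 1] : set R) k,
  exists C, forall r, 0 < r <= 1 -> 0 <= k r <= C / root4 r &
  forall r, 0 < r <= 1 ->
    k r = \int[mu]_(t in `[r, 1]) ((moment k t ^+ 2 / (2 * t ^+ 2) + mass h t) / t)].

(** * The logarithmic potential of the source *)

Section source.
Variable h : R -> R.
Hypothesis h_int : mu.-integrable `[0, 1] (EFin \o h).
Hypothesis h_ge0 : forall r, 0 <= r <= 1 -> 0 <= h r.

(** The radial solution of [- Laplacian G = h / r] that vanishes at [1]. Since [mass h] is bounded,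
    its singularity at the origin is at most logarithmic. *)
Definition log_potential r := \int[mu]_(t in `[r, 1]) (mass h t / t).
Local Notation G := log_potential.
Local Notation F1 := (mass h 1).

Lemma mass_ge0 r : r <= 1 -> 0 <= mass h r.
Proof.
move=> r1; apply: Rintegral_itv_ge0 => t /andP[t0 tr].
by rewrite h_ge0// t0 (le_trans tr).
Qed.

Lemma mass_mono r s : 0 <= r -> r <= s -> s <= 1 -> mass h r <= mass h s.
Proof.
move=> r0 rs s1; rewrite /mass (Rintegral_split r0 rs); last first.
  exact: integrable_sub h_int.
rewrite lerDl; apply: Rintegral_itv_ge0 => t /andP[rt ts].
by rewrite h_ge0// (le_trans r0 rt) (le_trans ts).
Qed.

Lemma mass_meas : measurable_fun (`[0, 1] : set R) (mass h).
Proof. exact: primitive_measurable. Qed.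

Lemma inv_meas : measurable_fun (`[0, 1] : set R) (fun t : R => t^-1).
Proof.
apply: continuous_itv_measurable => x /andP[x0 _].
by apply: cvgV; [rewrite gt_eqF|exact: cvg_id].
Qed.

Lemma mass_div_int r : 0 < r -> r <= 1 ->
  mu.-integrable `[r, 1] (EFin \o (fun t => mass h t / t)).
Proof.
move=> r0 r1; apply: (@bounded_integrable _ _ _ (F1 / r)).
  apply: (@measurable_sub _ 0 1); [exact: ltW|by []|].
  by apply: measurable_funM; [exact: mass_meas|exact: inv_meas].
move=> t /andP[rt t1]; have t0 := lt_le_trans r0 rt.
rewrite ger0_norm ?divr_ge0 ?mass_ge0// ?(ltW t0)//.
apply: ler_pM; rewrite ?mass_ge0 ?invr_ge0 ?(ltW t0)//.
  by rewrite mass_mono// ltW.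
by rewrite lef_pV2.
Qed.

Lemma log_potential_ge0 r : 0 < r -> 0 <= G r.
Proof.
move=> r0; apply: Rintegral_itv_ge0 => t /andP[rt t1].
by rewrite divr_ge0 ?mass_ge0// (le_trans (ltW r0)).
Qed.

Lemma mass_continuous x : 0 < x < 1 -> {for x, continuous (mass h)}.
Proof.
move=> x01; have := parameterized_integral_continuous ler01 h_int.
move=> /(continuous_within_itvP _ ltr01)[+ _ _]; apply.
by rewrite in_itv.
Qed.

Lemma is_derive_log_potential x : 0 < x < 1 -> is_derive x 1 G (- (mass h x / x)).
Proof.
move=> /andP[x0 x1]; apply: (@is_derive_Rintegral_lb _ (x / 2) 1).
- by rewrite x1 andbT; lra.
- by apply: mass_div_int; lra.
- apply: cvgM; first by apply: mass_continuous; rewrite x0.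
  by apply: cvgV; [rewrite gt_eqF|exact: cvg_id].
Qed.

Lemma log_potential_meas : measurable_fun (`[0, 1] : set R) G.
Proof.
apply: continuous_itv_measurable => x /is_derive_log_potential.
exact: is_derive_continuous.
Qed.

(** [G r] is at most [- F1 * ln r]. With [q = root4 r] one has [- ln r = 4 * ln (1 / q) <= 4 * (1 /
    q - 1)], and multiplying by [q] leaves at most [4 * F1]. The factor [4] is the exponent of the
    root. *)
Lemma log_potential_le r : 0 < r -> r <= 1 -> G r * root4 r <= 4 * F1.
Proof.
move=> r0 r1; have F10 : 0 <= F1 by exact: mass_ge0.
have q0 := root4_gt0 r0; have q1 := root4_le1 r1.
have cinv t : 0 < t -> {for t, continuous (fun x : R => x^-1)}.
  by move=> t0; apply: cvgV; [rewrite gt_eqF|exact: cvg_id].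
have iinv : mu.-integrable `[r, 1] (EFin \o (fun t : R => t^-1)).
  apply: (@bounded_integrable _ _ _ r^-1).
    by apply: (@measurable_sub _ 0 1); [exact: ltW|by []|exact: inv_meas].
  move=> t /andP[rt t1]; have t0 := lt_le_trans r0 rt.
  by rewrite ger0_norm ?invr_ge0 ?(ltW t0)// lef_pV2.
have Gln : G r <= F1 * - ln r.
  apply: (@le_trans _ _ (\int[mu]_(t in `[r, 1]) (F1 * t^-1))).
    apply: le_Rintegral_itv; first exact: mass_div_int.
      exact: integrable_scaler.
    move=> t /andP[rt t1]; have t0 := lt_le_trans r0 rt.
    by rewrite ler_wpM2r ?invr_ge0 ?(ltW t0)// mass_mono// ltW.
  rewrite RintegralZl// ler_wpM2l//.
  move: r1; rewrite le_eqVlt => /predU1P[->|r1].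
    by rewrite Rintegral_nil ln1 oppr0.
  suff -> : \int[mu]_(t in `[r, 1]) t^-1 = ln 1 - ln r by rewrite ln1 sub0r.
  apply: (@improper_FTC R r 1 (fun t : R => t^-1) (@ln R)) => //.
  - by move=> x /andP[rx _]; apply: cinv; exact: lt_trans rx.
  - by move=> x /andP[rx _]; apply: is_derive1_ln; exact: lt_trans rx.
  - by apply: cvg_at_right_filter; exact: continuous_ln.
  - by apply: cvg_at_left_filter; exact: continuous_ln.
have lnq : - ln r <= 4 * ((root4 r)^-1 - 1).
  have -> : ln r = 4 * ln (root4 r).
    by rewrite -{1}(root4X (ltW r0)) lnXn// mulr_natl.
  rewrite -mulrN -lnV ?posrE// ler_pM2l//.
  have := @le_ln1Dx R ((root4 r)^-1 - 1); rewrite (addrC 1) subrK; apply.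
  by rewrite ltrBrDl subrr invr_gt0.
apply: (@le_trans _ _ (F1 * (4 * ((root4 r)^-1 - 1)) * root4 r)).
  by rewrite ler_wpM2r ?root4_ge0// (le_trans Gln)// ler_wpM2l.
have -> : F1 * (4 * ((root4 r)^-1 - 1)) * root4 r = 4 * F1 * (1 - root4 r).
  by field; rewrite gt_eqF.
by rewrite ler_piMr ?mulr_ge0// gerBl ltW.
Qed.

Lemma log_potentialMid_le r : 0 < r -> r <= 1 ->
  G r * r <= 4 * F1 * (r / root4 r).
Proof.
move=> r0 r1; have q0 := root4_gt0 r0.
rewrite (mulrA _ r) ler_pdivlMr// mulrAC ler_pM2r//.
exact: log_potential_le.
Qed.

Lemma div_root4_mono r s : 0 < r -> r <= s -> r / root4 r <= s / root4 s.
Proof.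
have E x : 0 < x -> x / root4 x = root4 x ^+ 3.
  move=> x0; rewrite -{1}(root4X (ltW x0)) exprSr mulfK// gt_eqF//.
  exact: root4_gt0.
move=> r0 rs; rewrite !E ?(lt_le_trans r0)//.
by rewrite ler_pXn2r ?nnegrE ?root4_ge0// root4_le.
Qed.

Lemma div_root4_le1 r : 0 < r -> r <= 1 -> r / root4 r <= 1.
Proof.
move=> r0 r1; rewrite (le_trans (div_root4_mono r0 r1))//.
by rewrite /root4 !sqrtr1 divr1.
Qed.

Lemma log_potentialMid_bounded : bounded_by (4 * F1) (fun t => G t * t).
Proof.
split; first by apply: measurable_funM => //; exact: log_potential_meas.
have F10 : 0 <= F1 by exact: mass_ge0.
move=> r /andP[]; rewrite le_eqVlt => /predU1P[<-|r0] r1.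
  by rewrite mulr0 normr0 mulr_ge0.
rewrite ger0_norm ?mulr_ge0 ?log_potential_ge0 ?(ltW r0)//.
rewrite (le_trans (log_potentialMid_le r0 r1))// ler_piMr ?mulr_ge0//.
exact: div_root4_le1.
Qed.

(** [disk_avg_measurable] asks for a bounded function. [G] may be unbounded, but [G t * t] is
    bounded, and that suffices. *)
Lemma disk_avg_potential_meas : measurable_fun (`[0, 1] : set R) (disk_avg G).
Proof.
apply: measurable_funM.
  by apply: primitive_measurable; exact: (bounded_by_int log_potentialMid_bounded).
apply: continuous_itv_measurable => x /andP[x0 _].
apply: cvgV; first by rewrite expf_neq0// gt_eqF.
exact: exprn_continuous.
Qed.

Lemma moment_potential_ge0 r : 0 <= moment G r.
Proof.
apply: Rintegral_itv_ge0 => t /andP[].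
rewrite le_eqVlt => /predU1P[<-|t0 _]; first by rewrite mulr0.
by rewrite mulr_ge0 ?log_potential_ge0// ltW.
Qed.

(** As [r = root4 r ^+ 4 <= root4 r ^+ 2], this yields the bound on [a r ^+ 2 * r] required for
    shooting, with [e = 4 * F1]. *)
Lemma disk_avg_potential_le r : 0 < r -> r <= 1 ->
  disk_avg G r * root4 r <= 4 * F1.
Proof.
move=> r0 r1; have q0 := root4_gt0 r0; have F10 : 0 <= F1 by exact: mass_ge0.
have : moment G r <= 4 * F1 * (r / root4 r) * (r - 0).
  apply: Rintegral_le_cst; first exact: ltW.
    exact: (bounded_by_int log_potentialMid_bounded).
  move=> t /andP[]; rewrite le_eqVlt => /predU1P[<-|t0] tr.
    by rewrite mulr0 !mulr_ge0// ?invr_ge0 ltW.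
  rewrite (le_trans (log_potentialMid_le t0 (le_trans tr r1)))//.
  by rewrite ler_wpM2l ?mulr_ge0// div_root4_mono.
rewrite subr0 => h1; rewrite /disk_avg mulrAC ler_pdivrMr ?exprn_gt0//.
rewrite (le_trans (ler_wpM2r (ltW q0) h1))//.
by apply: eq_le_refl; field; rewrite gt_eqF.
Qed.

Lemma continuous_root4 : continuous root4.
Proof.
move=> x; apply: continuous_comp; exact: sqrt_continuous.
Qed.

End source.

Lemma moment_of_bounded C k : bounded_by C k -> forall r, r <= 1 ->
  mu.-integrable `[0, r] (EFin \o (fun t => k t * t)).
Proof. by move=> kC r r1; exact: (bounded_by_int (bounded_byMid kC)). Qed.

(** Each profile is [G] plus a bounded shot: with [a = disk_avg G] the slope of a shot [k] is
    [moment (G + k) r / r ^+ 2]. The profiles are separated by their moments because a solution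
    determines [- r u']. Moments determine the force, and the start of a shot ending at [0] is its
    total force. *)
Lemma two_profiles h : mu.-integrable `[0, 1] (EFin \o h) ->
  (forall r, 0 <= r <= 1 -> 0 <= h r) -> 4 * mass h 1 <= 8^-1 ->
  exists k1 k2, [/\ profile h k1, profile h k2 &
    ~ forall r, 0 < r < 1 -> moment k1 r = moment k2 r].
Proof.
move=> h_int h_ge0 hsmall.
have F10 : 0 <= mass h 1 by exact: mass_ge0.
set G := log_potential h.
have [a aE] : exists a, a = disk_avg G by exists (disk_avg G).
have a_meas : measurable_fun (`[0, 1] : set R) a by rewrite aE; exact: disk_avg_potential_meas.
have a_ge0 r : 0 <= r <= 1 -> 0 <= a r.
  by move=> r01; rewrite aE divr_ge0 ?sqr_ge0// moment_potential_ge0.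
have a_le r : 0 <= r <= 1 -> a r ^+ 2 * r <= (4 * mass h 1) ^+ 2.
  move=> /andP[]; rewrite le_eqVlt => /predU1P[<-|r0] r1.
    by rewrite mulr0 sqr_ge0.
  have q0 := root4_gt0 r0; have q1 := root4_le1 r1.
  have h1 : (a r * root4 r) ^+ 2 <= (4 * mass h 1) ^+ 2.
    have ar0 : 0 <= a r by rewrite a_ge0// r1 ltW.
    have n1 : 0 <= a r * root4 r := mulr_ge0 ar0 (ltW q0).
    have n2 : 0 <= 4 * mass h 1 by exact: mulr_ge0.
    rewrite ler_pXn2r ?nnegrE//.
    by rewrite aE; exact: disk_avg_potential_le.
  rewrite (le_trans _ h1)// exprMn ler_wpM2l ?sqr_ge0//.
  rewrite -{1}(root4X (ltW r0)) (exprD _ 2 2) ler_piMr ?sqr_ge0//.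
  by rewrite expr_le1// ltW.
have a_mono r s : 0 < r -> r <= s -> s <= 1 -> r ^+ 2 * a r <= s ^+ 2 * a s.
  move=> r0 rs s1.
  have E x : 0 < x -> x ^+ 2 * a x = moment G x.
    by move=> x0; rewrite aE /disk_avg mulrCA divff ?mulr1// expf_neq0// gt_eqF.
  rewrite !E ?(lt_le_trans r0)// /moment (Rintegral_split (ltW r0) rs); last first.
    exact: (bounded_by_int (log_potentialMid_bounded h_int h_ge0)).
  rewrite lerDl; apply: Rintegral_itv_ge0 => t /andP[rt _].
  have t0 := lt_le_trans r0 rt.
  by rewrite mulr_ge0 ?(log_potential_ge0 h_ge0)// ltW.
have e_ge0 : 0 <= 4 * mass h 1 by rewrite mulr_ge0.
have [C [c1 [c2 [k1 [k2 [c12 [k1C k2C] k1E k2E [k11 k21]]]]]]] :=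
  two_shots a_meas a_ge0 a_le e_ge0 hsmall a_mono.
have slopeE k : bounded_by C k -> forall r, 0 < r <= 1 ->
    slope a k r = moment (fun t => G t + k t) r / r ^+ 2.
  move=> kC r /andP[r0 r1]; rewrite /slope aE /disk_avg -mulrDl; congr (_ / _).
  rewrite /moment -RintegralD//.
  - by apply: eq_Rintegral => t _; rewrite mulrDl.
  - exact: (bounded_by_int (log_potentialMid_bounded h_int h_ge0)).
  - exact: (moment_of_bounded kC).
have f_int c k : bounded_by C k ->
    (forall r, 0 <= r <= 1 -> k r = shoot a c k r) -> forall r, 0 <= r -> r <= 1 ->
    mu.-integrable `[r, 1] (EFin \o force a k).
  move=> kC kE r r0 r1; apply: (@integrable_sub _ 0 1) => //.
  have C0 : 0 <= C by case: kC => _ /(_ 0); rewrite lexx ler01 => /(_ isT); apply: le_trans.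
  apply: (bounded_by_int (force_bounded a_meas a_ge0 a_le e_ge0 hsmall kC C0 _)) => //.
  by move=> t t01; case: kC => _ /(_ _ t01); exact: le_trans (ler_norm _).
(* A shot ending at [0] equals the force still to be spent, hence is nonnegative. Its slope is then
   nonnegative too, and the positive part in [force] can be removed. *)
have kI c k : bounded_by C k -> (forall r, 0 <= r <= 1 -> k r = shoot a c k r) ->
    k 1 = 0 -> forall r, 0 <= r <= 1 -> k r = \int[mu]_(t in `[r, 1]) force a k t.
  move=> kC kE k10 r /andP[r0 r1].
  have := kE 1; rewrite ler01 lexx k10 => /(_ isT).
  rewrite kE ?r0// /shoot (Rintegral_split r0 r1); last exact: f_int kE _ _ _.
  lra.
have prof c k : bounded_by C k -> (forall r, 0 <= r <= 1 -> k r = shoot a c k r) ->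
    k 1 = 0 -> profile h (fun t => G t + k t).
  move=> kC kE k10; have kI' := kI _ _ kC kE k10.
  have k0 r : 0 <= r <= 1 -> 0 <= k r.
    move=> /[dup] /kI' -> /andP[r0 r1]; apply: Rintegral_itv_ge0 => t /andP[rt _].
    by rewrite force_ge0// (le_trans r0).
  split.
  - by apply: measurable_funD; [exact: log_potential_meas|case: kC].
  - exists (4 * mass h 1 + C) => r /andP[r0 r1].
    rewrite addr_ge0 ?(log_potential_ge0 h_ge0) ?k0 ?(ltW r0)//=.
    have q0 := root4_gt0 r0; have q1 := root4_le1 r1.
    rewrite ler_pdivlMr// mulrDl lerD ?log_potential_le//.
    have kr : k r <= C.
      by case: kC => _ /(_ r); rewrite r1 ltW// => /(_ isT); exact: le_trans (ler_norm _).
    by rewrite (le_trans _ kr)// ler_piMr// k0// r1 ltW.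
  - move=> r /andP[r0 r1]; rewrite kI' ?r1 ?ltW// /G /log_potential.
    rewrite -RintegralD//; [|exact: mass_div_int|exact: f_int kE _ (ltW r0) _].
    apply: eq_Rintegral_itv => t /andP[rt t1]; have t0 := lt_le_trans r0 rt.
    rewrite /force (max_idPr _); last first.
      by rewrite addr_ge0 ?a_ge0 ?divr_ge0 ?sqr_ge0 ?(ltW t0)//;
        apply: Rintegral_itv_ge0 => s /andP[s0 st];
        rewrite mulr_ge0// k0// s0 (le_trans st).
    rewrite slopeE ?t0//; move: (moment _ t) => m; field; by rewrite gt_eqF.
exists (fun t => G t + k1 t), (fun t => G t + k2 t).
split; [exact: prof k1E k11|exact: prof k2E k21|] => E.
have : c1 = c2; last by move=> cE; move: c12; rewrite cE ltxx.
have cI c k : (forall r, 0 <= r <= 1 -> k r = shoot a c k r) -> k 1 = 0 ->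
    c = \int[mu]_(t in `[0, 1]) force a k t.
  move=> kE k10; have := kE 1; rewrite ler01 lexx k10 => /(_ isT) /eqP.
  by rewrite eq_sym subr_eq0 => /eqP.
(* The moments agree on the open interval only. The end point [1] is negligible, and at [0] the
   force vanishes because of its factor [r]. *)
rewrite (cI _ _ k1E k11) (cI _ _ k2E k21) -!Rintegral_itv_bndo_bndc; first last.
- by apply: integrableS (f_int _ _ k1C k1E 0 _ _) => // x /=; rewrite !in_itv/= => /andP[-> /ltW].
- by apply: integrableS (f_int _ _ k2C k2E 0 _ _) => // x /=; rewrite !in_itv/= => /andP[-> /ltW].
apply: eq_Rintegral => t; rewrite inE/= in_itv/= => /andP[].
rewrite le_eqVlt => /predU1P[<-|t0] t1; first by rewrite /force !mulr0 !mul0r.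
by rewrite /force !slopeE ?t0 ?(ltW t1)// E// t0.
Qed.

End profiles.

(** * Exchange of integrals *)

Section swap.
Context {R : realType}.
Local Notation mu := (@lebesgue_measure R).
Implicit Types (h g : R -> R).

(** Both sides integrate [h t * g r] over the triangle [t <= r]. This serves as integration by parts
    for an [h] that is merely integrable, whose primitive need not be differentiable at every
    point. *)
Lemma Rintegral_primitive_swap (a b : R) h g :
  mu.-integrable `[a, b] (EFin \o h) -> mu.-integrable `[a, b] (EFin \o g) ->
  \int[mu]_(r in `[a, b]) ((\int[mu]_(t in `[a, r]) h t) * g r) =
  \int[mu]_(t in `[a, b]) (h t * \int[mu]_(r in `[t, b]) g r).
Proof.
move=> inth intg; pose I := (`[a, b]%classic : set R).
have mI : measurable I by exact: measurable_itv.
have meas f : mu.-integrable I (EFin \o f) -> measurable_fun setT (f \_ I).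
  move=> intf; apply/(measurable_restrictT _ _).1 => //.
  by apply/measurable_EFinP; exact: measurable_int intf.
have abs_fin f : mu.-integrable I (EFin \o f) ->
    (\int[mu]_x `|(f \_ I) x|%:E < +oo)%E.
  move=> /integrableP[_]; rewrite integral_mkcond; congr (_ < _)%E.
  apply: eq_integral => x _; rewrite !patchE; case: ifPn => //=.
  by rewrite normr0.
pose H (z : R * R) : R := if z.1 <= z.2 then (h \_ I) z.1 * (g \_ I) z.2 else 0.
have mH : measurable_fun setT H.
  apply: measurable_fun_ifT => //.
    by apply: measurable_fun_ler; [exact: measurable_fst|exact: measurable_snd].
  by apply: measurable_funM;
    [apply: measurableT_comp (meas _ inth) measurable_fst|
     apply: measurableT_comp (meas _ intg) measurable_snd].
have iH : (mu \x mu)%E.-integrable setT (EFin \o H).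
  apply/integrable12ltyP; first exact/measurable_EFinP.
  set N := (\int[mu]_y `|(g \_ I) y|%:E)%E.
  have N0 : (0 <= N)%E by apply: integral_ge0 => y _; rewrite lee_fin.
  have [n n0 NE] : exists2 n, 0 <= n & N = n%:E.
    by exists (fine N); [rewrite fine_ge0|rewrite fineK// ge0_fin_numE// abs_fin].
  (* Without the constraint [t <= r] the integrand is a product, and the double integral is the
     product of two L^1 norms. *)
  apply: (@le_lt_trans _ _ (\int[mu]_x (`|(h \_ I) x|%:E * N))%E).
    apply: ge0_le_integral => //.
    - by move=> x _; apply: integral_ge0 => y _; rewrite lee_fin.
    - have mabs : measurable_fun setT (fun z => `|H z|%:E).
        by apply/measurable_EFinP; apply: measurableT_comp.
      have nn z : (0 <= `|H z|%:E)%E by rewrite lee_fin.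
      exact: (measurable_fun_fubini_tonelli_F (m2 := mu) _ mabs nn).
    - apply: emeasurable_funM => //; apply/measurable_EFinP.
      by apply: measurableT_comp => //; exact: meas.
    - move=> x _; rewrite -ge0_integralZl//.
      + apply: ge0_le_integral => //.
        * apply/measurable_EFinP/measurableT_comp => //.
          exact: (measurableT_comp mH (measurable_pair1 x)).
        * apply: emeasurable_funM => //; apply/measurable_EFinP.
          by apply: measurableT_comp => //; exact: meas.
        * move=> y _; rewrite -EFinM lee_fin /H/=; case: ifP => _.
            by rewrite normrM.
          by rewrite normr0 mulr_ge0.
      + by apply/measurable_EFinP/measurableT_comp => //; exact: meas.
  rewrite NE ge0_integralZr//; last first.
    by apply/measurable_EFinP/measurableT_comp => //; exact: meas.
  by rewrite muleC lte_mul_pinfty// abs_fin.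
have sub c d f : a <= c -> d <= b -> mu.-integrable I (EFin \o f) ->
    mu.-integrable `[c, d] (EFin \o f) by exact: integrable_sub.
have innert r : (\int[mu]_t (EFin \o H) (t, r) =
    (((fun r => (\int[mu]_(t in `[a, r]) h t) * g r) \_ I) r)%:E)%E.
  rewrite patchE; case: ifPn => [|rI]; last first.
    rewrite integral0_eq// => t _; rewrite /H/= [(g \_ I) r]patchE (negbTE rI).
    by rewrite mulr0 if_same.
  rewrite /I inE/= in_itv/= => /andP[ar rb].
  rewrite -RintegralZr//; last exact: sub inth.
  rewrite [RHS]fineK; last first.
    apply: integrable_fin_num => //.
    have := integrable_scaler (g r) (measurable_itv `[a, r]) (sub _ _ _ (lexx a) rb inth).
    by congr (_.-integrable _ _); apply/funext => t /=; rewrite mulrC.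
  rewrite [RHS]integral_mkcond; apply: eq_integral => t _.
  rewrite /H patchE/= !patchE.
  have rI : r \in I by rewrite /I inE/= in_itv/= ar.
  rewrite rI; case: ifPn => tr; last first.
    by rewrite ifF//; apply/negP; rewrite /I inE/= in_itv/= (negbTE tr) andbF.
  case: ifPn => tI.
  - rewrite ifT// inE/= in_itv/= tr andbT.
    by move: tI; rewrite /I inE/= in_itv/= => /andP[].
  - rewrite mul0r ifF//; apply/negP; rewrite /I inE/= in_itv/= tr andbT => at_.
    by move: tI; rewrite /I notin_setE/= in_itv/= at_ (le_trans tr rb).
have innerr t : (\int[mu]_r (EFin \o H) (t, r) =
    (((fun t => h t * (\int[mu]_(r in `[t, b]) g r)) \_ I) t)%:E)%E.
  rewrite patchE; case: ifPn => [|tI]; last first.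
    rewrite integral0_eq// => r _; rewrite /H/= patchE (negbTE tI).
    by rewrite mul0r if_same.
  rewrite /I inE/= in_itv/= => /andP[at_ tb].
  rewrite -RintegralZl//; last exact: sub intg.
  rewrite [RHS]fineK; last first.
    apply: integrable_fin_num => //.
    exact: (integrable_scaler (h t) (measurable_itv `[t, b]) (sub _ _ _ at_ (lexx b) intg)).
  rewrite [RHS]integral_mkcond; apply: eq_integral => r _.
  rewrite /H patchE/= !patchE.
  have tI : t \in I by rewrite /I inE/= in_itv/= at_.
  rewrite tI; case: ifPn => tr; last first.
    by rewrite ifF//; apply/negP; rewrite /I inE/= in_itv/= (negbTE tr).
  case: ifPn => rI.
  - rewrite ifT// inE/= in_itv/= tr/=.
    by move: rI; rewrite /I inE/= in_itv/= => /andP[].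
  - rewrite mulr0 ifF//; apply/negP; rewrite /I inE/= in_itv/= tr/= => rb.
    by move: rI; rewrite /I notin_setE/= in_itv/= rb (le_trans at_ tr).
have := Fubini iH.
under eq_integral do rewrite innerr.
under [X in _ = X -> _]eq_integral do rewrite innert.
move=> E; rewrite [LHS]Rintegral_mkcond [RHS]Rintegral_mkcond /Rintegral.
by congr fine; rewrite E.
Qed.

End swap.

(** * Test functions *)

Section test_functions.
Context {R : realType}.
Local Notation mu := (@lebesgue_measure R).
Implicit Types (phi u g : R -> R).

Lemma derive1_is_derive phi (x : R) : derivable phi x 1 ->
  is_derive x 1 phi (derive1 phi x).
Proof. by move=> dphi; apply: DeriveDef => //; rewrite derive1E. Qed.

Lemma smooth_is_derive phi : smooth phi ->
  (forall x : R, is_derive x 1 phi (derive1 phi x)) /\ continuous (derive1 phi).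
Proof.
move=> /(_ 1%N) [_ /(_ 1) [dphi [cphi _]]]; split.
  by move=> x; exact: derive1_is_derive.
by rewrite (_ : derive1 phi = 'D_1 phi)//; apply/funext => x; rewrite derive1E.
Qed.

Lemma near0_derive1 phi (x : R) : (\forall z \near x, phi z = 0) ->
  derive1 phi x = 0.
Proof.
move=> phi0; rewrite derive1E (near_eq_derive (g := cst 0))//.
exact: derive_cst.
Qed.

Lemma is_derive_prod (f1 f2 : R -> R) (x d1 d2 : R) :
  is_derive x 1 f1 d1 -> is_derive x 1 f2 d2 ->
  is_derive x 1 (fun z => f1 z * f2 z) (d1 * f2 x + f1 x * d2).
Proof.
move=> h1 h2; apply: (@is_derive_eq _ _ _ _ _ _ _ _ (is_deriveM h1 h2)).
by rewrite addrC; congr (_ + _); exact: mulrC.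
Qed.

Lemma continuous_locally_integrable (a b : R) f : 
  (forall x, a < x < b -> {for x, continuous f}) ->
  locally_integrable `]a, b[ f.
Proof.
move=> cf; have cf' : {in (`]a, b[%classic : set R), continuous f}.
  by move=> x; rewrite inE/= in_itv/=; exact: cf.
split.
- by apply: open_continuous_measurable_fun => //; exact: interval_open.
- exact: interval_open.
- move=> K Kab cK; have : mu.-integrable K (EFin \o f).
    apply: continuous_compact_integrable => //.
    apply: continuous_in_subspaceT => x; rewrite inE => /Kab xab.
    by apply: cf'; rewrite inE.
  by move=> /integrableP[].
Qed.

Lemma Rintegral_oo_support (a b c d : R) f : a < c -> d < b ->
  (forall x, a < x < b -> x < c \/ d < x -> f x = 0) ->
  \int[mu]_(x in `]a, b[) f x = \int[mu]_(x in `[c, d]) f x.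
Proof.
move=> ac db f0.
have -> : `[c, d]%classic = `]a, b[%classic `&` `[c, d]%classic :> set R.
  rewrite setIidr// => x /=; rewrite !in_itv/= => /andP[cx xd].
  by rewrite (lt_le_trans ac cx) (le_lt_trans xd db).
rewrite Rintegral_mkcondr; apply: eq_Rintegral => x.
rewrite inE/= in_itv/= patchE => xab; case: ifPn => //.
rewrite notin_setE/= in_itv/= => /negP; rewrite negb_and -!ltNge => /orP h.
exact: f0.
Qed.

(** A test function lives on a compact part of [(0, 1)]. Integration by parts on a slightly larger
    interval [[c, d]] inside [(0, 1)] never meets the end points, where [u] and [g] may be
    singular. *)
Lemma weak_deriv_classical u g :
  (forall x : R, 0 < x < 1 -> is_derive x 1 u (g x)) ->
  (forall x, 0 < x < 1 -> {for x, continuous g}) -> weak_deriv u g.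
Proof.
move=> du cg; have cu x : 0 < x < 1 -> {for x, continuous u}.
  by move=> /du; exact: is_derive_continuous.
split; [exact: continuous_locally_integrable..|].
move=> phi [sphi [a0 [b0 [a00 b01 phi0]]]].
have [dphi cdphi] := smooth_is_derive sphi.
have cphi x : {for x, continuous phi} := is_derive_continuous (dphi x).
(* [test01] does not order its two bounds; comparing with [1/2] does. *)
pose a := Num.min a0 2^-1; pose b := Num.max b0 2^-1.
have [a_gt0 a_le] : 0 < a /\ a <= 2^-1 by rewrite lt_min a00 ge_min lexx orbT; split => //; lra.
have [b_lt1 b_ge] : b < 1 /\ 2^-1 <= b.
  by rewrite gt_max b01 le_max lexx orbT; split => //; lra.
have phi0' x : x < a \/ b < x -> phi x = 0.
  move=> h; apply: phi0; case: h => h; [left|right].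
    by rewrite (lt_le_trans h)// ge_min lexx.
  by rewrite (le_lt_trans _ h)// le_max lexx.
have dphi0 x : x < a \/ b < x -> derive1 phi x = 0.
  case => h; apply: near0_derive1; near=> z; apply: phi0'; [left|right].
    by near: z; exact: lt_nbhsl.
  by near: z; exact: lt_nbhsr.
pose c := a / 2; pose d := (1 + b) / 2.
have c0 : 0 < c by rewrite /c; lra.
have ca : c < a by rewrite /c; lra.
have bd : b < d by rewrite /d; lra.
have d1 : d < 1 by rewrite /d; lra.
have cd : c < d by lra.
have inside x : c <= x <= d -> 0 < x < 1.
  by move=> /andP[cx xd]; rewrite (lt_le_trans c0 cx) (le_lt_trans xd d1).
have int (f : R -> R) : (forall x, 0 < x < 1 -> {for x, continuous f}) ->
    mu.-integrable `[c, d] (EFin \o f).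
  move=> cf; apply: continuous_compact_integrable; first exact: segment_compact.
  by apply: continuous_in_subspaceT => x; rewrite inE/= in_itv/= => /inside /cf.
have out x : x < c \/ d < x -> x < a \/ b < x.
  by move=> [h|h]; [left|right]; lra.
rewrite !(@Rintegral_oo_support 0 1 c d)//; last 2 first.
  by move=> x _ /out h; rewrite phi0' ?mulr0.
  by move=> x _ /out h; rewrite dphi0 ?mulr0.
have i1 : mu.-integrable `[c, d] (EFin \o (fun r => g r * phi r)).
  by apply: int => x x01; apply: cvgM; [exact: cg|exact: cphi].
have i2 : mu.-integrable `[c, d] (EFin \o (fun r => u r * derive1 phi r)).
  by apply: int => x x01; apply: cvgM; [exact: cu|exact: cdphi].
apply/eqP; rewrite -addr_eq0 addrC; apply/eqP.
rewrite -RintegralD//.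
have vanish x : x = c \/ x = d -> phi x = 0.
  by move=> h; apply: phi0'; case: h => ->; [left|right].
rewrite -[RHS](subrr 0).
have dP (x : R) : 0 < x < 1 ->
    is_derive x 1 (fun r => u r * phi r) (g x * phi x + u x * derive1 phi x).
  by move=> x01; exact: is_derive_prod (du _ x01) (dphi x).
have cP x : 0 < x < 1 -> {for x, continuous (fun r => u r * phi r)}.
  by move=> /dP; exact: is_derive_continuous.
have P0 x : x = c \/ x = d -> u x * phi x = 0 by move=> /vanish ->; rewrite mulr0.
apply: (@improper_FTC _ c d _ (fun r => u r * phi r)) => //.
- exact: integrable_addr.
- move=> x /andP[cx xd]; have x01 : 0 < x < 1 by rewrite inside// !ltW.
  apply: cvgD; first by apply: cvgM; [exact: cg|exact: cphi].
  by apply: cvgM; [exact: cu|exact: cdphi].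
- by move=> x /andP[cx xd]; apply: dP; rewrite inside// !ltW.
- rewrite -(P0 c); last by left.
  by apply: cvg_at_right_filter; apply: cP; rewrite inside// lexx ltW.
- rewrite -(P0 d); last by right.
  by apply: cvg_at_left_filter; apply: cP; rewrite inside// lexx andbT ltW.
Unshelve. all: by end_near. Qed.

(** Only [phi] on [r >= 0] is constrained, so [phi] need not be differentiable at [0]. Restricting
    the planar function to the first axis gives an even function [p0], regular on the whole line,
    that agrees with [phi] for [r >= 0]. Evenness yields [p1 0 = 0], which compensates the division
    by [r] in the Laplacian. *)
Lemma radial_test_profile phi : radial_test phi ->
  exists (p0 p1 p2 : R -> R) (rho : R),
    [/\ forall x : R, is_derive x 1 p0 (p1 x) /\ is_derive x 1 p1 (p2 x),
        continuous p2, p1 0 = 0,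
        forall r, 0 <= r -> phi r = p0 r &
     [/\ forall r, 0 < r -> derive1 phi r = p1 r /\ derive1n 2 phi r = p2 r,
         0 < rho < 1 & forall r, rho < r -> p0 r = 0 /\ p1 r = 0]].
Proof.
move=> [sPhi [rho0 rho01 phi0]].
set Phi : R * R -> R := fun x => _ in sPhi.
pose v : R * R := (1, 0).
have [_ /(_ v) [dPhi [_ /(_ v)[dPhi1 [cPhi2 _]]]]] := sPhi 2%N.
pose line (F : R * R -> R) (r : R) := F (r, 0).
have lineE F (r : R) :
    (fun h : R => h^-1 *: ((F \o shift ((r, 0) : R * R)) (h *: v) - F (r, 0))) =
    (fun h : R => h^-1 *: ((line F \o shift r) (h *: (1 : R)) - line F r)).
  apply/funext => h; rewrite /line /=; congr (_ *: (F _ - _)).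
  by rewrite /v; congr pair; rewrite /= ?scaler0 ?addr0.
have lineD F (r : R) : derivable F (r, 0) v -> is_derive r 1 (line F) (line ('D_v F) r).
  move=> dF; apply: DeriveDef.
    by move: dF; rewrite /derivable lineE.
  by rewrite /line /derive lineE.
pose p0 := line Phi; pose p1 := line ('D_v Phi); pose p2 := line ('D_v ('D_v Phi)).
have d0 (x : R) : is_derive x 1 p0 (p1 x) by exact: lineD.
have d1 (x : R) : is_derive x 1 p1 (p2 x) by exact: lineD.
have p0E r : 0 <= r -> phi r = p0 r.
  by move=> r0; rewrite /p0 /line /Phi/= expr0n/= addr0 sqrtr_sqr ger0_norm.
have p0N r : p0 (- r) = p0 r by rewrite /p0 /line /Phi/= sqrrN.
(* [rho0] may be negative; beyond a positive radius [phi] and [p0] agree. *)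
pose rho := Num.max rho0 2^-1.
have rho_gt0 : 0 < rho by rewrite lt_max invr_gt0 ltr0n orbT.
have rho_lt1 : rho < 1 by rewrite gt_max rho01; lra.
have p00 r : rho < r -> p0 r = 0.
  move=> rr; have r0 := lt_trans rho_gt0 rr; rewrite -p0E ?(ltW r0)//.
  by apply: phi0; rewrite ?(ltW r0)// (le_trans _ (ltW rr))// le_max lexx.
have D1 r : 0 < r -> derive1 phi r = p1 r.
  move=> r0; rewrite derive1E (near_eq_derive (g := p0)).
    by have [_ ->] := d0 r.
  near=> z; apply: p0E; apply/ltW; near: z; exact: lt_nbhsr.
exists p0, p1, p2, rho; split.
- by move=> x; split; [exact: d0|exact: d1].
- move=> x; have cline : (fun r : R => (r, 0 : R)) z @[z --> x] --> ((x, 0) : R * R).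
    by apply: (@cvg_pair _ _ _ _ (nbhs x) (nbhs (0 : R))); [exact: cvg_id|exact: cvg_cst].
  apply: (cvg_comp _ _ cline); exact: (cPhi2 (x, 0)).
- have dN : is_derive (0 : R) 1 (p0 \o -%R) (p1 (- 0) * -1).
    apply: is_derive1_comp.
  have E : p0 \o -%R = p0 by apply/funext => r; exact: p0N.
  move: dN; rewrite E oppr0 mulrN1 => -[_ h1].
  have [_ h2] := d0 0; move: h1; rewrite h2; lra.
- exact: p0E.
- split.
  + move=> r r0; split; first exact: D1.
    rewrite /= derive1E (near_eq_derive (g := p1)).
      by have [_ ->] := d1 r.
    by near=> z; apply: D1; near: z; exact: lt_nbhsr.
  + by rewrite rho_gt0 rho_lt1.
  + move=> r rr; split; first exact: p00.
    have [_ <-] := d0 r; rewrite (near_eq_derive (g := cst 0)) ?derive_cst//.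
    by near=> z; apply: p00; near: z; exact: lt_nbhsr.
Unshelve. all: by end_near. Qed.

End test_functions.

(** * Regularity and weak formulation *)

Section continuity_lemmas.
Context {R : realType}.

Lemma continuous_sqr (v : R -> R) (x : R) : {for x, continuous v} ->
  {for x, continuous (fun t => v t ^+ 2)}.
Proof.
move=> cv; apply: (@continuous_comp _ _ _ v (fun z => z ^+ 2)) => //.
exact: exprn_continuous.
Qed.

Lemma near_eq_continuous (v w : R -> R) (x : R) : (\near x, v x = w x) ->
  {for x, continuous v} -> {for x, continuous w}.
Proof.
move=> vw; rewrite /prop_for /continuous_at (nbhs_singleton vw) => cv.
exact: cvg_trans (near_eq_cvg vw) cv.
Qed.

End continuity_lemmas.

(** * Reconstruction of the solution from a profile *)

Section solution.
Context {R : realType}.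
Local Notation mu := (@lebesgue_measure R).
Variables (h k : R -> R) (C : R).
Hypothesis h_int : mu.-integrable `[0, 1] (EFin \o h).
Hypothesis h_ge0 : forall r, 0 <= r <= 1 -> 0 <= h r.
Hypothesis k_meas : measurable_fun (`[0, 1] : set R) k.
Hypothesis k_bd : forall r, 0 < r <= 1 -> 0 <= k r <= C / root4 r.
Definition flux (t : R) := (moment k t ^+ 2 / (2 * t ^+ 2) + mass h t) / t.
Hypothesis k_eq : forall r, 0 < r <= 1 -> k r = \int[mu]_(t in `[r, 1]) flux t.
Implicit Types r t x : R.

Local Notation y := (moment k).

(** [slope1] and [slope2] are u' and u'', read off from [- r u' = moment k] and
    [- (u'' + u'/r) = k]; [radial_sol] is u, the primitive that vanishes at [1]. *)
Definition slope1 r := - (y r / r).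
Definition slope2 r := y r / r ^+ 2 - k r.
Definition radial_sol r := - \int[mu]_(t in `[r, 1]) slope1 t.

Lemma bound_ge0 : 0 <= C.
Proof.
have /andP[k0 kC] := @k_bd 1 (introT andP (conj ltr01 (lexx 1))).
by have := le_trans k0 kC; rewrite /root4 !sqrtr1 divr1.
Qed.

Lemma profileMid_le r : 0 < r <= 1 -> k r * r <= C * (r / root4 r).
Proof.
move=> /[dup] r01 /andP[r0 r1]; have /andP[_ kr] := k_bd r01.
have -> : C * (r / root4 r) = C / root4 r * r by ring.
by rewrite ler_wpM2r// ltW.
Qed.

Lemma profileMid_bounded : bounded_by C (fun t => k t * t).
Proof.
split; first exact: measurable_funM.
move=> r /andP[]; rewrite le_eqVlt => /predU1P[<-|r0] r1.
  by rewrite mulr0 normr0 bound_ge0.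
have r01 : 0 < r <= 1 by rewrite r0.
rewrite ger0_norm; last by rewrite mulr_ge0 ?(ltW r0)//; case/andP: (k_bd r01).
by rewrite (le_trans (profileMid_le r01))// ler_piMr ?bound_ge0// div_root4_le1.
Qed.

Lemma profileMid_int r s : 0 <= r -> s <= 1 ->
  mu.-integrable `[r, s] (EFin \o (fun t => k t * t)).
Proof.
by move=> r0 s1; apply: (integrable_sub r0 s1); exact: (bounded_by_int profileMid_bounded).
Qed.

Lemma moment_ge0 r : r <= 1 -> 0 <= y r.
Proof.
move=> r1; apply: Rintegral_itv_ge0 => t /andP[].
rewrite le_eqVlt => /predU1P[<-|t0] tr; first by rewrite mulr0.
have /k_bd /andP[k0 _] : 0 < t <= 1 by rewrite t0 (le_trans tr).
by rewrite mulr_ge0// ltW.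
Qed.

Lemma moment_le r : 0 < r <= 1 -> y r <= C * (r / root4 r) * r.
Proof.
move=> /andP[r0 r1]; have -> : C * (r / root4 r) * r = C * (r / root4 r) * (r - 0) by rewrite subr0.
apply: Rintegral_le_cst; [exact: ltW|exact: profileMid_int|] => t /andP[].
rewrite le_eqVlt => /predU1P[<-|t0] tr.
  by rewrite mulr0 mulr_ge0 ?bound_ge0// divr_ge0 ?root4_ge0 ?ltW.
rewrite (le_trans (profileMid_le _)) ?t0 ?(le_trans tr)//.
by rewrite ler_wpM2l ?bound_ge0// div_root4_mono.
Qed.

Lemma moment_continuous x : 0 < x < 1 -> {for x, continuous y}.
Proof.
move=> x01; have := parameterized_integral_continuous ler01 (profileMid_int (lexx 0) (lexx 1)).
by move=> /(continuous_within_itvP _ ltr01)[+ _ _]; apply; rewrite in_itv.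
Qed.

Lemma inv_continuous x : 0 < x -> {for x, continuous (fun t : R => t^-1)}.
Proof. by move=> x0; apply: cvgV; [rewrite gt_eqF|exact: cvg_id]. Qed.

Lemma flux_continuous x : 0 < x < 1 -> {for x, continuous flux}.
Proof.
move=> /[dup] x01 /andP[x0 _]; apply: cvgM; last exact: inv_continuous.
apply: cvgD; last exact: mass_continuous.
apply: cvgM.
  by apply: continuous_sqr; exact: moment_continuous.
apply: cvgV; first by rewrite mulf_neq0 ?expf_neq0 ?gt_eqF.
by apply: cvgM; [exact: cvg_cst|exact: exprn_continuous].
Qed.

Lemma flux_le t : 0 < t <= 1 -> 0 <= flux t <= (C ^+ 2 + mass h 1) / t.
Proof.
move=> /[dup] t01 /andP[t0 t1]; have yt := moment_ge0 t1.
have E0 : 0 <= y t ^+ 2 / (2 * t ^+ 2) + mass h t.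
  apply: addr_ge0; last exact: mass_ge0.
  by apply: divr_ge0; [exact: sqr_ge0|rewrite mulr_ge0// sqr_ge0].
rewrite /flux divr_ge0 ?(ltW t0)//= ler_pM2r ?invr_gt0//.
rewrite lerD//; last by apply: mass_mono => //; exact: ltW.
rewrite ler_pdivrMr ?mulr_gt0 ?exprn_gt0//.
have h1 : y t <= C * t.
  rewrite (le_trans (moment_le t01))// ler_wpM2r ?(ltW t0)//.
  by rewrite ler_piMr ?bound_ge0// div_root4_le1.
have h2 : y t ^+ 2 <= (C * t) ^+ 2.
  by rewrite ler_pXn2r// nnegrE mulr_ge0 ?bound_ge0// ltW.
have := sqr_ge0 (C * t); have -> : C ^+ 2 * (2 * t ^+ 2) = 2 * (C * t) ^+ 2 by ring.
by move: h2; lra.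
Qed.

Lemma flux_int r : 0 < r -> mu.-integrable `[r, 1] (EFin \o flux).
Proof.
move=> r0; apply: (@bounded_integrable _ _ _ ((C ^+ 2 + mass h 1) / r)).
  apply: continuous_itv_measurable => x /andP[rx x1].
  by apply: flux_continuous; rewrite x1 (lt_trans r0).
move=> t /andP[rt t1]; have t0 := lt_le_trans r0 rt.
have /andP[f0 f1] : 0 <= flux t <= (C ^+ 2 + mass h 1) / t by apply: flux_le; rewrite t0.
rewrite ger0_norm// (le_trans f1)// ler_wpM2l ?lef_pV2//.
by rewrite addr_ge0 ?sqr_ge0// mass_ge0.
Qed.

Lemma is_derive_profile x : 0 < x < 1 -> is_derive x 1 k (- flux x).
Proof.
move=> /[dup] x01 /andP[x0 x1].
apply: (@is_derive_near _ (fun r => \int[mu]_(t in `[r, 1]) flux t)).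
  near=> r; rewrite k_eq//.
  have /andP[-> /ltW ->] // : 0 < r < 1 by near: r; exact: near_itvoo.
apply: (@is_derive_Rintegral_lb _ (x / 2)).
- by rewrite x1 andbT; lra.
- by apply: flux_int; lra.
- exact: flux_continuous.
Unshelve. all: by end_near. Qed.

Lemma profile_continuous x : 0 < x < 1 -> {for x, continuous k}.
Proof. by move=> /is_derive_profile; exact: is_derive_continuous. Qed.

Lemma is_derive_moment x : 0 < x < 1 -> is_derive x 1 y (k x * x).
Proof.
move=> x01; apply: (@is_derive_Rintegral_ub _ 0 1) => //.
  exact: profileMid_int.
by apply: cvgM; [exact: profile_continuous|exact: cvg_id].
Qed.

Lemma is_derive_inv x : 0 < x -> is_derive x 1 (fun t : R => t^-1) (- x ^- 2).
Proof.
move=> x0; have x0' : x != 0 by rewrite gt_eqF.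
have d := @is_deriveV R id x 1 1 x0' (is_derive_id _ _).
by apply: (@is_derive_eq _ _ _ _ _ _ _ _ d); exact: mulr1.
Qed.

Lemma is_derive_slope1 x : 0 < x < 1 -> is_derive x 1 slope1 (slope2 x).
Proof.
move=> /[dup] x01 /andP[x0 _].
have := is_derive_prod (is_derive_moment x01) (is_derive_inv x0) => d.
have := is_deriveN d => {}d.
apply: (@is_derive_eq _ _ _ _ _ _ _ _ d).
by rewrite /slope2; field; rewrite gt_eqF.
Qed.

Lemma slope1_continuous x : 0 < x < 1 -> {for x, continuous slope1}.
Proof. by move=> /is_derive_slope1; exact: is_derive_continuous. Qed.

Lemma slope2_continuous x : 0 < x < 1 -> {for x, continuous slope2}.
Proof.
move=> /[dup] x01 /andP[x0 _]; apply: cvgB; last exact: profile_continuous.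
apply: cvgM; first exact: moment_continuous.
by apply: cvgV; [rewrite expf_neq0// gt_eqF|exact: exprn_continuous].
Qed.

Lemma slope1_le r : 0 < r <= 1 -> `|slope1 r| <= C * (r / root4 r).
Proof.
move=> /[dup] r01 /andP[r0 r1]; rewrite normrN ger0_norm.
  by rewrite ler_pdivrMr// moment_le.
by rewrite divr_ge0 ?moment_ge0// ltW.
Qed.

Lemma slope1_bounded : bounded_by C slope1.
Proof.
split; first by apply: continuous_itv_measurable; exact: slope1_continuous.
move=> r /andP[]; rewrite le_eqVlt => /predU1P[<-|r0] r1.
  by rewrite /slope1 invr0 mulr0 oppr0 normr0 bound_ge0.
rewrite (le_trans (slope1_le _)) ?r0//.
by rewrite ler_piMr ?bound_ge0// div_root4_le1.
Qed.

Lemma slope1_div_le r : 0 < r <= 1 -> 0 <= y r / r ^+ 2 <= C / root4 r.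
Proof.
move=> /[dup] r01 /andP[r0 r1]; rewrite divr_ge0 ?moment_ge0 ?sqr_ge0//=.
rewrite ler_pdivrMr ?exprn_gt0// (le_trans (moment_le r01))//.
by apply: eq_le_refl; ring.
Qed.

Lemma slope2_le r : 0 < r <= 1 -> `|slope2 r| <= C / root4 r.
Proof.
move=> r01; have := slope1_div_le r01; have := k_bd r01.
move=> /andP[h1 h2] /andP[h3 h4].
by rewrite /slope2 ler_norml; apply/andP; split; lra.
Qed.

(** u' is of order [r ^ (3/4)] and u'' of order [r ^ (- 1/4)], so the nonlinear term is bounded
    although u'' need not be. *)
Lemma slope_prod_le r : 0 <= r <= 1 -> `|slope1 r * slope2 r| <= C ^+ 2.
Proof.
move=> /andP[]; rewrite le_eqVlt => /predU1P[<-|r0] r1.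
  by rewrite /slope1 invr0 mulr0 oppr0 mul0r normr0 sqr_ge0.
have r01 : 0 < r <= 1 by rewrite r0.
have q0 := root4_gt0 r0; have q1 := root4_le1 r1.
rewrite normrM (le_trans (ler_pM _ _ (slope1_le r01) (slope2_le r01)))//.
have -> : C * (r / root4 r) * (C / root4 r) = C ^+ 2 * root4 r ^+ 2.
  rewrite -{1}(root4X (ltW r0)); by field; rewrite gt_eqF.
by rewrite ler_piMr ?sqr_ge0// expr_le1// ltW.
Qed.

Lemma slope1_int r : 0 <= r -> mu.-integrable `[r, 1] (EFin \o slope1).
Proof.
by move=> r0; apply: (integrable_sub r0 (lexx 1)); exact: (bounded_by_int slope1_bounded).
Qed.

Lemma is_derive_radial_sol x : 0 < x < 1 -> is_derive x 1 radial_sol (slope1 x).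
Proof.
move=> x01; have d : is_derive x 1 (fun r => \int[mu]_(t in `[r, 1]) slope1 t) (- slope1 x).
  apply: (@is_derive_Rintegral_lb _ 0 1) => //; first exact: slope1_int.
  exact: slope1_continuous.
by apply: (@is_derive_eq _ _ _ _ _ _ _ _ (is_deriveN d)); rewrite opprK.
Qed.

Lemma weak_deriv_radial_sol : weak_deriv radial_sol slope1.
Proof.
by apply: weak_deriv_classical; [exact: is_derive_radial_sol|exact: slope1_continuous].
Qed.

Lemma weak_deriv_slope1 : weak_deriv slope1 slope2.
Proof.
by apply: weak_deriv_classical; [exact: is_derive_slope1|exact: slope2_continuous].
Qed.

Lemma L2r_bounded (M : R) (v : R -> R) : measurable_fun (`[0, 1] : set R) v ->
  (forall r, 0 < r <= 1 -> v r ^+ 2 * r <= M) -> L2r v.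
Proof.
move=> mv vM; split => //; apply: (@bounded_integrable _ _ _ `|M|).
  by apply: measurable_funM => //; exact: measurable_funX.
move=> r /andP[]; rewrite le_eqVlt => /predU1P[<-|r0] r1.
  by rewrite mulr0 normr0.
rewrite ger0_norm; last by apply: mulr_ge0; [exact: sqr_ge0|exact: ltW].
by rewrite (le_trans (vM _ _)) ?r0// ler_norm.
Qed.

Lemma bounded_L2r (M : R) (v : R -> R) : bounded_by M v -> L2r v.
Proof.
move=> [mv vM]; apply: (@L2r_bounded (M ^+ 2)) => // r /andP[r0 r1].
have vr : `|v r| <= M by rewrite vM// r1 ltW.
rewrite (@le_trans _ _ (v r ^+ 2))//; first by rewrite ler_piMr// sqr_ge0.
by rewrite -real_normK ?num_real// ler_pXn2r// nnegrE// (le_trans _ vr).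
Qed.

(** The square is of order [r ^ (- 1/2)], and the weight [r] more than compensates. This covers both
    u'' and u'/r. *)
Lemma root4_L2r (v : R -> R) : measurable_fun (`[0, 1] : set R) v ->
  (forall r, 0 < r <= 1 -> `|v r| <= C / root4 r) -> L2r v.
Proof.
move=> mv vC; apply: (@L2r_bounded (C ^+ 2)) => // r /[dup] r01 /andP[r0 r1].
have q0 := root4_gt0 r0; have q1 := root4_le1 r1.
rewrite -real_normK ?num_real//.
have : `|v r| ^+ 2 <= (C / root4 r) ^+ 2.
  by rewrite ler_pXn2r ?nnegrE ?divr_ge0 ?bound_ge0 ?(ltW q0)// vC.
move=> /(ler_wpM2r (ltW r0)) /le_trans; apply.
have -> : (C / root4 r) ^+ 2 * r = C ^+ 2 * root4 r ^+ 2.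
  by rewrite -{2}(root4X (ltW r0)); field; rewrite gt_eqF.
by rewrite ler_piMr ?sqr_ge0// expr_le1// ltW.
Qed.

Lemma radial_sol_bounded : bounded_by C radial_sol.
Proof.
split.
  apply: continuous_itv_measurable => x /is_derive_radial_sol.
  exact: is_derive_continuous.
move=> r /andP[r0 r1]; rewrite normrN (@le_trans _ _ (C * (1 - r)))//.
  apply: Rintegral_norm_le_cst => //; first exact: slope1_int.
  by move=> t /andP[rt t1]; apply: slope1_bounded.2; rewrite t1 (le_trans r0).
by rewrite ler_piMr ?bound_ge0// gerBl.
Qed.

Lemma radial_sol_W22 : W22 radial_sol.
Proof.
exists slope1, slope2; split; [exact: weak_deriv_radial_sol|exact: weak_deriv_slope1|].
split; [exact: bounded_L2r radial_sol_bounded|exact: bounded_L2r slope1_bounded| |].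
  apply: root4_L2r; last exact: slope2_le.
  by apply: continuous_itv_measurable; exact: slope2_continuous.
apply: root4_L2r.
  by apply: measurable_funM; [exact: slope1_bounded.1|exact: inv_meas].
move=> r /[dup] r01 /andP[r0 _]; have /andP[s0 sC] := slope1_div_le r01.
by rewrite /slope1 mulNr normrN -mulrA -invfM -expr2 ger0_norm.
Qed.

Lemma cvg_squeeze0 (v : R -> R) (M : R) :
  (forall r, 0 < r < 1 -> `|v r| <= M * root4 r) -> v r @[r --> 0^'+] --> 0.
Proof.
move=> vM.
have q0 : M * root4 r @[r --> (0 : R)^'+] --> 0.
  apply: cvg_at_right_filter.
  rewrite -[X in _ --> X](_ : M * root4 0 = 0); last by rewrite /root4 !sqrtr0 mulr0.
  by apply: cvgM; [exact: cvg_cst|exact: continuous_root4].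
apply: (@squeeze_cvgr _ _ _ _ (fun r => - (M * root4 r)) (fun r => M * root4 r)) => //.
  near=> r; rewrite -ler_norml; apply: vM; apply/andP; split.
    by near: r; exact: nbhs_right_gt.
  by near: r; exact: nbhs_right_lt.
by rewrite -[X in _ --> X]oppr0; apply: cvgN.
Unshelve. all: by end_near. Qed.

Lemma div_root4_le r : 0 < r < 1 -> r / root4 r <= root4 r.
Proof.
move=> /andP[r0 r1]; have q0 := root4_gt0 r0; have q1 := root4_le1 (ltW r1).
rewrite ler_pdivrMr// -{1}(root4X (ltW r0)) -expr2 (exprD _ 2 2).
by rewrite ler_piMr ?sqr_ge0// expr_le1// ltW.
Qed.

Lemma slope1_boundary0 : boundary_value0 slope1 0.
Proof.
exists slope1; first by apply: aeW.
apply: (@cvg_squeeze0 _ C) => r /[dup] r01 /andP[r0 r1].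
have r01' : 0 < r <= 1 by rewrite r0 ltW.
by rewrite (le_trans (slope1_le r01'))// ler_wpM2l ?bound_ge0// div_root4_le.
Qed.

Lemma radial_sol_trace : trace1 radial_sol 0.
Proof.
exists 0, slope1; split; [by rewrite lexx ltr01|exact: slope1_int|].
by apply: aeW => r _; rewrite sub0r.
Qed.

Lemma laplacian_trace : trace1 (fun r => slope2 r + slope1 r / r) 0.
Proof.
(* The equation for [k] is itself the trace representation. It is used away from the origin because
   [flux] need not be integrable near [0]. *)
exists 2^-1, flux; split; [by lra|by apply: flux_int; rewrite invr_gt0|].
apply: aeW => r /andP[r0 r1]; have r00 : 0 < r by lra.
rewrite -k_eq ?r00 ?ltW// /slope2 /slope1; field; by rewrite gt_eqF.
Qed.

(** With [E = u'^2 / 2 + F] the profile equation reads [k' = - E / r]. One integration by parts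
    turns the left side into [- E] against [phi']; the two summands of [E] are then integrated back
    separately, giving [u' u''] and [h] against [phi]. *)
Lemma weak_form (phi : R -> R) : radial_test phi ->
  \int[mu]_(r in `[0, 1]) ((slope2 r + slope1 r / r) *
     (derive1n 2 phi r + derive1 phi r / r) * r) =
  \int[mu]_(r in `[0, 1]) (slope1 r * slope2 r * phi r) +
  \int[mu]_(r in `[0, 1]) (h r * phi r).
Proof.
move=> /radial_test_profile [p0 [p1 [p2 [rho [dp cp2 p10 phiE [dphiE /andP[rho0 rho1] psupp]]]]]].
have cp0 x : {for x, continuous p0} := is_derive_continuous (dp x).1.
have cp1 x : {for x, continuous p1} := is_derive_continuous (dp x).2.
have bounded01 (p : R -> R) : continuous p ->
    exists2 M, 0 <= M & forall r, 0 <= r <= 1 -> `|p r| <= M.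
  move=> cp.
  have [|c _ hc] := @EVT_max R (fun r => `|p r|) 0 1 ler01.
    by apply: continuous_subspaceT => x; apply: cvg_norm; exact: cp.
  by exists `|p c| => // r r01; apply: hc; rewrite in_itv.
have [M0 M00 p0M] := bounded01 _ cp0.
have [M1 M10 p1M] := bounded01 _ cp1.
have [M2 M20 p2M] := bounded01 _ cp2.
(* Since [p1 0 = 0], the derivative of the test function is of order [r]. This offsets the
   singularity of [k] in the integrand and removes the boundary term at [0]. *)
have p1le r : 0 <= r <= 1 -> `|p1 r| <= M2 * r.
  move=> /andP[r0 r1].
  have [||c] := @MVT_segment R p1 p2 0 r r0.
  - by move=> x _; exact: (dp x).2.
  - by apply: continuous_subspaceT => x; exact: cp1.
  rewrite in_itv/= p10 !subr0 => /andP[c0 cr] ->.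
  by rewrite normrM (ger0_norm r0) ler_wpM2r// p2M// c0 (le_trans cr).
have near1 (p : R -> R) : (forall r, rho < r -> p r = 0) -> p r @[r --> 1^'-] --> 0.
  move=> p_0; apply/cvgrPdist_le => e e0; near=> r.
  have rr : rho < r by near: r; exact: nbhs_left_gt.
  by rewrite p_0// subrr normr0 ltW.
have meas (p : R -> R) : (forall x, 0 < x < 1 -> {for x, continuous p}) ->
  measurable_fun (`[0, 1] : set R) p by exact: continuous_itv_measurable.
pose E r := y r ^+ 2 / (2 * r ^+ 2) + mass h r.
have E_cont x : 0 < x < 1 -> {for x, continuous E}.
  move=> /[dup] x01 /andP[x0 _]; apply: cvgD; last exact: mass_continuous.
  apply: cvgM; first by apply: continuous_sqr; exact: moment_continuous.
  apply: cvgV; first by rewrite mulf_neq0 ?expf_neq0 ?gt_eqF.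
  by apply: cvgM; [exact: cvg_cst|exact: exprn_continuous].
have W_cont x : 0 < x < 1 -> {for x, continuous (fun r => slope1 r ^+ 2 / 2)}.
  move=> x01; apply: cvgM; last exact: cvg_cst.
  by apply: continuous_sqr; exact: slope1_continuous.
have EW r : 0 < r -> E r = slope1 r ^+ 2 / 2 + mass h r.
  by move=> r0; rewrite /E /slope1; congr (_ + _); field; rewrite gt_eqF.
have slope1_sq r : 0 <= r <= 1 -> `|slope1 r ^+ 2 / 2| <= C ^+ 2.
  move=> r01; rewrite ger0_norm ?divr_ge0 ?sqr_ge0//.
  have sC := slope1_bounded.2 _ r01.
  have : slope1 r ^+ 2 <= C ^+ 2.
    by rewrite -real_normK ?num_real// ler_pXn2r ?nnegrE ?bound_ge0.
  by have := sqr_ge0 (slope1 r); lra.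
have mass_le r : 0 <= r <= 1 -> `|mass h r| <= mass h 1.
  by move=> /andP[r0 r1]; rewrite ger0_norm ?mass_ge0// mass_mono.
pose L r := (slope2 r + slope1 r / r) * (derive1n 2 phi r + derive1 phi r / r) * r.
have LE r : 0 < r -> L r = - (k r * (p2 r * r + p1 r)).
  move=> r0; have [D1 D2] := dphiE _ r0; rewrite /L D1 D2 /slope2 /slope1.
  by field; rewrite gt_eqF.
have L0 : L 0 = 0 by rewrite /L mulr0.
have L_cont x : 0 < x < 1 -> {for x, continuous L}.
  move=> /[dup] x01 /andP[x0 _].
  apply: (@near_eq_continuous _ (fun r => - (k r * (p2 r * r + p1 r)))).
    by near=> r; rewrite LE//; near: r; exact: lt_nbhsr.
  apply: cvgN; apply: cvgM; first exact: profile_continuous.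
  by apply: cvgD; [apply: cvgM; [exact: cp2|exact: cvg_id]|exact: cp1].
have L_int : mu.-integrable `[0, 1] (EFin \o L).
  apply: (@bounded_integrable _ _ _ (C * (M2 + M2))); first exact: meas.
  move=> r /andP[]; rewrite le_eqVlt => /predU1P[<-|r0] r1.
    by rewrite L0 normr0 mulr_ge0 ?addr_ge0 ?bound_ge0.
  have r01 : 0 < r <= 1 by rewrite r0.
  have r01' : 0 <= r <= 1 by rewrite r1 ltW.
  rewrite LE// normrN normrM.
  apply: (@le_trans _ _ (`|k r| * ((M2 + M2) * r))).
    rewrite ler_wpM2l// (le_trans (ler_normD _ _))// mulrDl lerD ?p1le//.
    by rewrite normrM (ger0_norm (ltW r0)) ler_wpM2r ?(ltW r0)// p2M.
  have -> : `|k r| * ((M2 + M2) * r) = `|k r| * r * (M2 + M2) by ring.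
  rewrite ler_wpM2r ?addr_ge0//.
  by have := profileMid_bounded.2 _ r01'; rewrite normrM (ger0_norm (ltW r0)).
have Ep_int : mu.-integrable `[0, 1] (EFin \o (fun r => E r * p1 r)).
  apply: (@bounded_integrable _ _ _ ((C ^+ 2 + mass h 1) * M1)).
    by apply: meas => x x01; apply: cvgM; [exact: E_cont|exact: cp1].
  move=> r /[dup] r01 /andP[]; rewrite le_eqVlt => /predU1P[<-|r0] r1.
    by rewrite p10 mulr0 normr0 mulr_ge0// addr_ge0 ?sqr_ge0 ?mass_ge0.
  rewrite normrM ler_pM// ?p1M// EW// (le_trans (ler_normD _ _))//.
  by rewrite lerD ?slope1_sq ?mass_le.
have Wp_int : mu.-integrable `[0, 1] (EFin \o (fun r => slope1 r ^+ 2 / 2 * p1 r)).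
  apply: (@bounded_integrable _ _ _ (C ^+ 2 * M1)).
    by apply: meas => x x01; apply: cvgM; [exact: W_cont|exact: cp1].
  by move=> r r01; rewrite normrM ler_pM// ?p1M// slope1_sq.
have Fp_int : mu.-integrable `[0, 1] (EFin \o (fun r => mass h r * p1 r)).
  apply: (@bounded_integrable _ _ _ (mass h 1 * M1)).
    by apply: meas => x x01; apply: cvgM; [exact: mass_continuous|exact: cp1].
  by move=> r r01; rewrite normrM ler_pM// ?p1M// mass_le.
have W'p_int : mu.-integrable `[0, 1] (EFin \o (fun r => slope1 r * slope2 r * p0 r)).
  apply: (@bounded_integrable _ _ _ (C ^+ 2 * M0)).
    apply: meas => x x01; apply: cvgM; last exact: cp0.
    by apply: cvgM; [exact: slope1_continuous|exact: slope2_continuous].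
  by move=> r r01; rewrite normrM ler_pM// ?p0M// slope_prod_le.
(* The factor [(phi'' + phi'/r) * r] is the derivative of [r phi'], so [- k r phi'] is the
   primitive. At [0], [k r] is bounded and [phi'] vanishes; near [1] the test function is zero. *)
have step1 : \int[mu]_(r in `[0, 1]) L r = - \int[mu]_(r in `[0, 1]) (E r * p1 r).
  apply/eqP; rewrite -addr_eq0 -RintegralD//; apply/eqP.
  rewrite -[RHS](subrr 0).
  apply: (@improper_FTC _ 0 1 _ (fun r => - (k r * r * p1 r))) => //.
  - exact: integrable_addr.
  - move=> x x01; apply: cvgD; first exact: L_cont.
    by apply: cvgM; [exact: E_cont|exact: cp1].
  - move=> x /[dup] x01 /andP[x0 _].
    have dkx := is_derive_prod (is_derive_profile x01) (is_derive_id x 1).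
    have d := is_deriveN (is_derive_prod dkx (dp x).2).
    apply: (@is_derive_eq _ _ _ _ _ _ _ _ d).
    by rewrite LE// /flux /E; field; rewrite gt_eqF.
  - apply: (@cvg_squeeze0 _ (C * M2)) => r /[dup] r01 /andP[r0 r1].
    have r01' : 0 <= r <= 1 by rewrite !ltW.
    rewrite normrN normrM -mulrA.
    apply: ler_pM => //; first exact: profileMid_bounded.2.
    rewrite (le_trans (p1le _ r01'))// ler_wpM2l//.
    have q0 := root4_gt0 r0; have q1 := root4_le1 (ltW r1).
    by rewrite -{1}(root4X (ltW r0)) exprS ler_piMr ?(ltW q0)// exprn_ile1// ltW.
  - by apply: near1 => r rr; rewrite (psupp _ rr).2 mulr0 oppr0.
(* [u' u''] is the derivative of [u'^2 / 2], which tends to [0] at the origin. *)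
have step2 : \int[mu]_(r in `[0, 1]) (slope1 r * slope2 r * p0 r) =
    - \int[mu]_(r in `[0, 1]) (slope1 r ^+ 2 / 2 * p1 r).
  apply/eqP; rewrite -addr_eq0 -RintegralD//; apply/eqP.
  rewrite -[RHS](subrr 0).
  apply: (@improper_FTC _ 0 1 _ (fun r => slope1 r ^+ 2 / 2 * p0 r)) => //.
  - exact: integrable_addr.
  - move=> x x01; apply: cvgD; last by apply: cvgM; [exact: W_cont|exact: cp1].
    apply: cvgM; last exact: cp0.
    by apply: cvgM; [exact: slope1_continuous|exact: slope2_continuous].
  - move=> x /[dup] x01 /andP[x0 _].
    have d1 := is_derive_slope1 x01.
    have d2 := is_derive_prod (is_derive_prod d1 d1) (is_derive_cst (2^-1 : R) x 1).
    have d := is_derive_prod d2 (dp x).1.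
    apply: (@is_derive_eq _ _ _ _ _ _ _ _ d).
    by rewrite /cst expr2 /=; field.
  - apply: (@cvg_squeeze0 _ (C ^+ 2 * M0)) => r /[dup] r01 /andP[r0 r1].
    have r01' : 0 < r <= 1 by rewrite r0 ltW.
    have r01'' : 0 <= r <= 1 by rewrite !ltW.
    rewrite normrM (mulrAC (C ^+ 2)); apply: ler_pM; rewrite ?p0M//.
    have q0 := root4_gt0 r0; have q1 := root4_le1 (ltW r1).
    rewrite normrM normrX (@ger0_norm _ 2^-1)//.
    have s1 : `|slope1 r| <= C * root4 r.
      by rewrite (le_trans (slope1_le r01'))// ler_wpM2l ?bound_ge0// div_root4_le.
    have : `|slope1 r| ^+ 2 <= (C * root4 r) ^+ 2.
      by rewrite ler_pXn2r ?nnegrE ?mulr_ge0 ?bound_ge0 ?(ltW q0).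
    have : (C * root4 r) ^+ 2 <= C ^+ 2 * root4 r.
      by rewrite exprMn ler_wpM2l ?sqr_ge0// expr2 ler_piMr// ltW.
    have : 0 <= C ^+ 2 * root4 r by rewrite mulr_ge0 ?sqr_ge0// ltW.
    lra.
  - by apply: near1 => r rr; rewrite (psupp _ rr).1 mulr0.
(* [h] is only integrable, so Fubini replaces differentiation of [mass h]. *)
have step3 : \int[mu]_(r in `[0, 1]) (h r * p0 r) =
    - \int[mu]_(r in `[0, 1]) (mass h r * p1 r).
  rewrite Rintegral_primitive_swap//; last first.
    apply: (@bounded_integrable _ _ _ M1); last exact: p1M.
    by apply: meas => x _; exact: cp1.
  have p1_int t : mu.-integrable `[t, 1] (EFin \o p1).
    apply: continuous_compact_integrable; first exact: segment_compact.
    by have cp1' : continuous p1 by []; exact: continuous_subspaceT.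
  have p01 : p0 1 = 0 by exact: (psupp _ rho1).1.
  have pE t : 0 <= t <= 1 -> \int[mu]_(r in `[t, 1]) p1 r = - p0 t.
    move=> /andP[t0]; rewrite le_eqVlt => /predU1P[->|t1].
      by rewrite Rintegral_nil p01 oppr0.
    rewrite -[RHS]add0r -p01.
    apply: (@improper_FTC _ t 1 _ p0) => //.
    - by move=> x _; exact: (dp x).1.
    - by apply: cvg_at_right_filter; exact: cp0.
    - by apply: cvg_at_left_filter; exact: cp0.
  have mI : measurable (`[0, 1] : set R) by exact: measurable_itv.
  have hp_int : mu.-integrable `[0, 1] (EFin \o (fun r => h r * p0 r)).
    have mp0 : measurable_fun (`[0, 1] : set R) p0 by apply: meas => x _; exact: cp0.
    have bp0 : [bounded p0 x | x in (`[0, 1] : set R)].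
      exists M0; split; first exact: num_real.
      move=> N MN x /=; rewrite in_itv/= => /p0M /le_trans; apply; exact: ltW.
    have := @integrableMl _ _ R mu _ mI _ _ h_int mp0 bp0.
    by apply: eq_integrable => // t _; rewrite /= EFinM.
  apply/eqP; rewrite -addr_eq0 -RintegralD//.
  - rewrite (@eq_Rintegral_itv _ _ _ _ (cst 0)) ?Rintegral_cstE ?mul0r//.
    by move=> t t01; rewrite pE//=; ring.
  - have := integrable_scaler (-1) mI hp_int; apply: eq_integrable => // t.
    by rewrite inE/= in_itv/= => t01; rewrite pE//; congr (_%:E); ring.
rewrite -/(Rintegral _ _ L) step1.
have -> : \int[mu]_(r in `[0, 1]) (E r * p1 r) =
    \int[mu]_(r in `[0, 1]) (slope1 r ^+ 2 / 2 * p1 r) +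
    \int[mu]_(r in `[0, 1]) (mass h r * p1 r).
  rewrite -RintegralD//; apply: eq_Rintegral_itv => r /andP[].
  rewrite le_eqVlt => /predU1P[<-|r0] _; first by rewrite p10 !mulr0 addr0.
  by rewrite EW// mulrDl.
rewrite opprD -step2 -step3; congr (_ + _); apply: eq_Rintegral_itv => r /andP[r0 _];
  by rewrite phiE.
Unshelve. all: by end_near. Qed.

End solution.

(** * A flat function *)

Section smooth_functions.
Context {R : realType}.
Implicit Types (x y s t : R) (f g : R -> R).

(** The negative powers of [x] are included so that derivatives remain linear combinations of
    members of the family. *)
Definition flat (n : nat) x : R := if 0 < x then x^-1 ^+ n * expR (- x^-1) else 0.

Lemma flat_le0 n x : x <= 0 -> flat n x = 0.
Proof. by move=> x0; rewrite /flat ltNge x0. Qed.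

Lemma flat_gt0 n x : 0 < x -> 0 < flat n x.
Proof. by move=> x0; rewrite /flat x0 mulr_gt0 ?expR_gt0// exprn_gt0// invr_gt0. Qed.

Lemma flat_ge0 n x : 0 <= flat n x.
Proof. by have [/flat_le0->//|/(flat_gt0 n)/ltW] := leP x 0. Qed.

(** Keep the term of order [n + 1] in the exponential series at [x^-1]. *)
Lemma flat_le_linear n x : 0 <= x -> flat n x <= (n.+1)`!%:R * x.
Proof.
rewrite le_eqVlt => /predU1P[<-|x0]; first by rewrite flat_le0// mulr0.
rewrite /flat x0 expRN ler_pdivrMr ?expR_gt0//.
have v0 : 0 <= x^-1 by rewrite invr_ge0 ltW.
have f0 : 0 < (n.+1)`!%:R :> R by rewrite ltr0n fact_gt0.
have h1 : x^-1 ^+ n.+1 / (n.+1)`!%:R <= expR x^-1.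
  by have := expR_ge1Dxn n v0; lra.
move: h1; rewrite ler_pdivrMr// => /(ler_wpM2r (ltW x0)).
rewrite exprSr mulfVK ?gt_eqF// => /le_trans; apply.
by apply: eq_le_refl; ring.
Qed.

Lemma flat_divE n x : x != 0 -> x^-1 * flat n x = flat n.+1 x.
Proof.
move=> x0; have [xn|xp] := leP x 0; first by rewrite !flat_le0// mulr0.
by rewrite /flat xp exprS mulrA.
Qed.

Lemma is_derive_pow n f x (d : R) : is_derive x 1 f d ->
  is_derive x 1 (fun z => f z ^+ n) (n%:R * f x ^+ n.-1 * d).
Proof.
move=> df; have -> : (fun z => f z ^+ n) = f ^+ n.
  by apply/funext => z; rewrite fctE.
exact: is_deriveX.
Qed.

Lemma is_derive_flat n x : is_derive x 1 (flat n) (flat n.+2 x - n%:R * flat n.+1 x).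
Proof.
have [x0|x0|->] := ltgtP x 0.
- rewrite !flat_le0 ?(ltW x0)// mulr0 subrr.
  apply: (@is_derive_near _ (cst 0)).
  by near=> z; rewrite flat_le0//; apply/ltW; near: z; exact: lt_nbhsl.
- apply: (@is_derive_near _ (fun z => z^-1 ^+ n * expR (- z^-1))).
    by near=> z; rewrite /flat ifT//; near: z; exact: lt_nbhsr.
  have d1 := is_derive_inv x0.
  have d2 := is_derive_pow n d1.
  have d3 : is_derive x 1 (fun z => expR (- z^-1)) (expR (- x^-1) * x ^- 2).
    have d := @is_derive1_comp R expR (fun z => - z^-1) x _ _ (is_derive_expR _) (is_deriveN d1).
    by apply: (@is_derive_eq _ _ _ _ _ _ _ _ d); rewrite opprK.
  apply: (@is_derive_eq _ _ _ _ _ _ _ _ (is_derive_prod d2 d3)).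
  rewrite /flat x0 (exprS _ n.+1) (exprS _ n).
  have -> : n%:R * x^-1 ^+ n.-1 * - x ^- 2 = - (n%:R * (x^-1 * x^-1 ^+ n)).
    case: n {d2} => [|n]; first by rewrite !mul0r oppr0.
    rewrite /= (exprS x^-1); move: (n.+1%:R : R) (x^-1 ^+ n) => a b.
    by rewrite -exprVn; ring.
  by rewrite -exprVn; ring.
- rewrite !flat_le0// mulr0 subrr.
  (* The difference quotient of [flat n] at [0] is [flat n.+1], which tends to zero by the linear
     bound. *)
  have lim : (fun h => flat n.+1 h) @ (0 : R)^' --> (0 : R).
    pose M : R := (n.+2)`!%:R.
    have M0 : 0 <= M by rewrite ler0n.
    apply/cvgrPdist_le => e e0; near=> h; rewrite sub0r normrN ger0_norm ?flat_ge0//.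
    have [/flat_le0->|h0] := leP h 0; first exact: ltW.
    rewrite (le_trans (flat_le_linear _ (ltW h0)))// -/M.
    have : `|h| <= e / (M + 1).
      by near: h; apply: dnbhs0_le; rewrite divr_gt0// ltr_wpDl.
    rewrite gtr0_norm// ler_pdivlMr ?ltr_wpDl// => he.
    by rewrite mulrC (le_trans _ he)// ler_wpM2l ?(ltW h0)// lerDl.
  have E : (fun h => h^-1 *: ((flat n \o shift 0) (h *: (1 : R)) - flat n 0)) @ (0 : R)^'
      --> (0 : R).
    apply: cvg_trans lim; apply: near_eq_cvg; near=> h.
    rewrite /= addr0 (flat_le0 _ (lexx 0)) subr0.
    have -> : h *: (1 : R) = h by exact: mulr1.
    rewrite /GRing.scale/= flat_divE//.
    by near: h; exact: nbhs_dnbhs_neq.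
  apply: DeriveDef; first by apply/cvg_ex; exists 0.
  by apply: (cvg_lim (@Rhausdorff R)).
Unshelve. all: by end_near. Qed.

End smooth_functions.

(** * Elementary smooth functions *)

Section smooth_algebra.
Context {R : realType}.
Implicit Types (x y s t : R) (f g : R -> R).

(** [smooth] asks for iterated derivatives of every order. A class containing a derivative of each
    of its members gives them by induction, without formulas; [elementary_primitive] admits
    integrals of members. *)
Inductive elementary : (R -> R) -> Prop :=
| elementary_cst c : elementary (fun=> c)
| elementary_flat n : elementary (flat n)
| elementary_add f g : elementary f -> elementary g -> elementary (fun x => f x + g x)
| elementary_mul f g : elementary f -> elementary g -> elementary (fun x => f x * g x)
| elementary_inv f : (forall x, f x != 0) -> elementary f -> elementary (fun x => (f x)^-1)
| elementary_affine f a b : elementary f -> elementary (fun x => f (a * x + b))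
| elementary_primitive f g : (forall x : R, is_derive x 1 f (g x)) ->
    elementary g -> elementary f.

Lemma is_derive_affine a b x : is_derive x 1 (fun z => a * z + b) a.
Proof.
have d1 := is_derive_prod (is_derive_cst (a : R) x 1) (is_derive_id x 1).
apply: (@is_derive_eq _ _ _ _ _ _ _ _ (is_deriveD d1 (is_derive_cst (b : R) x 1))).
by rewrite mul0r add0r mulr1 addr0.
Qed.

Lemma elementary_derive f : elementary f ->
  exists2 g, elementary g & forall x : R, is_derive x 1 f (g x).
Proof.
elim=> {f} [c|n|f g _ [f' ef' df] _ [g' eg' dg]|f g ef [f' ef' df] eg [g' eg' dg]
           |f f0 ef [f' ef' df]|f a b _ [f' ef' df]|f g df eg _].
- by exists (fun=> 0); [exact: elementary_cst|move=> x; exact: is_derive_cst].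
- exists (fun x => flat n.+2 x + (- n%:R) * flat n.+1 x).
    apply: elementary_add; first exact: elementary_flat.
    by apply: elementary_mul; [exact: elementary_cst|exact: elementary_flat].
  by move=> x; rewrite mulNr; exact: is_derive_flat.
- exists (fun x => f' x + g' x); first exact: elementary_add.
  by move=> x; exact: is_deriveD.
- exists (fun x => f' x * g x + f x * g' x).
    by apply: elementary_add; exact: elementary_mul.
  by move=> x; exact: is_derive_prod.
- exists (fun x => (- 1) * (((f x)^-1 * (f x)^-1) * f' x)).
    apply: elementary_mul; first exact: elementary_cst.
    apply: elementary_mul => //.
    by apply: elementary_mul; exact: elementary_inv.
  move=> x; apply: (@is_derive_eq _ _ _ _ _ _ _ _ (is_deriveV (f0 x) (df x))).
  rewrite /GRing.scale/= -exprVn; ring.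
- exists (fun x => a * f' (a * x + b)).
    by apply: elementary_mul; [exact: elementary_cst|exact: elementary_affine].
  move=> x; have d := @is_derive1_comp R f _ x _ _ (df _) (is_derive_affine a b x).
  by apply: (@is_derive_eq _ _ _ _ _ _ _ _ d); exact: mulrC.
- by exists g.
Qed.

Lemma elementary_continuous f : elementary f -> continuous f.
Proof.
by move=> /elementary_derive[g _ df] x; exact: is_derive_continuous (df x).
Qed.

Lemma elementary_sum (I : Type) (r : seq I) (F : I -> R -> R) :
  (forall i, elementary (F i)) -> elementary (fun x => \sum_(i <- r) F i x).
Proof.
move=> eF; elim: r => [|i r IH].
  rewrite (_ : (fun _ => _) = fun=> 0); first exact: elementary_cst.
  by apply/funext => x; rewrite big_nil.
rewrite (_ : (fun _ => _) = fun x => F i x + \sum_(j <- r) F j x).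
  exact: elementary_add.
by apply/funext => x; rewrite big_cons.
Qed.

(** The counterpart on the plane. Radial functions enter through the squared norm, a polynomial, so
    the origin is not exceptional. *)
Inductive elementary2 : (R * R -> R) -> Prop :=
| elementary2_cst c : elementary2 (fun=> c)
| elementary2_fst : elementary2 fst
| elementary2_snd : elementary2 snd
| elementary2_add F G : elementary2 F -> elementary2 G -> elementary2 (fun x : R * R => F x + G x)
| elementary2_mul F G : elementary2 F -> elementary2 G -> elementary2 (fun x : R * R => F x * G x)
| elementary2_radial f : elementary f -> elementary2 (fun x : R * R => f (x.1 ^+ 2 + x.2 ^+ 2)).

Lemma is_derive_line (F : R * R -> R) (x v : R * R) d :
  is_derive (0 : R) 1 (fun t : R => F (t *: v + x)) d -> is_derive x v F d.
Proof.
pose L (t : R) := F (t *: v + x).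
have E : (fun h : R => h^-1 *: ((L \o shift 0) (h *: (1 : R)) - L 0)) =
         (fun h : R => h^-1 *: ((F \o shift x) (h *: v) - F x)).
  apply/funext => h; rewrite /L /= scale0r add0r addr0.
  by have -> : h *: (1 : R) = h by exact: mulr1.
move=> [d1 d2]; apply: DeriveDef.
  by move: d1; rewrite /derivable -E.
by move: d2; rewrite /derive -E.
Qed.

Lemma elementary2_continuous F : elementary2 F -> continuous F.
Proof.
elim=> {F} [c|||F G _ cF _ cG|F G _ cF _ cG|f /elementary_continuous cf] x.
- exact: cvg_cst.
- exact: cvg_fst.
- exact: cvg_snd.
- by apply: cvgD; [exact: cF|exact: cG].
- by apply: cvgM; [exact: cF|exact: cG].
- apply: (@continuous_comp _ _ _ (fun x : R * R => x.1 ^+ 2 + x.2 ^+ 2) f); last exact: cf.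
  apply: cvgD.
    by apply: (@continuous_comp _ _ _ fst (fun z : R => z ^+ 2));
      [exact: cvg_fst|exact: exprn_continuous].
  by apply: (@continuous_comp _ _ _ snd (fun z : R => z ^+ 2));
    [exact: cvg_snd|exact: exprn_continuous].
Qed.

Lemma elementary2_derive F (v : R * R) : elementary2 F ->
  exists2 G, elementary2 G & forall x : R * R, is_derive x v F (G x).
Proof.
elim=> {F} [c|||F G _ [F' eF dF] _ [G' eG dG]|F G eF [F' eF' dF] eG [G' eG' dG]
           |f /[dup] ef /elementary_derive[f' ef' df]].
- by exists (fun=> 0); [exact: elementary2_cst|move=> x; exact: is_derive_cst].
- exists (fun=> v.1); first exact: elementary2_cst.
  move=> x; apply: is_derive_line.
  have := is_derive_affine v.1 x.1 0.
  by congr is_derive; apply/funext => t; rewrite mulrC.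
- exists (fun=> v.2); first exact: elementary2_cst.
  move=> x; apply: is_derive_line.
  have := is_derive_affine v.2 x.2 0.
  by congr is_derive; apply/funext => t; rewrite mulrC.
- exists (fun x : R * R => F' x + G' x); first exact: elementary2_add.
  by move=> x; exact: is_deriveD.
- exists (fun x : R * R => F x * G' x + G x * F' x).
    by apply: elementary2_add; exact: elementary2_mul.
  by move=> x; exact: is_deriveM.
- exists (fun x : R * R => f' (x.1 ^+ 2 + x.2 ^+ 2) * (2 * v.1 * x.1 + 2 * v.2 * x.2)).
    apply: elementary2_mul; first exact: elementary2_radial.
    by apply: elementary2_add; (apply: elementary2_mul; first exact: elementary2_cst);
      [exact: elementary2_fst|exact: elementary2_snd].
  move=> x; apply: is_derive_line.
  have dq (a b : R) : is_derive (0 : R) 1 (fun t => (t * a + b) ^+ 2) (2 * a * b).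
    have d0 : is_derive (0 : R) 1 (fun t => t * a + b) a.
      rewrite (_ : (fun _ => _) = (fun t => a * t + b)); first exact: is_derive_affine.
      by apply/funext => t; rewrite mulrC.
    apply: (@is_derive_eq _ _ _ _ _ _ _ _ (is_derive_pow 2 d0)).
    by rewrite mul0r add0r expr1; ring.
  have d1 := is_deriveD (dq v.1 x.1) (dq v.2 x.2).
  pose N (t : R) := (t * v.1 + x.1) ^+ 2 + (t * v.2 + x.2) ^+ 2.
  have d := @is_derive1_comp R f N 0 _ _ (df _) d1.
  apply: (@is_derive_eq _ _ _ _ _ _ _ _ d).
  by rewrite /N !mul0r !add0r.
Qed.

Lemma elementary2_smooth F : elementary2 F -> smooth F.
Proof.
move=> eF k; elim: k F eF => [|k IH] F eF /=.
  by split => //; exact: elementary2_continuous.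
split; first exact: elementary2_continuous.
move=> v; have [G eG dF] := elementary2_derive v eF.
split; first by move=> x; have [] := dF x.
have -> : 'D_v F = G by apply/funext => x; have [] := dF x.
exact: IH.
Qed.

Lemma flat_mono x y : 0 < x -> x <= y -> flat 0 x <= flat 0 y.
Proof.
move=> x0 xy; have y0 := lt_le_trans x0 xy.
by rewrite /flat x0 y0 !mul1r ler_expR lerN2 lef_pV2.
Qed.

Definition smooth_step x := flat 0 x / (flat 0 x + flat 0 (1 - x)).

Lemma smooth_step_den x : 0 < flat 0 x + flat 0 (1 - x).
Proof.
have [x0|x0] := leP x 0.
  by rewrite ltr_wpDl ?flat_ge0// flat_gt0//; lra.
by rewrite ltr_pwDl ?flat_ge0// flat_gt0.
Qed.

Lemma smooth_step_le0 x : x <= 0 -> smooth_step x = 0.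
Proof. by move=> x0; rewrite /smooth_step flat_le0// mul0r. Qed.

Lemma smooth_step_ge1 x : 1 <= x -> smooth_step x = 1.
Proof.
move=> x1; rewrite /smooth_step (@flat_le0 _ _ (1 - x)); last by lra.
by rewrite addr0 divff// gt_eqF// flat_gt0//; lra.
Qed.

Lemma smooth_step_mono x y : x <= y -> smooth_step x <= smooth_step y.
Proof.
have mono (a b : R) : a <= b -> flat 0 a <= flat 0 b.
  move=> ab; have [a0|a0] := leP a 0; first by rewrite flat_le0// flat_ge0.
  exact: flat_mono.
move=> xy; rewrite /smooth_step ler_pdivrMr ?smooth_step_den//.
rewrite mulrAC ler_pdivlMr ?smooth_step_den// !mulrDr mulrC lerD2l.
rewrite ler_pM ?flat_ge0// mono//; lra.
Qed.

Lemma smooth_step_elementary : elementary smooth_step.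
Proof.
have E : elementary (fun x => flat 0 x + flat 0 (1 - x)).
  apply: elementary_add; first exact: elementary_flat.
  rewrite (_ : (fun _ => _) = (fun x => flat 0 (-1 * x + 1))).
    exact: elementary_affine (elementary_flat 0).
  by apply/funext => x; congr flat; ring.
apply: elementary_mul; first exact: elementary_flat.
by apply: elementary_inv => // x; rewrite gt_eqF// smooth_step_den.
Qed.

End smooth_algebra.

(** * Density of radial test functions *)

Section density.
Context {R : realType}.
Local Notation mu := (@lebesgue_measure R).
Variables (w : R -> R) (C : R).
Hypothesis w_cont : forall x, 0 < x < 1 -> {for x, continuous w}.
Hypothesis w_bd : bounded_by C w.
Implicit Types (r s x : R) (n i : nat).

(* [u r = U (r ^ 2)] with [u' = w] gives [U' s = w (sqrt s) / (2 sqrt s)]; this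
   function of [s] is approximated by a smooth partition of unity. *)
Definition sq_slope s := w (Num.sqrt s) / (2 * Num.sqrt s).
Definition step n i s := smooth_step (n%:R * s + - i%:R).
Definition bump n i s := step n i s - step n i.+1 s.
(** The bump of index [i] lives on [[i/n, (i+2)/n]]. The range of [i], up to [n - 3], keeps all
    supports in [[1/n, 1 - 1/n]], away from the singularity at [0] and from the boundary, while the
    bumps still sum to [1] on [[2/n, 1 - 2/n]]. *)
Definition approx n s := \sum_(1 <= i < n.-2) sq_slope (i%:R / n%:R) * bump n i s.

Lemma slope_bound_ge0 : 0 <= C.
Proof. by apply: le_trans (w_bd.2 0 _); rewrite ?lexx ?ler01. Qed.

Lemma approx_elementary n : elementary (approx n).
Proof.
have step_el i : elementary (step n i).
  exact: elementary_affine smooth_step_elementary.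
apply: elementary_sum => i; apply: elementary_mul; first exact: elementary_cst.
rewrite (_ : bump n i = fun s => step n i s + (-1) * step n i.+1 s).
  apply: elementary_add => //; apply: elementary_mul => //.
  exact: elementary_cst.
by apply/funext => s; rewrite /bump mulN1r.
Qed.

Lemma bump_ge0 n i s : 0 <= bump n i s.
Proof. by rewrite subr_ge0 smooth_step_mono// lerD2l lerN2 ler_nat. Qed.

Lemma bump_support n i s : bump n i s != 0 -> i%:R < n%:R * s < i.+2%:R.
Proof.
apply: contraNT; rewrite negb_and -!leNgt => /orP[h|h].
  have h1 : i%:R <= i.+1%:R :> R by rewrite ler_nat.
  by rewrite /bump /step !smooth_step_le0 ?subrr//; lra.
have h1 : i.+2%:R = i%:R + 2 :> R by rewrite -addn2 natrD.
have h2 : i.+1%:R = i%:R + 1 :> R by rewrite -addn1 natrD.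
by rewrite /bump /step !smooth_step_ge1 ?subrr//; rewrite ?h2 ?h1 in h *; lra.
Qed.

Lemma sum_bump n s : \sum_(1 <= i < n.+3.-2) bump n.+3 i s = step n.+3 1 s - step n.+3 n.+1 s.
Proof.
rewrite -opprB -(@telescope_sumr _ 1 n.+1 (step n.+3 ^~ s))// -sumrN.
by apply: eq_bigr => i _; rewrite opprB.
Qed.

Lemma smooth_step_01 x : 0 <= smooth_step x <= 1.
Proof.
rewrite divr_ge0 ?flat_ge0 ?(ltW (smooth_step_den _))//=.
by rewrite ler_pdivrMr ?smooth_step_den// mul1r lerDl flat_ge0.
Qed.

Lemma sum_bump_le1 n s : \sum_(1 <= i < n.-2) bump n i s <= 1.
Proof.
case: n => [|[|[|n]]]; [by rewrite big_geq..|].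
rewrite sum_bump; have /andP[_ h1] := smooth_step_01 (n.+3%:R * s + - 1%:R).
have /andP[h2 _] := smooth_step_01 (n.+3%:R * s + - n.+1%:R).
by rewrite /step; lra.
Qed.

Lemma approx_support n s : s <= n%:R^-1 \/ 1 - n%:R^-1 <= s -> (0 < n)%N -> approx n s = 0.
Proof.
move=> hs n0; rewrite /approx big_nat_cond big1// => i; rewrite andbT => /andP[i1 iN].
have n0' : 0 < n%:R :> R by rewrite ltr0n.
suff -> : bump n i s = 0 by rewrite mulr0.
apply: contrapT => /eqP/bump_support/andP[b1 b2].
case: hs => hs.
  have : n%:R * s <= 1 by rewrite mulrC -ler_pdivlMr// div1r.
  have : 1 <= i%:R :> R by rewrite ler1n.
  lra.
have : n%:R - 1 <= n%:R * s.
  have := ler_wpM2l (ltW n0') hs; rewrite mulrBr mulr1 divff//.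
  by rewrite gt_eqF.
have : i.+3%:R <= n%:R :> R by rewrite ler_nat; lia.
have -> : i.+3%:R = i.+2%:R + 1 :> R by rewrite -addn1 natrD.
lra.
Qed.

(** [sq_slope] is singular at [0], but where the bump of index [i] is nonzero,
    [r ^+ 2 < (i + 2) / n <= 4 * i / n]. So [r] is at most twice the sampling point [sqrt (i/n)],
    and the factor [r] cancels the singularity uniformly in [n]. *)
Lemma approx_bound n r : 0 <= r -> `|2 * r * approx n (r ^+ 2)| <= 2 * C.
Proof.
move=> r0; have C2 : 0 <= 2 * C by rewrite mulr_ge0 ?slope_bound_ge0.
rewrite /approx mulr_sumr (le_trans (ler_norm_sum _ _ _))//.
apply: (@le_trans _ _ (\sum_(1 <= i < n.-2) 2 * C * bump n i (r ^+ 2))); last first.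
  by rewrite -mulr_sumr ler_piMr// sum_bump_le1.
rewrite big_nat_cond [leRHS]big_nat_cond.
apply: ler_sum => i; rewrite andbT => /andP[i1 iN].
have n0 : 0 < n%:R :> R by rewrite ltr0n; lia.
have [->|/bump_support/andP[b1 b2]] := eqVneq (bump n i (r ^+ 2)) 0.
  by rewrite !mulr0 normr0.
rewrite mulrA normrM (ger0_norm (bump_ge0 _ _ _)) ler_wpM2r ?bump_ge0//.
pose q : R := Num.sqrt (i%:R / n%:R).
have i0 : 0 < i%:R :> R by rewrite ltr0n.
have in0 : 0 < i%:R / n%:R :> R by rewrite divr_gt0.
have q0 : 0 < q by rewrite sqrtr_gt0.
have q2 : q ^+ 2 = i%:R / n%:R by rewrite sqr_sqrtr// ltW.
have q1 : q <= 1.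
  rewrite -sqrtr1 ler_wsqrtr// ler_pdivrMr// mul1r ler_nat; lia.
have rq : r <= 2 * q.
  rewrite -(@ler_pXn2r _ 2)// ?nnegrE ?mulr_ge0 ?(ltW q0)// exprMn q2.
  rewrite mulrA ler_pdivlMr// mulrC.
  have h1 : i.+2%:R = i%:R + 2 :> R by rewrite -addn2 natrD.
  have : 1 <= i%:R :> R by rewrite ler1n.
  by move: b2; rewrite h1; lra.
have wq : `|w q| <= C by apply: w_bd.2; rewrite q1 ltW.
rewrite /sq_slope -/q normrM (@ger0_norm _ (2 * r)) ?mulr_ge0//.
rewrite normrM normfV (@ger0_norm _ (2 * q)) ?mulr_ge0 ?(ltW q0)//.
have -> : 2 * r * (`|w q| / (2 * q)) = (r / q) * `|w q| by field; rewrite gt_eqF.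
by apply: ler_pM => //; [rewrite divr_ge0// ltW|rewrite ler_pdivrMr].
Qed.

Lemma sq_slope_continuous s : 0 < s < 1 -> {for s, continuous sq_slope}.
Proof.
move=> /andP[s0 s1].
have cs : {for s, continuous (@Num.sqrt R)} by exact: sqrt_continuous.
have q0 : 0 < Num.sqrt s by rewrite sqrtr_gt0.
have q1 : Num.sqrt s < 1 by rewrite -sqrtr1 ltr_sqrt.
apply: cvgM.
  by apply: (@continuous_comp _ _ _ Num.sqrt w) => //; apply: w_cont; rewrite q0.
apply: cvgV; first by rewrite gt_eqF// mulr_gt0.
by apply: cvgM; [exact: cvg_cst|exact: cs].
Qed.

Lemma approx_cvg r : 0 < r < 1 ->
  (fun n => 2 * r * approx n (r ^+ 2)) @ \oo --> w r.
Proof.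
move=> /andP[r0 r1]; pose s := r ^+ 2.
have s0 : 0 < s by rewrite exprn_gt0.
have s1 : s < 1 by rewrite expr_lt1// ltW.
have wE : w r = 2 * r * sq_slope s.
  rewrite /sq_slope sqrtr_sqr gtr0_norm//; field; by rewrite gt_eqF.
apply/cvgrPdist_le => e e0.
have e2 : 0 < e / 2 by rewrite divr_gt0.
have /cvgrPdist_le /(_ _ e2) : {for s, continuous sq_slope}.
  by apply: sq_slope_continuous; rewrite s0.
move=> /nbhs_ballP[d /= d0 hd].
(* For [n] beyond [A] the width [2/n] of a bump is below the modulus of continuity [d], and [s] lies
   where the bumps sum to [1]. *)
pose A := 2 / d + 2 / s + 2 / (1 - s).
near=> n.
have nA : A < n%:R by near: n; exact: nbhs_infty_gtr.
have [A1 A2 A3] : [/\ 0 < 2 / d, 0 < 2 / s & 0 < 2 / (1 - s)].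
  by rewrite !divr_gt0// subr_gt0.
have n0 : 0 < n%:R :> R by apply: lt_trans nA; rewrite !addr_gt0.
have nd : 2 / n%:R < d.
  rewrite ltr_pdivrMr// mulrC -ltr_pdivrMr//; apply: le_lt_trans nA.
  by rewrite /A; lra.
have ns : 2 < n%:R * s by rewrite -ltr_pdivrMr//; apply: le_lt_trans nA; rewrite /A; lra.
have ns1 : 2 < n%:R * (1 - s).
  by rewrite -ltr_pdivrMr ?subr_gt0//; apply: le_lt_trans nA; rewrite /A; lra.
have n3 : (3 <= n)%N.
  have : 2 < n%:R :> R.
    by apply: (lt_le_trans ns); rewrite ler_piMr// ltW.
  by rewrite ltr_nat.
have [m nE] : exists m, n = m.+3 by exists (n - 3)%N; rewrite -addn3 subnK.
have sum1 : \sum_(1 <= i < n.-2) bump n i s = 1.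
  rewrite nE sum_bump /step -nE.
  rewrite smooth_step_ge1; last by lra.
  rewrite smooth_step_le0 ?subr0//.
  have -> : m.+1%:R = n%:R - 2 :> R by rewrite nE -[m.+3]addn2 natrD addrK.
  by move: ns1; rewrite mulrBr mulr1; lra.
have -> : w r - 2 * r * approx n (r ^+ 2) = 2 * r * (\sum_(1 <= i < n.-2)
    (sq_slope s * bump n i s - sq_slope (i%:R / n%:R) * bump n i s)).
  by rewrite sumrB -mulr_sumr sum1 mulr1 mulrBr -wE.
rewrite normrM (@ger0_norm _ (2 * r)) ?mulr_ge0 ?(ltW r0)//.
have bnd : `|\sum_(1 <= i < n.-2) (sq_slope s * bump n i s -
     sq_slope (i%:R / n%:R) * bump n i s)| <= e / 2.
  rewrite (le_trans (ler_norm_sum _ _ _))//.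
  apply: (@le_trans _ _ (\sum_(1 <= i < n.-2) e / 2 * bump n i s)); last first.
    by rewrite -mulr_sumr sum1 mulr1.
  apply: ler_sum => i _; rewrite -mulrBl normrM (ger0_norm (bump_ge0 _ _ _)).
  have [->|/bump_support/andP[b1 b2]] := eqVneq (bump n i s) 0; first by rewrite !mulr0.
  rewrite ler_wpM2r ?bump_ge0//; apply: hd; rewrite /ball/=.
  apply: lt_trans nd; rewrite -(@ltr_pM2r _ n%:R)// divfK ?gt_eqF//.
  have -> : `|s - i%:R / n%:R| * n%:R = `|n%:R * s - i%:R|.
    rewrite -{2}(gtr0_norm n0) -normrM mulrBl divfK ?gt_eqF// (mulrC s)//.
  move: b2; have -> : i.+2%:R = i%:R + 2 :> R by rewrite -addn2 natrD.
  by move=> b2; rewrite ltr_norml; apply/andP; split; lra.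
have := ler_wpM2l (mulr_ge0 (ler0n R 2) (ltW r0)) bnd; move=> /le_trans; apply.
have : r * e <= e by rewrite ler_piMl// ltW.
lra.
Unshelve. all: by end_near. Qed.

(** Subtracting the total integral makes it vanish from [1 - 1/n] on, where [approx n] is zero. *)
Definition approx_primitive n s :=
  \int[mu]_(t in `[0, s]) approx n t - \int[mu]_(t in `[0, 1]) approx n t.

Lemma approx_continuous n : continuous (approx n).
Proof. exact: elementary_continuous (approx_elementary n). Qed.

Lemma approx_int n (a b : R) : mu.-integrable `[a, b] (EFin \o approx n).
Proof.
apply: continuous_compact_integrable; first exact: segment_compact.
by have h := @approx_continuous n; exact: continuous_subspaceT.
Qed.

Lemma is_derive_approx_primitive n s : (0 < n)%N ->
  is_derive s 1 (approx_primitive n) (approx n s).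
Proof.
move=> n0; have n0' : 0 < n%:R^-1 :> R by rewrite invr_gt0 ltr0n.
suff d : is_derive s 1 (fun s => \int[mu]_(t in `[0, s]) approx n t) (approx n s).
  apply: (@is_derive_eq _ _ _ _ _ _ _ _
    (is_deriveB d (is_derive_cst (\int[mu]_(t in `[0, 1]) approx n t) s 1))).
  by rewrite subr0.
(* For negative [s] the interval [[0, s]] is empty and the integral is [0]. This fits, since
   [approx n] vanishes up to [1/n]. *)
have [s0|s0] := leP s 0.
  rewrite approx_support//; last by left; rewrite (le_trans s0)// ltW.
  apply: (@is_derive_near _ (cst 0)).
  near=> z; apply/esym.
  have zn : z <= n%:R^-1.
    by apply/ltW; near: z; apply: lt_nbhsl; exact: le_lt_trans n0'.
  rewrite (@eq_Rintegral_itv _ _ _ _ (cst 0)).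
    have [z0|z0] := leP 0 z; first by rewrite Rintegral_cstE// mul0r.
    by rewrite set_itv_ge ?Rintegral_set0// -leNgt bnd_simp.
  by move=> t /andP[_ tz]; rewrite approx_support//; left; exact: le_trans zn.
apply: (@is_derive_Rintegral_ub _ 0 (s + 1)).
- by rewrite s0 ltrDl ltr01.
- exact: approx_int.
- exact: approx_continuous.
Unshelve. all: by end_near. Qed.

Lemma approx_primitive_eq0 n s : (0 < n)%N -> 1 - n%:R^-1 <= s ->
  approx_primitive n s = 0.
Proof.
move=> n0 ns; have n1 : n%:R^-1 <= 1 :> R by rewrite invf_le1 ?ltr0n// ler1n.
have s0 : 0 <= s by lra.
have vanish (a b : R) : 1 - n%:R^-1 <= a -> a <= b -> \int[mu]_(t in `[a, b]) approx n t = 0.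
  move=> na ab; rewrite (@eq_Rintegral_itv _ _ _ _ (cst 0)).
    by rewrite Rintegral_cstE// mul0r.
  by move=> t /andP[at_ _]; rewrite approx_support//; right; exact: le_trans at_.
have n10 : 1 - n%:R^-1 <= 1 :> R by rewrite gerBl invr_ge0 ler0n.
rewrite /approx_primitive; have [s1|/ltW s1] := leP s 1.
  by rewrite [X in _ - X](Rintegral_split s0 s1) ?approx_int// (vanish s)// addr0 subrr.
by rewrite (Rintegral_split ler01 s1) ?approx_int// (vanish 1)// addr0 subrr.
Qed.

Definition approx_radial n r := approx_primitive n (r ^+ 2).

Lemma approx_radial_test n : (0 < n)%N -> radial_test (approx_radial n).
Proof.
move=> n0; have n1 : 0 < n%:R^-1 :> R by rewrite invr_gt0 ltr0n.
split.
  rewrite (_ : (fun x : R * R => _) =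
    (fun x : R * R => approx_primitive n (x.1 ^+ 2 + x.2 ^+ 2))).
    apply: elementary2_smooth; apply: elementary2_radial.
    apply: (elementary_primitive (g := approx n)); last exact: approx_elementary.
    by move=> x; exact: is_derive_approx_primitive.
  by apply/funext => x; rewrite /approx_radial sqr_sqrtr// addr_ge0 ?sqr_ge0.
exists (Num.sqrt (1 - n%:R^-1)).
  by rewrite -[ltRHS]sqrtr1 ltr_sqrt// gtrBl.
move=> r r0 rr; apply: approx_primitive_eq0 => //.
have n2 : 0 <= 1 - n%:R^-1 :> R by rewrite subr_ge0 invf_le1 ?ltr0n// ler1n.
rewrite -(sqr_sqrtr n2) ler_pXn2r// nnegrE sqrtr_ge0//.
Qed.

Lemma is_derive_approx_radial n r : (0 < n)%N ->
  is_derive r 1 (approx_radial n) (2 * r * approx n (r ^+ 2)).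
Proof.
move=> n0; have d1 := is_derive_pow 2 (is_derive_id r 1).
have d := @is_derive1_comp R _ (fun z => z ^+ 2) r _ _
  (is_derive_approx_primitive (r ^+ 2) n0) d1.
by apply: (@is_derive_eq _ _ _ _ _ _ _ _ d); rewrite expr1; ring.
Qed.

Lemma slope_int r s : 0 <= r -> s <= 1 -> mu.-integrable `[r, s] (EFin \o w).
Proof.
by move=> r0 s1; apply: (integrable_sub r0 s1); exact: (bounded_by_int w_bd).
Qed.

Definition approx_err n r := w r - 2 * r * approx n (r ^+ 2).

Lemma approx_slope_continuous n : continuous (fun r => 2 * r * approx n (r ^+ 2)).
Proof.
move=> x; apply: cvgM; first by apply: cvgM; [exact: cvg_cst|exact: cvg_id].
apply: (@continuous_comp _ _ _ (fun z : R => z ^+ 2) (approx n)).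
  exact: exprn_continuous.
exact: approx_continuous.
Qed.

Lemma approx_err_bounded n : bounded_by (3 * C) (approx_err n).
Proof.
split.
  apply: measurable_funB; first exact: w_bd.1.
  by apply: continuous_itv_measurable => x _; exact: approx_slope_continuous.
move=> r /[dup] r01 /andP[r0 r1]; rewrite (le_trans (ler_normB _ _))//.
have := w_bd.2 _ r01; have := approx_bound n r0; lra.
Qed.

Lemma norm_err_int n (a b : R) : 0 <= a -> b <= 1 ->
  mu.-integrable `[a, b] (EFin \o (fun r => `|approx_err n r|)).
Proof.
move=> a0 b1; apply: (integrable_sub a0 b1).
apply: (@integrable_norm _ _ _ mu _ (approx_err n)).
exact: (bounded_by_int (approx_err_bounded n)).
Qed.

(** Dominated convergence: the errors tend to zero inside the interval and are all bounded by
    [3 * C]. *)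
Lemma approx_err_cvg : (fun n => \int[mu]_(r in `[0, 1]) `|approx_err n r|) @ \oo --> 0.
Proof.
pose f_ n (r : R) := (`|approx_err n r|)%:E.
have mI : measurable (`]0, 1[%classic : set R) by exact: measurable_itv.
have sub : (`]0, 1[%classic : set R) `<=` `[0, 1].
  by move=> x /=; rewrite !in_itv/= => /andP[/ltW-> /ltW->].
have m_ n : measurable_fun (`]0, 1[%classic : set R) (f_ n).
  apply/measurable_EFinP; apply: measurableT_comp => //.
  exact: measurable_funS sub (approx_err_bounded n).1.
have [||||_ _ lim] := @dominated_convergence _ _ R mu _ mI f_ (cst 0%E) (cst (3 * C)%:E) m_.
- exact: measurable_cst.
- apply: aeW => r; rewrite /= in_itv/= => r01.
  apply: cvg_EFin; first by apply: nearW.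
  rewrite -[X in _ --> X](normr0 R); apply: cvg_norm.
  rewrite -(subrr (w r)); apply: cvgB; first exact: cvg_cst.
  exact: approx_cvg.
- by apply: integrableS (cst_integrable 0 1 (3 * C)).
- apply: aeW => r n /= /sub; rewrite /= in_itv/= => r01; rewrite /f_ lee_fin normr_id.
  exact: (approx_err_bounded n).2.
move: lim; rewrite integral0 => /fine_cvgP[_]; apply: cvg_trans.
apply: near_eq_cvg; apply: nearW => n /=.
have int := norm_err_int n (lexx 0) (lexx 1).
rewrite -[RHS]Rintegral_itv_bndo_bndc.
  rewrite -[RHS]Rintegral_itv_obnd_cbnd//.
  exact: integrableS int.
by apply: integrableS int => // x /=; rewrite !in_itv/= => /andP[-> /ltW].
Qed.

(** [u] and [approx_radial n] both vanish at [1], so the L^1 error [D n] of the derivatives bounds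
    the uniform error of the functions. The squared error of the derivatives is at most [3 * C]
    times the error itself. Convergence of the derivatives in L^1 is therefore enough. *)
Lemma W12o_primitive : W12o (fun r => - \int[mu]_(t in `[r, 1]) w t).
Proof.
set u := fun r => _.
have w01 : mu.-integrable `[0, 1] (EFin \o w) by exact: slope_int.
have du x : 0 < x < 1 -> is_derive x 1 u (w x).
  move=> x01; have d := is_derive_Rintegral_lb x01 w01 (w_cont x01).
  by apply: (@is_derive_eq _ _ _ _ _ _ _ _ (is_deriveN d)); rewrite opprK.
have u_bd : bounded_by C u.
  split.
    by apply: continuous_itv_measurable => x /du; exact: is_derive_continuous.
  move=> r /andP[r0 r1]; rewrite normrN (@le_trans _ _ (C * (1 - r)))//.
    apply: Rintegral_norm_le_cst => //; first exact: slope_int.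
    by move=> t /andP[rt t1]; apply: w_bd.2; rewrite t1 (le_trans r0).
  by rewrite ler_piMr ?slope_bound_ge0// gerBl.
exists w; split.
- exact: weak_deriv_classical.
- exact: bounded_L2r u_bd.
- exact: bounded_L2r w_bd.
move=> e e0.
pose D n := \int[mu]_(r in `[0, 1]) `|approx_err n r|.
have lim : (fun n => D n * D n + 3 * C * D n) @ \oo --> 0.
  rewrite -[X in _ --> X](_ : 0 * 0 + 3 * C * 0 = 0); last by ring.
  apply: cvgD; first by apply: cvgM; exact: approx_err_cvg.
  by apply: cvgM; [exact: cvg_cst|exact: approx_err_cvg].
have [n n0 De] : exists2 n, (0 < n)%N & D n * D n + 3 * C * D n < e.
  move/cvgrPdist_lt : lim => /(_ _ e0) => lim.
  near \oo => n; exists n; first by near: n; exact: nbhs_infty_gt.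
  have : `|0 - (D n * D n + 3 * C * D n)| < e by near: n; exact: lim.
  by rewrite sub0r normrN; apply: le_lt_trans; exact: ler_norm.
exists (approx_radial n); first exact: approx_radial_test.
have D0 : 0 <= D n by apply: Rintegral_itv_ge0.
have dphi r : derive1 (approx_radial n) r = 2 * r * approx n (r ^+ 2).
  by rewrite derive1E; have [_ ->] := is_derive_approx_radial r n0.
have cphi r : {for r, continuous (approx_radial n)}.
  exact: is_derive_continuous (is_derive_approx_radial r n0).
have uphi r : 0 <= r <= 1 -> `|u r - approx_radial n r| <= D n.
  move=> /andP[r0 r1].
  have i2 : mu.-integrable `[r, 1] (EFin \o (fun r => 2 * r * approx n (r ^+ 2))).
    apply: continuous_compact_integrable; first exact: segment_compact.
    by have h := @approx_slope_continuous n; exact: continuous_subspaceT.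
  have E : - approx_radial n r = \int[mu]_(t in `[r, 1]) (2 * t * approx n (t ^+ 2)).
    have phi1 : approx_radial n 1 = 0.
      by apply: approx_primitive_eq0 => //; rewrite expr1n gerBl invr_ge0 ler0n.
    move: r1; rewrite le_eqVlt => /predU1P[->|r1].
      by rewrite Rintegral_nil phi1 oppr0.
    rewrite -[LHS]add0r -phi1; apply/esym.
    apply: (@improper_FTC _ r 1 _ (approx_radial n)) => //.
    - by move=> x _; exact: approx_slope_continuous.
    - by move=> x _; exact: is_derive_approx_radial.
    - by apply: cvg_at_right_filter; exact: cphi.
    - by apply: cvg_at_left_filter; exact: cphi.
  have -> : u r - approx_radial n r = - \int[mu]_(t in `[r, 1]) approx_err n t.
    by rewrite /u E /approx_err RintegralB//; [ring|exact: slope_int].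
  have i3 : mu.-integrable `[r, 1] (EFin \o approx_err n).
    by apply: (integrable_sub r0 (lexx 1)); exact: (bounded_by_int (approx_err_bounded n)).
  rewrite normrN (le_trans (le_normr_Rintegral _ i3))//.
  rewrite /D (Rintegral_split r0 r1) ?norm_err_int// lerDr.
  exact: Rintegral_itv_ge0.
pose g r := ((u r - approx_radial n r) ^+ 2 +
  (w r - derive1 (approx_radial n) r) ^+ 2) * r.
have g_le r : 0 <= r <= 1 -> g r <= D n * D n + 3 * C * `|approx_err n r|.
  move=> /[dup] r01 /andP[r0 r1].
  have h1 : (u r - approx_radial n r) ^+ 2 <= D n * D n.
    by rewrite -real_normK ?num_real// -expr2 ler_pXn2r ?nnegrE ?uphi.
  have h2 : (w r - derive1 (approx_radial n) r) ^+ 2 <= 3 * C * `|approx_err n r|.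
    rewrite dphi -real_normK ?num_real// expr2 ler_wpM2r//.
    exact: (approx_err_bounded n).2.
  have := lerD h1 h2; apply: le_trans.
  by rewrite /g ler_piMr// addr_ge0 ?sqr_ge0.
have g_ge0 r : 0 <= r <= 1 -> 0 <= g r.
  by move=> /andP[r0 _]; rewrite /g; apply: mulr_ge0 => //; rewrite addr_ge0 ?sqr_ge0.
have g_int : mu.-integrable `[0, 1] (EFin \o g).
  apply: (@bounded_integrable _ _ _ (D n * D n + 3 * C * (3 * C))).
    apply: measurable_funM => //; apply: measurable_funD; apply: measurable_funX.
      apply: measurable_funB; first exact: u_bd.1.
      by apply: continuous_itv_measurable => x _; exact: cphi.
    apply: measurable_funB; first exact: w_bd.1.
    apply: continuous_itv_measurable => x _.
    rewrite (_ : derive1 _ = fun r => 2 * r * approx n (r ^+ 2)); last exact/funext.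
    exact: approx_slope_continuous.
  move=> r r01; rewrite ger0_norm ?g_ge0// (le_trans (g_le _ r01))// lerD2l.
  by rewrite ler_wpM2l ?mulr_ge0 ?slope_bound_ge0// (approx_err_bounded n).2.
rewrite -[X in (X < _)%E](@fineK R); last exact: integrable_fin_num.
rewrite lte_fin; apply: le_lt_trans De.
apply: (@le_trans _ _ (\int[mu]_(r in `[0, 1]) (D n * D n + 3 * C * `|approx_err n r|))).
  apply: (@le_Rintegral_itv _ _ _ g) => //.
  apply: integrable_addr => //; first exact: cst_integrable.
  by apply: integrable_scaler => //; exact: norm_err_int.
rewrite RintegralD//; first last.
- by apply: integrable_scaler => //; exact: norm_err_int.
- exact: cst_integrable.
rewrite Rintegral_cstE// subr0 mulr1 RintegralZl//.
exact: norm_err_int.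
Unshelve. all: by end_near. Qed.

End density.

(** * Two solutions *)

Section conclusion.
Context {R : realType}.
Local Notation mu := (@lebesgue_measure R).
Implicit Types (f h k u v : R -> R).

(** If the functions differed at [r], they would differ on a whole interval around it, which has
    positive measure. *)
Lemma ae_eq_continuous u v :
  (forall x, 0 < x < 1 -> {for x, continuous u}) ->
  (forall x, 0 < x < 1 -> {for x, continuous v}) ->
  {ae mu, forall r, 0 <= r <= 1 -> u r = v r} ->
  forall r, 0 < r < 1 -> u r = v r.
Proof.
move=> cu cv [A [mA A0 uvA]] r r01; apply/eqP; apply/negPn/negP => uvr.
have d0 : 0 < `|u r - v r| by rewrite normr_gt0 subr_eq0.
have /cvgrPdist_lt/(_ _ d0) near1 : {for r, continuous (fun x => u x - v x)}.
  by apply: cvgB; [exact: cu|exact: cv].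
have /nbhs_ballP[d /= d_gt0 hd] : \forall x \near r, A x.
  near=> x; apply: uvA => /= uvx.
  have x01 : 0 < x < 1 by near: x; exact: near_itvoo.
  have : `|u r - v r - (u x - v x)| < `|u r - v r| by near: x; exact: near1.
  case/andP: x01 => /ltW x0 /ltW x1.
  by rewrite uvx ?x0// subrr subr0 ltxx.
pose I : set R := `]r - d, r + d[%classic.
have : (mu I <= mu A)%E.
  apply: le_measure; rewrite ?inE//; first exact: measurable_itv.
  move=> x /=; rewrite /I /= in_itv/= => /andP[x1 x2]; apply: hd.
  by rewrite /ball/= ltr_norml; apply/andP; split; lra.
rewrite A0 lebesgue_measure_itv/= lte_fin ifT; last by lra.
by rewrite -EFinD lee_fin; lra.
Unshelve. all: by end_near. Qed.

Lemma radial_test_bounded (phi : R -> R) : radial_test phi ->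
  measurable_fun (`[0, 1] : set R) phi /\ [bounded phi x | x in (`[0, 1] : set R)].
Proof.
move=> /radial_test_profile [p0 [p1 [p2 [rho [dp _ _ phiE _]]]]].
have cp0 : continuous p0 by move=> x; exact: is_derive_continuous (dp x).1.
split.
  apply: (eq_measurable_fun p0).
    by move=> x; rewrite inE/= in_itv/= => /andP[x0 _]; rewrite phiE.
  by apply: continuous_itv_measurable => x _; exact: cp0.
have [|c _ hc] := @EVT_max R (fun r => `|p0 r|) 0 1 ler01.
  by apply: continuous_subspaceT => x; apply: cvg_norm; exact: cp0.
exists `|p0 c|; split; first exact: num_real.
move=> N MN x /= x01; have := hc _ x01; move: x01; rewrite in_itv/= => /andP[x0 _].
by rewrite phiE// => /le_trans; apply; exact: ltW.
Qed.

(* Equal to [f r * r] almost everywhere, and nonnegative everywhere. *)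
Definition source f r := Num.max 0 (f r) * r.

Lemma source_int f : L1r f -> mu.-integrable `[0, 1] (EFin \o source f).
Proof.
move=> [mf intf]; apply: le_integrable intf => //.
  apply/measurable_EFinP; apply: measurable_funM => //.
  exact: measurable_maxr.
move=> x _; rewrite /= lee_fin !normrM ler_wpM2r// maxEle.
by case: (leP 0 (f x)) => _; rewrite ?normr0 ?lexx.
Qed.

Lemma source_ge0 f r : 0 <= r -> 0 <= source f r.
Proof. by move=> r0; rewrite mulr_ge0// le_max lexx. Qed.

Lemma source_weak f lambda (phi : R -> R) : L1r f ->
  {ae mu, forall r, 0 <= r <= 1 -> 0 <= f r} -> radial_test phi ->
  lambda * \int[mu]_(r in `[0, 1]) (f r * phi r * r) =
  \int[mu]_(r in `[0, 1]) (lambda * source f r * phi r).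
Proof.
move=> hf f_ge0 /radial_test_bounded [mphi bphi].
have mI : measurable (`[0, 1] : set R) by exact: measurable_itv.
have int : mu.-integrable `[0, 1] (EFin \o (fun r => source f r * phi r)).
  have := @integrableMl _ _ R mu _ mI _ _ (source_int hf) mphi bphi.
  by apply: eq_integrable => // t _; rewrite /= EFinM.
rewrite [RHS](_ : _ = lambda * \int[mu]_(r in `[0, 1]) (source f r * phi r)).
  congr (_ * _); congr fine; apply: ae_eq_integral => //.
  - apply/measurable_EFinP; apply: measurable_funM => //.
    by apply: measurable_funM => //; case: hf.
  - exact: measurable_int int.
  - move: f_ge0; apply: filterS; first exact: (ae_filter_ringOfSetsType mu).
    move=> r fr /= r01; congr _%:E.
    rewrite /source (max_idPr _); first by ring.
    by apply: fr; move: r01; rewrite in_itv.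
rewrite -RintegralZl//; apply: eq_Rintegral => r _; by rewrite -mulrA.
Qed.

Lemma profile_solution f lambda k : L1r f ->
  {ae mu, forall r, 0 <= r <= 1 -> 0 <= f r} -> 0 < lambda ->
  profile (fun r => lambda * source f r) k ->
  navier_solution f lambda (radial_sol k).
Proof.
move=> hf f_ge0 lambda0 [k_meas [C k_bd] k_eq].
set h := fun r => lambda * source f r in k_eq.
have h_int : mu.-integrable `[0, 1] (EFin \o h).
  by apply: integrable_scaler => //; exact: source_int.
have h_ge0 r : 0 <= r <= 1 -> 0 <= h r.
  by move=> /andP[r0 _]; rewrite mulr_ge0 ?source_ge0// ltW.
split.
  split; first exact: (radial_sol_W22 h_int h_ge0 k_meas k_bd k_eq).
  apply: (@W12o_primitive _ _ C).
    exact: (slope1_continuous h_int h_ge0 k_meas k_bd k_eq).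
  exact: (slope1_bounded h_int h_ge0 k_meas k_bd k_eq).
exists (slope1 k), (slope2 k); split.
- exact: (weak_deriv_radial_sol h_int h_ge0 k_meas k_bd k_eq).
- exact: (weak_deriv_slope1 h_int h_ge0 k_meas k_bd k_eq).
- move=> phi tphi; rewrite (source_weak _ hf f_ge0 tphi).
  exact: (weak_form h_int h_ge0 k_meas k_bd k_eq tphi).
- split.
  + exact: (slope1_boundary0 k_meas k_bd).
  + exact: (radial_sol_trace h_int h_ge0 k_meas k_bd k_eq).
  + exact: (laplacian_trace h_int h_ge0 k_meas k_bd k_eq).
Qed.

(** Solutions equal almost everywhere are equal inside the interval by continuity. Their derivatives
    then agree, and [moment k] is [- r u']. *)
Lemma radial_sol_inj h k1 k2 : mu.-integrable `[0, 1] (EFin \o h) ->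
  (forall r, 0 <= r <= 1 -> 0 <= h r) -> profile h k1 -> profile h k2 ->
  {ae mu, forall r, 0 <= r <= 1 -> radial_sol k1 r = radial_sol k2 r} ->
  forall r, 0 < r < 1 -> moment k1 r = moment k2 r.
Proof.
move=> h_int h_ge0 [m1 [C1 b1] e1] [m2 [C2 b2] e2] u12 r r01.
have d1 (x : R) (x01 : 0 < x < 1) := is_derive_radial_sol h_int h_ge0 m1 b1 e1 x01.
have d2 (x : R) (x01 : 0 < x < 1) := is_derive_radial_sol h_int h_ge0 m2 b2 e2 x01.
have E := ae_eq_continuous (fun x x01 => is_derive_continuous (d1 x x01))
                           (fun x x01 => is_derive_continuous (d2 x x01)) u12.
have [_ D1] := d1 r r01; have [_ D2] := d2 r r01.
have : slope1 k1 r = slope1 k2 r.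
  rewrite -D1 -D2; apply: near_eq_derive; near=> x; apply: E.
  by near: x; exact: near_itvoo.
rewrite /slope1 => /oppr_inj /(congr1 (fun z => z * r)).
by case/andP: r01 => r0 _; rewrite !divfK// gt_eqF.
Unshelve. all: by end_near. Qed.

End conclusion.

Theorem theorem3p2 (R : realType) (f : R -> R)
    (hf : L1r f)
    (f_ge0 : {ae @lebesgue_measure R, forall r, 0 <= r <= 1 -> 0 <= f r}) :
  exists2 lambda_c : R, 0 < lambda_c &
    forall lambda : R, 0 < lambda < lambda_c ->
      exists u1 u2 : R -> R,
        [/\ navier_solution f lambda u1,
            navier_solution f lambda u2 &
            ~ {ae @lebesgue_measure R, forall r, 0 <= r <= 1 -> u1 r = u2 r}].
Proof.
pose F1 := mass (source f) 1.
have F10 : 0 <= F1.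
  by apply: Rintegral_itv_ge0 => r /andP[r0 _]; exact: source_ge0.
(* Chosen so that [4 * lambda * F1 <= 1/8]; adding [1] to [F1] keeps the threshold finite when the
   source vanishes. *)
exists (32 * (F1 + 1))^-1 => [|lambda /andP[lambda0 lambda1]].
  by rewrite invr_gt0 mulr_gt0// ltr_wpDl.
pose h r := lambda * source f r.
have h_int : lebesgue_measure.-integrable `[0, 1] (EFin \o h).
  by apply: integrable_scaler => //; exact: source_int.
have h_ge0 r : 0 <= r <= 1 -> 0 <= h r.
  by move=> /andP[r0 _]; rewrite mulr_ge0 ?source_ge0// ltW.
have h_small : 4 * mass h 1 <= 8^-1.
  rewrite /mass /h RintegralZl//; last exact: source_int.
  rewrite -/(mass (source f) 1) -/F1.
  have := ltW lambda1; rewrite -[_^-1]div1r ler_pdivlMr ?mulr_gt0 ?ltr_wpDl//.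
  by rewrite mulrCA mulrDr mulr1; lra.
have [k1 [k2 [p1 p2 k12]]] := two_profiles h_int h_ge0 h_small.
exists (radial_sol k1), (radial_sol k2); split.
- exact: (profile_solution hf f_ge0 lambda0 p1).
- exact: (profile_solution hf f_ge0 lambda0 p2).
- by move=> /(radial_sol_inj h_int h_ge0 p1 p2).
Qed.
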